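(* Let $m$ be a positive integer and let $n$ be a positive squarefree integer relatively prime to $m$. Let $\mathcal{L}\subset V(\mathbb{Z})$ be a set defined by congruence conditions modulo $m$. Then for real $X,Y>0$, each choice of sign $\pm$, and every $\epsilon>0$, \[ \#\{f\in\mathcal{L}\cap\Sigma_n: 0<\pm\Delta(f)<X,\ h(f)<Y\}=\nu(\mathcal{L})\,\nu(\Sigma_n)\,\mathrm{Vol}\bigl(V(\mathbb{R})^\pm_{X,Y}\bigr)+O_\epsilon\bigl(Y^3m/n^{1-\epsilon}+Y^2mn^\epsilon\bigr). \]
   Context: For a ring $R$, $V(R)$ is the set of monic cubic polynomials $x^3+tx^2+Ax+B$ with $t\in\{-1,0,1\}$ and $A,B\in R$; $\Delta(f)$ is the discriminant and $h(f)$ is the maximum absolute value of the complex roots of $f$. For $f\in V(\mathbb{Z})$ with $\Delta(f)\ne0$, $\mathrm{ind}(f)$ is the index of $\mathbb{Z}[x]/(f)$ in the ring of integral elements of $\mathbb{Q}[x]/(f)$. $\Sigma_n$ is the set of $f\in V(\mathbb{Z})$ with $\Delta(f)\neq0$ and $n\mid\mathrm{ind}(f)$. For $S\subset V(\mathbb{Z})$, $\nu(S)$ is the measure of the closure of $S$ in $V(\hat{\mathbb{Z}})=\{-1,0,1\}\times\hat{\mathbb{Z}}^2$ with respect to the probability measure (uniform in $t$, normalized Haar in $(A,B)$). $V(\mathbb{R})^\pm_{X,Y}$ is the set of $f\in V(\mathbb{R})$ with $\pm\Delta(f)>0$, $|\Delta(f)|<X$ and $h(f)<Y$; its volume is taken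 with respect to counting measure in $t$ times Lebesgue measure in $(A,B)$. *)

(* Defs.v *)
From HB Require Import structures.
From mathcomp Require Import all_boot all_order all_algebra.
From mathcomp Require Import all_classical all_reals all_analysis.
From mathcomp Require Import complex finmap.

Set Implicit Arguments.
Unset Strict Implicit.
Unset Printing Implicit Defensive.

Import Order.TTheory GRing.Theory Num.Theory.
Local Open Scope classical_set_scope.
Local Open Scope ring_scope.

(* V(R): monic cubics x^3 + t x^2 + A x + B, t in {-1,0,1}.               *)
(* The coefficient t is encoded by i : 'I_3, with t = i - 1.              *)

Definition tval (i : 'I_3) : int := (i : nat)%:Z - 1.

Definition VZ := ('I_3 * int * int)%type.
Definition tcoef (f : VZ) : int := tval f.1.1.
Definition Acoef (f : VZ) : int := f.1.2.
Definition Bcoef (f : VZ) : int := f.2.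

Definition cubic (R : nzRingType) (t A B : R) : {poly R} :=
  'X^3 + t%:P * 'X^2 + A%:P * 'X + B%:P.

Definition disc (R : comNzRingType) (t A B : R) : R :=
  t ^+ 2 * A ^+ 2 - 4 * A ^+ 3 - 4 * t ^+ 3 * B - 27 * B ^+ 2
  + 18 * t * A * B.

Definition discZ (f : VZ) : int := disc (tcoef f) (Acoef f) (Bcoef f).

(* h(f) = maximum absolute value of the complex roots of f (the set of
   roots is finite and nonempty, so its supremum is its maximum). *)
Definition hR (R : realType) (t A B : R) : R :=
  sup [set Normc.normc z | z in
        [set z : R[i] | root (map_poly (real_complex R) (cubic t A B)) z]].

Definition hZ (R : realType) (f : VZ) : R :=
  hR (tcoef f)%:~R (Acoef f)%:~R (Bcoef f)%:~R.

(* ind(f): index of Z[x]/(f) in the ring of integral elements of Q[x]/(f). *)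
(* Q[x]/(f) is represented by polynomials over rat of size <= 3 (reduced   *)
(* representatives); an element p is integral iff g(p) = 0 in Q[x]/(f)    *)
(* for some monic g in Z[x], i.e. f divides g(p(x)) in Q[x].               *)

Definition fQ (f : VZ) : {poly rat} :=
  cubic (tcoef f)%:~R (Acoef f)%:~R (Bcoef f)%:~R.

Definition integral_elt (f : VZ) (p : {poly rat}) : Prop :=
  (size p <= 3)%N /\
  exists g : {poly int}, g \is monic /\ fQ f %| (map_poly intr g \Po p).

(* p and q lie in the same coset of Z[x]/(f) (= Z-combinations of
   1, x, x^2) *)
Definition same_coset (p q : {poly rat}) : Prop :=
  p - q \is a polyOver Num.int.

Definition is_ind (f : VZ) (k : nat) : Prop :=
  exists s : seq {poly rat},
    [/\ size s = k,
        (forall p, p \in s -> integral_elt f p),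
        (forall i j, (i < size s)%N -> (j < size s)%N -> i <> j ->
             ~ same_coset (nth 0 s i) (nth 0 s j)) &
        (forall p, integral_elt f p -> exists2 q, q \in s & same_coset p q)].

Definition Sigma (n : nat) : set VZ :=
  [set f | discZ f != 0 /\ exists k, is_ind f k /\ (n %| k)%N].

(* nu(S): Haar measure of the closure of S in V(Zhat).                     *)
(* The closure of S is the decreasing intersection over N of the          *)
(* preimages of the reductions S mod N, so its measure is                 *)
(*   inf_N #(S mod N) / (3 N^2).                                          *)

Definition redZ (k : nat) (a : int) : 'I_k.+1 :=
  inord (absz (a %% (k.+1)%:Z)%Z).

Definition redV (k : nat) (f : VZ) : 'I_3 * 'I_k.+1 * 'I_k.+1 :=
  (f.1.1, redZ k (Acoef f), redZ k (Bcoef f)).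

Definition red_density (R : realType) (S : set VZ) (k : nat) : R :=
  (#|[set x : 'I_3 * 'I_k.+1 * 'I_k.+1 | `[< exists2 f, S f & redV k f = x >]]|)%:R
  / (3 * (k.+1) ^ 2)%:R.

Definition nu (R : realType) (S : set VZ) : R :=
  inf (range (red_density R S)).

Definition congruence_mod (m : nat) (L : set VZ) : Prop :=
  forall f g : VZ, f.1.1 = g.1.1 ->
    (Acoef f == Acoef g %[mod m%:Z])%Z -> (Bcoef f == Bcoef g %[mod m%:Z])%Z ->
    (L f <-> L g).

Definition squarefree (n : nat) : Prop :=
  forall p : nat, prime p -> ~~ (p * p %| n)%N.

(* s = +1 or -1 encodes the sign.                                         *)

Definition VR_region (R : realType) (s X Y : R) (i : 'I_3) : set (R * R) :=
  [set AB | 0 < s * disc (tval i)%:~R AB.1 AB.2 /\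
            `|disc (tval i)%:~R AB.1 AB.2| < X /\
            hR (tval i)%:~R AB.1 AB.2 < Y].

Definition VolR (R : realType) (s X Y : R) : \bar R :=
  (\sum_(i < 3)
     ((@lebesgue_measure R) \x (@lebesgue_measure R)) (VR_region s X Y i))%E.

Definition countV (S : set VZ) : nat := (#|` fset_set S|)%fset.

Definition sgnb (R : numDomainType) (b : bool) : R := if b then 1 else -1.

(* Main.v *)
(* A squarefree [n] divides the index of a cubic [f] with nonzero discriminant iff there is [r]
   with [n | f'(r)] and [n^2 | f(r)], and such an [r] is unique modulo [n]. Hence the cubics in
   [Sigma n] are a union over [r] mod [n] of congruence conditions [A = -3r^2 - 2tr mod n] and
   [B = -r^3 - tr^2 - Ar mod n^2]. For a bound [Y >= 1] the condition [h(f) < Y] is semialgebraic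
   in [(A, B)] (Jury's criterion), so that the lattice points of each such progression are counted
   slice by slice, with an error bounded by the number of breakpoints of a slice. For a given [A]
   the number of relevant [r] is [O(n^eps)], which gives the error [Y^2 m n^eps]; the other error
   terms are at most [Y^3 m / n]. Since [L] need not be equidistributed in [t], one also has to
   compare the three volumes obtained for [t = -1, 0, 1]; they differ by [O(Y^3)]. For [Y < 1] no
   integral cubic qualifies, and the main term is itself [O(Y^3 / n^2)]. *)
Require Import Defs.
From HB Require Import structures.
From mathcomp Require Import finmap.
From mathcomp Require Import all_boot all_order all_algebra all_fingroup all_solvable all_field.
From mathcomp Require Import all_classical all_reals all_analysis measurable_realfun.
From mathcomp Require Import complex ring lra zify.

Set Implicit Arguments.
Unset Strict Implicit.
Unset Printing Implicit Defensive.

Import Order.TTheory GRing.Theory Num.Theory.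
Import numFieldNormedType.Exports.
Local Open Scope classical_set_scope.
Local Open Scope ring_scope.

(** * The index and double roots *)

(** The delicate point is the comparison of the three volumes. In the coordinates of the depressed
    cubic ([a = A - t^2/3] and a translate [b] of [B]) the discriminant conditions no longer involve
    [t], but the ends of a slice that come from the root bound still move by [O(Y^2)]. Over [O(Y^2)]
    slices this alone would give [O(Y^4)], which exceeds the allowed error already for fixed [m] and
    [n]. The missing factor [Y] comes from the symmetry [b -> -b] of the discriminant: to first
    order one end of a slice gains what the other loses. This fails only on the [O(Y)] slices where
    two bounding curves nearly cross. The index is given as the length of a list of coset
    representatives. Cosets of integral elements form a subgroup of a group of residues modulo the
    discriminant, so Cauchy's theorem turns a prime divisor [p] of the index into an integral
    fraction [u/p], which is then studied through its values at the three roots in [algC]. In the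
    lattice count the class of [B] depends on [A], so [B] is counted first, with an absolute error
    for each pair of [A] and [r]. *)

Ltac rpred_auto := repeat (first [assumption | apply: rpredB | apply: rpredD | apply: rpredM | apply: rpredX | apply: rpredN]).

Lemma map_cubic (R S : nzRingType) (g : {rmorphism R -> S}) (t A B : R) :
  map_poly g (cubic t A B) = cubic (g t) (g A) (g B).
Proof.
rewrite /cubic !rmorphD /= map_polyXn.
by rewrite ![map_poly _ (_ * _)]rmorphM /= !map_polyXn !map_polyC !map_polyX.
Qed.

Lemma cubic_horner (R : comNzRingType) (t A B x : R) :
  (cubic t A B).[x] = x ^+ 3 + t * x ^+ 2 + A * x + B.
Proof. by rewrite /cubic !hornerE. Qed.

Lemma size_cubic_tail (R : nzRingType) (t A B : R) :
  (size (t%:P * 'X^2 + A%:P * 'X + B%:P)%R < 4)%N.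
Proof.
apply: leq_ltn_trans (size_polyD _ _) _.
rewrite gtn_max; apply/andP; split; last first.
  exact: leq_ltn_trans (size_polyC_leq1 _) _.
apply: leq_ltn_trans (size_polyD _ _) _; rewrite gtn_max; apply/andP; split.
  by rewrite mul_polyC; apply: leq_ltn_trans (size_scale_leq _ _) _; rewrite size_polyXn.
by rewrite mul_polyC; apply: leq_ltn_trans (size_scale_leq _ _) _; rewrite size_polyX.
Qed.

Lemma size_cubic (R : nzRingType) (t A B : R) : size (cubic t A B) = 4%N.
Proof.
by rewrite /cubic -!addrA size_polyDl size_polyXn // addrA size_cubic_tail.
Qed.

Lemma cubic_monic (R : nzRingType) (t A B : R) : cubic t A B \is monic.
Proof.
apply/monicP; rewrite /cubic -!addrA lead_coefDl ?lead_coefXn //.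
by rewrite size_polyXn addrA size_cubic_tail.
Qed.

Lemma cubic_coef_inj (R : nzRingType) (t A B t' A' B' : R) :
  cubic t A B = cubic t' A' B' -> [/\ t = t', A = A' & B = B'].
Proof.
move=> /polyP E; split.
- by have := E 2; rewrite /cubic !coefD !coefCM !coefXn !coefX !coefC /= !(mulr0,mulr1,addr0,add0r).
- by have := E 1%N; rewrite /cubic !coefD !coefCM !coefXn !coefX !coefC /= !(mulr0,mulr1,addr0,add0r).
- by have := E 0%N; rewrite /cubic !coefD !coefCM !coefXn !coefX !coefC /= !(mulr0,mulr1,addr0,add0r).
Qed.

Lemma cubic_vieta (R : comNzRingType) (x y z : R) :
  cubic (- (x + y + z)) (x * y + x * z + y * z) (- (x * y * z)) =
  ('X - x%:P) * ('X - y%:P) * ('X - z%:P).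
Proof. by rewrite /cubic !(polyCN, polyCD, polyCM); ring. Qed.

Lemma cubic_split (F : closedFieldType) (t A B : F) :
  exists x y z, [/\ t = - (x + y + z), A = x * y + x * z + y * z & B = - (x * y * z)].
Proof.
have [rs E] := closed_field_poly_normal (cubic t A B).
rewrite (monicP (cubic_monic _ _ _)) scale1r in E.
have := size_cubic t A B; rewrite E size_prod_XsubC.
case: rs E => [|x [|y [|z [|w rs]]]] // E _.
exists x, y, z; apply: cubic_coef_inj; rewrite cubic_vieta E.
by rewrite !big_cons big_nil mulr1 mulrA.
Qed.

Lemma disc_vieta (R : comNzRingType) (x y z : R) :
  disc (- (x + y + z)) (x * y + x * z + y * z) (- (x * y * z)) =
  ((x - y) * (x - z) * (y - z)) ^+ 2.
Proof. rewrite /disc; ring. Qed.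

Lemma rmorph_disc (R S : comNzRingType) (g : {rmorphism R -> S}) (t A B : R) :
  g (disc t A B) = disc (g t) (g A) (g B).
Proof.
rewrite /disc !(rmorphD, rmorphB, rmorphN) /= ![g (_ * _)]rmorphM /= ?rmorph_nat; ring.
Qed.

(** * Integrality tested at the three complex roots *)

Definition evC (p : {poly rat}) (w : algC) : algC := (map_poly ratr p).[w].

Lemma evCD p q w : evC (p + q) w = evC p w + evC q w.
Proof. by rewrite /evC rmorphD hornerD. Qed.

(** A rational algebraic integer is an integer. In this way norms of integral elements become
    divisibility statements. *)
Lemma Cint_Aint_dvd (z d : int) : d != 0 ->
  (z%:~R / d%:~R : algC) \in Aint -> (d %| z)%Z.
Proof.
move=> d0 zA.
have: (z%:~R / d%:~R : algC) \in Num.int.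
  by apply: Cint_rat_Aint => //; apply: rpred_div; apply: rpred_int.
move=> /intrP[k]; move/(canRL (mulfVK _)); rewrite intr_eq0 => /(_ d0) E.
apply/dvdzP; exists k; apply/eqP.
by rewrite -(eqr_int algC) E rmorphM.
Qed.

Section OneCubic.
Variables (f : VZ) (x y z : algC).
Hypothesis f0 : discZ f != 0.
Let t := tcoef f. Let A := Acoef f. Let B := Bcoef f.
Hypothesis Et : t%:~R = - (x + y + z).
Hypothesis EA : A%:~R = x * y + x * z + y * z.
Hypothesis EB : B%:~R = - (x * y * z).

Lemma fQC : map_poly ratr (fQ f) = ('X - x%:P) * ('X - y%:P) * ('X - z%:P).
Proof. by rewrite /fQ map_cubic /= !ratr_int -cubic_vieta -Et -EA -EB. Qed.

Lemma discC : (discZ f)%:~R = ((x - y) * (x - z) * (y - z)) ^+ 2.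
Proof. by rewrite /discZ rmorph_disc -disc_vieta -Et -EA -EB. Qed.

Lemma uniq_xyz : uniq [:: x; y; z].
Proof.
have : (discZ f)%:~R != 0 :> algC by rewrite intr_eq0.
rewrite discC expf_eq0 /= !mulf_eq0 !subr_eq0 !negb_or => /andP[/andP[xy xz] yz].
by rewrite /= xy xz yz.
Qed.

(** The roots are distinct because the discriminant is nonzero, so [f] divides every polynomial over
    [algC] that vanishes at all three. When the three values are algebraic integers, the product of
    their minimal polynomials is a monic integral annihilator. *)
Lemma integral_eltE (p : {poly rat}) : integral_elt f p <->
  (size p <= 3)%N /\ {in [:: x; y; z], forall w, evC p w \in Aint}.
Proof.
split=> [[sp [g [gm /dvdpP[q E]]]]|[sp vA]]; split=> //.
  move=> w wx.
  have gC (h : {poly int}) : map_poly ratr (map_poly intr h) = map_poly intr h :> {poly algC}.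
    by rewrite -map_poly_comp; apply: eq_map_poly => k /=; rewrite ratr_int.
  apply: (@root_monic_Aint (map_poly intr g)); last 2 first.
  - exact: monic_map.
  - by apply/polyOverP => i; rewrite coef_map; apply: intr_int.
  rewrite -gC /root /evC -horner_comp -map_comp_poly E rmorphM /= hornerM fQC !hornerM !hornerXsubC.
  by move: wx; rewrite !inE => /or3P[] /eqP ->; rewrite subrr !(mul0r, mulr0).
have G (v : algC) : v \in Aint -> exists g : {poly int}, g \is monic /\ root (map_poly intr g) v.
  move=> /floorpP[g E]; exists g; split; last by rewrite -E root_minCpoly.
  have := minCpoly_monic v; rewrite E => /monicP.
  rewrite lead_coef_map_inj //; last exact: intr_inj.
  by move=> /eqP; rewrite (eqr_int _ _ 1) => /eqP/monicP.
have [|gx [mx rx]] := G (evC p x); first by apply: vA; rewrite !inE eqxx.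
have [|gy [my ry]] := G (evC p y); first by apply: vA; rewrite !inE eqxx orbT.
have [|gz [mz rz]] := G (evC p z); first by apply: vA; rewrite !inE eqxx !orbT.
exists (gx * gy * gz); split; first by rewrite !monicMr.
rewrite -(dvdp_map (ratr : {rmorphism rat -> algC})) fQC map_comp_poly.
have -> : map_poly ratr (map_poly intr (gx * gy * gz)) = map_poly intr (gx * gy * gz) :> {poly algC}.
  by rewrite -map_poly_comp; apply: eq_map_poly => k /=; rewrite ratr_int.
have := @uniq_roots_dvdp algC (map_poly intr (gx * gy * gz) \Po map_poly ratr p) [:: x; y; z].
rewrite !big_cons big_nil mulr1 mulrA; apply; last by rewrite uniq_rootsE uniq_xyz.
by rewrite /= andbT /root !horner_comp -!/(evC _ _) !rmorphM !hornerM /=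
  (rootP rx) (rootP ry) (rootP rz) !(mul0r, mulr0) eqxx.
Qed.
End OneCubic.

Lemma evC3 (p : {poly rat}) w : (size p <= 3)%N ->
  evC p w = ratr p`_0 + ratr p`_1 * w + ratr p`_2 * w ^+ 2.
Proof.
move=> sp; have sp' : (size (map_poly ratr p : {poly algC}) <= 3)%N by rewrite size_map_poly.
rewrite /evC (horner_coef_wide _ sp').
by rewrite !big_ord_recr big_ord0 /= !coef_map /= add0r expr0 expr1 mulr1.
Qed.

Lemma evC_quad (k b c : rat) w :
  evC (k *: ('X^2 + b%:P * 'X + c%:P)) w = ratr k * (w ^+ 2 + ratr b * w + ratr c).
Proof.
rewrite /evC map_polyZ hornerZ !rmorphD /= map_polyXn [map_poly _ (_ * _)]rmorphM /=.
by rewrite !map_polyC map_polyX !hornerE.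
Qed.

Lemma discZ_vieta (f : VZ) : exists x y z : algC,
  [/\ (tcoef f)%:~R = - (x + y + z), (Acoef f)%:~R = x * y + x * z + y * z
    & (Bcoef f)%:~R = - (x * y * z)].
Proof. exact: cubic_split. Qed.

Lemma root_Aint (f : VZ) (x y z : algC) :
  (tcoef f)%:~R = - (x + y + z) -> (Acoef f)%:~R = x * y + x * z + y * z ->
  (Bcoef f)%:~R = - (x * y * z) -> {in [:: x; y; z], forall w, w \in Aint}.
Proof.
move=> Et EA EB w wx.
apply: (@root_monic_Aint (cubic (tcoef f)%:~R (Acoef f)%:~R (Bcoef f)%:~R)); last 2 first.
- exact: cubic_monic.
- by rewrite -(map_cubic (intr : {rmorphism int -> algC})); apply/polyOverP => i; rewrite coef_map; apply: intr_int.
rewrite Et EA EB cubic_vieta /root !hornerE.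
by move: wx; rewrite !inE => /or3P[] /eqP ->; rewrite subrr !(mul0r, mulr0).
Qed.

(* Lagrange interpolation at the three roots: the denominators divide the discriminant. *)
Lemma integral_elt_disc (f : VZ) (p : {poly rat}) : discZ f != 0 ->
  integral_elt f p -> (discZ f)%:~R *: p \is a polyOver Num.int.
Proof.
move=> f0; have [x [y [z [Et EA EB]]]] := discZ_vieta f.
move=> /(integral_eltE f0 Et EA EB)[sp vA].
have rA := root_Aint Et EA EB.
have [x1 y1 z1] : [/\ x \in Aint, y \in Aint & z \in Aint].
  by split; apply: rA; rewrite !inE eqxx ?orbT.
have [x2 y2 z2] : [/\ evC p x \in Aint, evC p y \in Aint & evC p z \in Aint].
  by split; apply: vA; rewrite !inE eqxx ?orbT.
have H (q : rat) : (discZ f)%:~R * ratr q \in Aint -> (discZ f)%:~R * q \in Num.int.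
  move=> qA; have: (ratr ((discZ f)%:~R * q) : algC) \in Num.int.
    by apply: Cint_rat_Aint; [exact: Crat_rat | rewrite rmorphM /= ratr_int].
  move=> /intrP[k E]; apply/intrP; exists k.
  by apply: (@fmorph_inj _ _ (ratr : {rmorphism rat -> algC})); rewrite /= E ratr_int.
apply/polyOverP => i; rewrite coefZ.
case: (ltnP i 3) => i3; last by rewrite (nth_default _ (leq_trans sp i3)) mulr0 rpred0.
apply: H; rewrite (discC Et EA EB).
move: x2 y2 z2; rewrite !(evC3 _ sp).
set c0 := ratr p`_0; set c1 := ratr p`_1; set c2 := ratr p`_2.
set V := (x - y) * (x - z) * (y - z).
set v1 := c0 + _ + _; set v2 := c0 + _ + _; set v3 := c0 + _ + _ => x2 y2 z2.
have VA : V \in Aint by rewrite !rpredM ?rpredB.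
move: i3; case: i => [|[|[|//]]] _; rewrite -/c0 -/c1 -/c2.
- have -> : V ^+ 2 * c0 = V * (v1 * ((y - z) * y * z) - v2 * ((x - z) * x * z) + v3 * ((x - y) * x * y)).
    by rewrite /V /v1 /v2 /v3; ring.
  by rpred_auto.
- have -> : V ^+ 2 * c1 = V * (v2 * ((x - z) * (x + z)) - v1 * ((y - z) * (y + z)) - v3 * ((x - y) * (x + y))).
    by rewrite /V /v1 /v2 /v3; ring.
  by rpred_auto.
- have -> : V ^+ 2 * c2 = V * (v1 * (y - z) - v2 * (x - z) + v3 * (x - y)).
    by rewrite /V /v1 /v2 /v3; ring.
  by rpred_auto.
Qed.

Lemma integral_eltD f p q : discZ f != 0 ->
  integral_elt f p -> integral_elt f q -> integral_elt f (p + q).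
Proof.
move=> f0; have [x [y [z [Et EA EB]]]] := discZ_vieta f.
rewrite !(integral_eltE f0 Et EA EB) => -[sp pA] [sq qA]; split.
  by rewrite (leq_trans (size_polyD _ _)) // geq_max sp.
by move=> w wx; rewrite evCD rpredD ?pA ?qA.
Qed.

Lemma integral_elt_int f (p : {poly rat}) : discZ f != 0 ->
  (size p <= 3)%N -> p \is a polyOver Num.int -> integral_elt f p.
Proof.
move=> f0 sp /polyOverP pZ; have [x [y [z [Et EA EB]]]] := discZ_vieta f.
rewrite (integral_eltE f0 Et EA EB); split=> // w /(root_Aint Et EA EB) wA.
have H i : ratr p`_i \in Aint.
  by have /intrP[k ->] := pZ i; rewrite ratr_int Aint_int.
rewrite evC3 //; apply: rpredD; [apply: rpredD; [exact: H | apply: rpredM; [exact: H | by []]] | apply: rpredM; [exact: H | exact: rpredX]].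
Qed.

Lemma same_coset_integral f (p q : {poly rat}) : discZ f != 0 ->
  integral_elt f p -> (size q <= 3)%N -> same_coset p q -> integral_elt f q.
Proof.
move=> f0 pI sq pq; have -> : q = p + (q - p) by ring.
have sp : (size p <= 3)%N by case: pI.
apply: integral_eltD => //; apply: integral_elt_int => //.
  by rewrite (leq_trans (size_polyD _ _)) // size_polyN geq_max sp sq.
by apply/polyOverP => i; rewrite -[q - p]opprB coefN rpredN; apply: (polyOverP pq).
Qed.

(* The Dedekind criterion, in the easy direction: [q] generates an order strictly
   containing [Z[x]/(f)]. *)
Lemma double_root_integral (f : VZ) (p : nat) (r : int) : prime p -> discZ f != 0 ->
  let t := tcoef f in let A := Acoef f in let B := Bcoef f in
  (p%:Z %| 3 * r ^+ 2 + 2 * t * r + A)%Z ->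
  (p%:Z ^+ 2 %| r ^+ 3 + t * r ^+ 2 + A * r + B)%Z ->
  exists b c : int, integral_elt f ((p%:R)^-1 *: ('X^2 + b%:~R%:P * 'X + c%:~R%:P)).
Proof.
move=> pp f0 t A B /dvdzP[b' Eb] /dvdzP[c' Ec].
pose a := 3 * r + t.
(* With [y = X - r] this is [(y^2 + a*y)/p], where [f = y^3 + a*y^2 + b'*p*y + c'*p^2]. Multiplying
   by [y] and using [f = 0] cancels the denominator, which gives [h1] below. *)
exists (a - 2 * r), (r ^+ 2 - a * r).
have [x [y [z [Et EA EB]]]] := discZ_vieta f.
have sq : (size ((p%:R)^-1 *: ('X^2 + (a - 2 * r)%:~R%:P * 'X + (r ^+ 2 - a * r)%:~R%:P) : {poly rat})%R <= 3)%N.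
  apply: leq_trans (size_scale_leq _ _) _.
  apply: leq_trans (size_polyD _ _) _; rewrite geq_max; apply/andP; split; last first.
    exact: leq_trans (size_polyC_leq1 _) _.
  apply: leq_trans (size_polyD _ _) _; rewrite geq_max size_polyXn leqnn /= mul_polyC.
  by apply: leq_trans (size_scale_leq _ _) _; rewrite size_polyX.
rewrite (integral_eltE f0 Et EA EB); split=> // w wx.
move: Et EA EB; rewrite -/t -/A -/B; clearbody t A B => Et EA EB.
have p0 : (p%:R : algC) != 0 by rewrite pnatr_eq0 -lt0n prime_gt0.
have fw : w ^+ 3 + t%:~R * w ^+ 2 + A%:~R * w + B%:~R = 0.
  by rewrite Et EA EB; move: wx; rewrite !inE => /or3P[] /eqP ->; ring.
set v := evC _ w.
have Ev : v = ((w - r%:~R) ^+ 2 + a%:~R * (w - r%:~R)) / p%:R.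
  rewrite /v evC_quad fmorphV rmorph_nat !ratr_int /a.
  by ring.
have h1 : v * (w - r%:~R) = - b'%:~R * (w - r%:~R) - p%:R * c'%:~R.
  have Eb2 : (3 * r%:~R ^+ 2 + 2 * t%:~R * r%:~R + A%:~R : algC) = b'%:~R * p%:R.
    transitivity ((b' * p%:Z)%:~R : algC); last by ring.
    by rewrite -Eb; ring.
  have Ec2 : (r%:~R ^+ 3 + t%:~R * r%:~R ^+ 2 + A%:~R * r%:~R + B%:~R : algC) = c'%:~R * p%:R ^+ 2.
    transitivity ((c' * p%:Z ^+ 2)%:~R : algC); last by ring.
    by rewrite -Ec; ring.
  rewrite Ev mulrAC; apply: (canLR (mulfK p0)).
  have -> : a%:~R = 3 * r%:~R + t%:~R :> algC by rewrite /a; ring.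
  transitivity ((w ^+ 3 + t%:~R * w ^+ 2 + A%:~R * w + B%:~R)
    - (3 * r%:~R ^+ 2 + 2 * t%:~R * r%:~R + A%:~R) * (w - r%:~R)
    - (r%:~R ^+ 3 + t%:~R * r%:~R ^+ 2 + A%:~R * r%:~R + B%:~R)); first by ring.
  rewrite fw Eb2 Ec2; ring.
have h2 : v ^+ 2 + b'%:~R * v + c'%:~R * a%:~R = - c'%:~R * (w - r%:~R).
  have -> : v ^+ 2 = (v * (w - r%:~R)) * (w - r%:~R + a%:~R) / p%:R by rewrite expr2 {2}Ev; field.
  rewrite h1; transitivity (b'%:~R * (v - ((w - r%:~R) ^+ 2 + a%:~R * (w - r%:~R)) / p%:R) - c'%:~R * (w - r%:~R)).
    by field.
  by rewrite -Ev; ring.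
(* Multiplying [h2] by [v + b'] and applying [h1] eliminates [w - r] and leaves this monic integral
   equation for [v]. *)
pose G : {poly int} := cubic (2 * b') (b' ^+ 2 + c' * a) (a * b' * c' - p%:Z * c' ^+ 2).
apply: (@root_monic_Aint (map_poly intr G)); last 2 first.
- exact/monic_map/cubic_monic.
- by apply/polyOverP => i; rewrite coef_map; apply: intr_int.
clearbody a; rewrite map_cubic /root cubic_horner.
apply/eqP; transitivity ((v ^+ 2 + b'%:~R * v + c'%:~R * a%:~R) * (v + b'%:~R) - p%:R * c'%:~R ^+ 2); first by ring.
rewrite h2; transitivity (- c'%:~R * (v * (w - r%:~R) + b'%:~R * (w - r%:~R)) - p%:R * c'%:~R ^+ 2); first by ring.
rewrite h1; ring.
Qed.

(** The valuation of [c] at [p] is at least [3/2], hence at least [2]. *)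
Lemma prime_cube_sqr (p : nat) (k c : int) : prime p -> ~~ (p%:Z %| k)%Z ->
  (p%:Z ^+ 3 %| k ^+ 3 * c ^+ 2)%Z -> (p%:Z ^+ 2 %| c)%Z.
Proof.
move=> pp pk H.
have cop : coprimez (p%:Z ^+ 3) (k ^+ 3).
  by rewrite coprimezXl // coprimezXr // coprimezE prime_coprime.
rewrite Gauss_dvdzr // in H.
have pc : (p%:Z %| c)%Z.
  have : (p%:Z %| c ^+ 2)%Z by apply: dvdz_trans H; rewrite exprS dvdz_mulr.
  by rewrite !dvdzE abszX /= Euclid_dvdX // => /andP[].
case/dvdzP: pc H => c1 ->.
have -> : p%:Z ^+ 3 = p%:Z ^+ 2 * p%:Z by ring.
have -> : (c1 * p%:Z) ^+ 2 = p%:Z ^+ 2 * c1 ^+ 2 by ring.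
rewrite dvdz_mul2l ?expf_neq0 ?eqz_nat -?lt0n ?prime_gt0 //.
move=> H; have pc1 : (p%:Z %| c1)%Z by move: H; rewrite !dvdzE abszX /= Euclid_dvdX // => /andP[].
by rewrite expr2 dvdz_mul.
Qed.

Definition quadQ (p : nat) (a b c : int) : {poly rat} :=
  (p%:R)^-1 *: (c%:~R%:P * 'X^2 + b%:~R%:P * 'X + a%:~R%:P).

Lemma size_quadQ p a b c : (size (quadQ p a b c) <= 3)%N.
Proof.
apply: leq_trans (size_scale_leq _ _) _.
apply: leq_trans (size_polyD _ _) _; rewrite geq_max; apply/andP; split; last first.
  exact: leq_trans (size_polyC_leq1 _) _.
apply: leq_trans (size_polyD _ _) _; rewrite geq_max; apply/andP; split; rewrite mul_polyC;
  by apply: leq_trans (size_scale_leq _ _) _; rewrite ?size_polyX ?size_polyXn.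
Qed.

Lemma evC_quadQ p a b c w :
  evC (quadQ p a b c) w = (c%:~R * w ^+ 2 + b%:~R * w + a%:~R) / p%:R.
Proof.
rewrite /evC map_polyZ hornerZ !rmorphD /= ![map_poly _ (_ * _)]rmorphM /=.
by rewrite !map_polyC map_polyX map_polyXn /= !hornerE /= fmorphV rmorph_nat !ratr_int mulrC.
Qed.

(* If [u = k0 + k1 y + k2 y^2] with [y = X - r] is such that [u / p] is integral, and [p]
   divides [k0], [f(r)] and [f'(r)], then norms of well-chosen elements force [p^2 | f(r)]. *)
Lemma integral_double_root (f : VZ) (p : nat) (r k0 k1 k2 : int) :
  prime p -> discZ f != 0 ->
  let t := tcoef f in let A := Acoef f in let B := Bcoef f in
  (p%:Z %| 3 * r ^+ 2 + 2 * t * r + A)%Z ->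
  (p%:Z %| r ^+ 3 + t * r ^+ 2 + A * r + B)%Z ->
  (p%:Z %| k0)%Z -> ~~ ((p%:Z %| k1)%Z && (p%:Z %| k2)%Z) ->
  integral_elt f (quadQ p (k0 - k1 * r + k2 * r ^+ 2) (k1 - 2 * k2 * r) k2) ->
  (p%:Z ^+ 2 %| r ^+ 3 + t * r ^+ 2 + A * r + B)%Z.
Proof.
move=> pp f0 t A B /dvdzP[b' Eb] pc /dvdzP[k0' Ek0] nk.
have [x [y [z [Et EA EB]]]] := discZ_vieta f.
move=> /(integral_eltE f0 Et EA EB)[_ vA].
have rA := root_Aint Et EA EB.
move: Et EA EB pc; rewrite -/t -/A -/B; clearbody t A B => Et EA EB pc.
pose a := 3 * r + t; set c := r ^+ 3 + t * r ^+ 2 + A * r + B.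
have p0 : (p%:R : algC) != 0 by rewrite pnatr_eq0 -lt0n prime_gt0.
(* The roots translated by [r]; their elementary symmetric functions are [-a], [b'*p] and [-c]. *)
pose X := x - r%:~R; pose Y := y - r%:~R; pose Z := z - r%:~R.
have Ea : a%:~R = - (X + Y + Z) 
  by transitivity (3 * r%:~R + t%:~R : algC); [rewrite /a | rewrite Et /X /Y /Z]; ring.
have Eb2 : X * Y + X * Z + Y * Z = b'%:~R * p%:R.
  transitivity ((b' * p%:Z)%:~R : algC); last by ring.
  rewrite -Eb; transitivity (3 * r%:~R ^+ 2 + 2 * t%:~R * r%:~R + A%:~R : algC); last by ring.
  by rewrite /X /Y /Z Et EA; ring.
have Ec : c%:~R = - (X * Y * Z).
  transitivity (r%:~R ^+ 3 + t%:~R * r%:~R ^+ 2 + A%:~R * r%:~R + B%:~R : algC); first by rewrite /c; ring.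
  by rewrite Et EA EB /X /Y /Z; ring.
have wA : {in [:: X; Y; Z], forall w, w \in Aint}.
  have H w : w \in [:: x; y; z] -> w - r%:~R \in Aint by move=> wx; apply: rpredB; [exact: rA | exact: Aint_int].
  by move=> w; rewrite !inE => /or3P[] /eqP ->; apply: H; rewrite !inE eqxx ?orbT.
have fw : {in [:: X; Y; Z], forall w, w * (w ^+ 2 + a%:~R * w) = - (b'%:~R * p%:R) * w - c%:~R}.
  by move=> w; rewrite -Eb2 Ea Ec !inE => /or3P[] /eqP ->; ring.
have uA : {in [:: X; Y; Z], forall w, (k2%:~R * w ^+ 2 + k1%:~R * w) / p%:R \in Aint}.
  have H w : w \in [:: x; y; z] ->
     (k2%:~R * (w - r%:~R) ^+ 2 + k1%:~R * (w - r%:~R)) / p%:R \in Aint.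
    move=> wx; have := vA w wx; rewrite evC_quadQ => H.
    have -> : (k2%:~R * (w - r%:~R) ^+ 2 + k1%:~R * (w - r%:~R)) / p%:R =
      (k2%:~R * w ^+ 2 + (k1 - 2 * k2 * r)%:~R * w + (k0 - k1 * r + k2 * r ^+ 2)%:~R) / p%:R - k0'%:~R :> algC.
      by rewrite Ek0; field.
    by rewrite rpredB ?Aint_int.
  by move=> w; rewrite !inE => /or3P[] /eqP ->; apply: H; rewrite !inE eqxx ?orbT.
(* The product of the conjugates of an integral element is an integer. Each case below produces an
   element whose norm is written with denominator [p^3]. *)
have norm (d : int) (P : algC -> algC) : P X * P Y * P Z = d%:~R / p%:R ^+ 3 ->
    {in [:: X; Y; Z], forall w, P w \in Aint} -> (p%:Z ^+ 3 %| d)%Z.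
  move=> E PA; apply: Cint_Aint_dvd; first by rewrite expf_neq0 // eqz_nat -lt0n prime_gt0.
  rewrite rmorphXn /= -E; apply: rpredM; first apply: rpredM; apply: PA;
  by rewrite !inE eqxx ?orbT.
have cint (k : int) : k%:~R \in Aint by exact: Aint_int.
(* If [p] divides [k1], removing the integral term [(k1/p)*y] leaves [k2*y^2/p], of norm
   [k2^3*c^2/p^3]. *)
have [pk1|pk1] := boolP (p%:Z %| k1)%Z.
  have pk2 : ~~ (p%:Z %| k2)%Z by move: nk; rewrite pk1.
  apply: (prime_cube_sqr pp pk2).
  apply: (norm _ (fun w => k2%:~R * w ^+ 2 / p%:R)).
    have -> : (k2 ^+ 3 * c ^+ 2)%:~R = k2%:~R ^+ 3 * (c%:~R) ^+ 2 :> algC by ring.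
    by rewrite Ec; field.
  move=> w wX; case/dvdzP: pk1 => k1' E1; have := uA w wX.
  have -> : k2%:~R * w ^+ 2 / p%:R = (k2%:~R * w ^+ 2 + k1%:~R * w) / p%:R - k1'%:~R * w :> algC.
    by rewrite E1; field.
  by move=> H; apply: rpredB; [exact: H | apply: rpredM; [exact: cint | exact: wA]].
(* If [k1 = a*k2] modulo [p], an integral multiple of [y] can be removed to leave
   [k2*(y^2 + a*y)/p]. Adding [k2*b'] turns it into [-k2*c/(p*y)], again of norm [k2^3*c^2/p^3];
   dividing by [y] is possible once [c] is nonzero. *)
have [pk3|pk3] := boolP (p%:Z %| k1 - a * k2)%Z.
  have pk2 : ~~ (p%:Z %| k2)%Z.
    by apply: contra pk1 => H; rewrite -(subrK (a * k2) k1); apply: rpredD => //; exact: dvdz_mull.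
  have [c0|c0] := eqVneq c 0; first by rewrite c0.
  apply: (prime_cube_sqr pp pk2).
  apply: (norm _ (fun w => k2%:~R * (w ^+ 2 + a%:~R * w) / p%:R + k2%:~R * b'%:~R)).
    have -> : (k2 ^+ 3 * c ^+ 2)%:~R = k2%:~R ^+ 3 * (c%:~R) ^+ 2 :> algC by ring.
    have cn0 : c%:~R != 0 :> algC by rewrite intr_eq0.
    have E w : w \in [:: X; Y; Z] ->
      k2%:~R * (w ^+ 2 + a%:~R * w) / p%:R + k2%:~R * b'%:~R = - (k2%:~R * c%:~R / p%:R) / w.
      move=> wX; have w0 : w != 0.
        move: wX cn0; rewrite Ec oppr_eq0 !inE !mulf_eq0 !negb_or.
        by move=> /or3P[] /eqP -> /andP[/andP[]].
      apply: (mulIf w0); rewrite mulfVK //.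
      rewrite mulrDl; transitivity (k2%:~R * (w * (w ^+ 2 + a%:~R * w)) / p%:R + k2%:~R * b'%:~R * w); first by field.
      by rewrite fw //; field.
    rewrite !E ?inE ?eqxx ?orbT //.
    have [X0 Y0 Z0] : [/\ X != 0, Y != 0 & Z != 0].
      by move: cn0; rewrite Ec oppr_eq0 !mulf_eq0 !negb_or => /andP[/andP[-> ->] ->].
    by rewrite Ec; field; rewrite p0 X0 Y0 Z0.
  move=> w wX; case/dvdzP: pk3 => k3' E3; have := uA w wX.
  have -> : k2%:~R * (w ^+ 2 + a%:~R * w) / p%:R = (k2%:~R * w ^+ 2 + k1%:~R * w) / p%:R - k3'%:~R * w :> algC.
    have -> : (k1%:~R : algC) = k3'%:~R * p%:R + a%:~R * k2%:~R.
      by rewrite -(subrK (a * k2) k1) E3; ring.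
    by field.
  by move=> H; apply: rpredD; [apply: rpredB; [exact: H | apply: rpredM; [exact: cint | exact: wA]] | apply: rpredM; exact: cint].
(* Otherwise the norm of [(k2*y^2 + k1*y)/p] itself is [-c*N/p^3]. Modulo [p], [N] is
   [k1^2*(k1 - a*k2)], which is prime to [p], so even [p^3] divides [c]. *)
pose N := k1 ^+ 3 - a * k1 ^+ 2 * k2 + (b' * p%:Z) * k1 * k2 ^+ 2 - c * k2 ^+ 3.
have H : (p%:Z ^+ 3 %| c * N)%Z.
  suff H : (p%:Z ^+ 3 %| - (c * N))%Z by rewrite -[c * N]opprK rpredN.
  apply: (norm _ (fun w => (k2%:~R * w ^+ 2 + k1%:~R * w) / p%:R)) => //.
  transitivity (- c%:~R * (k1%:~R ^+ 3 - a%:~R * k1%:~R ^+ 2 * k2%:~R + (b'%:~R * p%:R) * k1%:~R * k2%:~R ^+ 2 - c%:~R * k2%:~R ^+ 3) / p%:R ^+ 3 : algC).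
    by rewrite -Eb2 Ec Ea; field.
  by rewrite /N; congr (_ / _); clearbody a c; ring.
have cN : coprimez (p%:Z ^+ 3) N.
  rewrite coprimezXl // coprimezE prime_coprime // -[(p %| _)%N]/(p%:Z %| N)%Z.
  apply: contra pk3 => pN.
  have : (p%:Z %| k1 ^+ 2 * (k1 - a * k2))%Z.
    have -> : k1 ^+ 2 * (k1 - a * k2) = N - (b' * k1 * k2 ^+ 2) * p%:Z + c * k2 ^+ 3 by rewrite /N; ring.
    by apply: rpredD; [apply: rpredB => //; exact: dvdz_mull | exact: dvdz_mulr].
  rewrite !dvdzE abszM Euclid_dvdM // abszX Euclid_dvdX //= => /orP[|//].
  by move: pk1; rewrite dvdzE /= => /negPf ->.
rewrite Gauss_dvdzl // in H; apply: dvdz_trans H.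
by rewrite [p%:Z ^+ 3]exprS dvdz_mull.
Qed.

(** * Reduction of integral fractions modulo a prime *)

Lemma irredp_dvdXn (F : fieldType) (g u : {poly F}) n :
  irreducible_poly g -> g %| u ^+ n -> g %| u.
Proof.
move=> irr gu; have [s1|s1] := eqVneq (size (gcdp g u)) 1%N; last first.
  by have /eqp_dvdl <- := irr.2 _ s1 (dvdp_gcdl _ _); exact: dvdp_gcdr.
have cop : coprimep g (u ^+ n) by apply: coprimep_expr; rewrite /coprimep s1.
move: gu; rewrite -[u ^+ n]mulr1 Gauss_dvdpr // dvdp1 => /eqP s.
by have := irr.1; rewrite s.
Qed.

(** Without a double root in [F] the cubic is squarefree, and [f %| u ^+ n] would give [f %| u],
    against the degrees. Since a polynomial of degree two or three without roots is irreducible, the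
    factors can be split off one root at a time. *)
Lemma double_root_exists (F : fieldType) (f u : {poly F}) n :
  size f = 4%N -> u != 0 -> (size u <= 3)%N -> f %| u ^+ n ->
  exists r, [/\ root f r, root f^`() r & root u r].
Proof.
move=> sf u0 su fu.
have nfu : ~~ (f %| u).
  by apply/negP => /(dvdp_leq u0) H; have := leq_trans H su; rewrite sf.
have rootu r : root f r -> root u r.
  rewrite -!dvdp_XsubCl => rf; apply: (@irredp_dvdXn _ _ _ n); first exact: irredp_XsubC.
  exact: dvdp_trans rf fu.
have [r1 rr1] : exists r, root f r.
  apply: contrapT => nr; move/negP: nfu; apply; apply: (@irredp_dvdXn _ _ _ n) => //.
  by apply: cubic_irreducible; [rewrite sf | move=> r; apply/negP => rf; apply: nr; exists r].
have /dvdpP[g Eg] : ('X - r1%:P) %| f by rewrite dvdp_XsubCl.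
have g0 : g != 0 by apply: contra_eqN sf => /eqP g0; rewrite Eg g0 mul0r size_poly0.
have sg : size g = 3%N.
  by move: sf; rewrite Eg size_Mmonic ?monicXsubC // size_XsubC addn2 /= => -[].
have gf : g %| f by rewrite Eg dvdp_mulr.
have fin r : root f r -> f^`().[r] = 0 -> exists r, [/\ root f r, root f^`() r & root u r].
  by move=> rf rf'; exists r; split=> //; [exact/rootP | exact: rootu].
have [rg|rg] := boolP (root g r1).
  apply: (fin r1) => //; rewrite Eg derivM derivXsubC mulr1 hornerD hornerM hornerXsubC subrr.
  by rewrite mulr0 add0r (rootP rg).
have [r2 rr2] : exists r, root g r.
  apply: contrapT => nr; move/negP: nfu; apply.
  rewrite Eg Gauss_dvdp; last by rewrite coprimep_XsubC.
  rewrite dvdp_XsubCl rootu // andbT; apply: (@irredp_dvdXn _ _ _ n); last exact: dvdp_trans fu.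
  by apply: cubic_irreducible; [rewrite sg | move=> r; apply/negP => rf; apply: nr; exists r].
have /dvdpP[h Eh] : ('X - r2%:P) %| g by rewrite dvdp_XsubCl.
have sh : size h = 2%N.
  have h0 : h != 0 by apply: contraNneq g0 => h0; rewrite Eh h0 mul0r.
  by move: sg; rewrite Eh size_Mmonic ?monicXsubC // size_XsubC addn2 /= => -[].
have [rh|rh] := boolP (root h r2).
  apply: (fin r2); first by rewrite -dvdp_XsubCl (dvdp_trans _ gf) // dvdp_XsubCl.
  rewrite Eg Eh !derivM !derivXsubC !mulr1 !(hornerXsubC, hornerD, hornerM) subrr.
  by rewrite (rootP rh) !(mulr0, mul0r, addr0, add0r).
exfalso; move/negP: nfu; apply.
have r12 : r1 != r2 by apply: contraNneq rg => ->.
have [r3 rr3] : exists r, root h r by have [r] := poly2_root sh; exists r.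
have Eh3 : 'X - r3%:P %= h by rewrite -dvdp_size_eqp ?dvdp_XsubCl // size_XsubC sh.
rewrite Eg Gauss_dvdp; last by rewrite coprimep_XsubC.
rewrite dvdp_XsubCl rootu // andbT Eh Gauss_dvdp; last by rewrite coprimep_XsubC.
have hf : h %| f by rewrite Eg Eh -mulrA dvdp_mulr.
rewrite -(eqp_dvdl _ Eh3) !dvdp_XsubCl !rootu // -dvdp_XsubCl.
  by rewrite (dvdp_trans _ gf) // dvdp_XsubCl.
by rewrite (eqp_dvdl _ Eh3).
Qed.

(* With [e1, e2, e3] the elementary symmetric functions of the values of [u] at the roots of
   [f], reduce [u^3 - e1 u^2 + e2 u - e3], which vanishes at these roots, modulo [p]. *)
Lemma integral_nilpotent (f : VZ) (p : nat) (a b c : int) : prime p -> discZ f != 0 ->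
  integral_elt f (quadQ p a b c) ->
  cubic (tcoef f)%:~R (Acoef f)%:~R (Bcoef f)%:~R %|
    (c%:~R%:P * 'X^2 + b%:~R%:P * 'X + a%:~R%:P : {poly 'F_p}) ^+ 3.
Proof.
move=> pp f0; have [x [y [z [Et EA EB]]]] := discZ_vieta f.
move=> /(integral_eltE f0 Et EA EB)[_ vA].
have xyz := uniq_xyz f0 Et EA EB.
set t := tcoef f in Et *; set A := Acoef f in EA *; set B := Bcoef f in EB *.
pose U : {poly int} := c%:P * 'X^2 + b%:P * 'X + a%:P.
pose u w : algC := c%:~R * w ^+ 2 + b%:~R * w + a%:~R.
have p0 : (p%:R : algC) != 0 by rewrite pnatr_eq0 -lt0n prime_gt0.
have uA w : w \in [:: x; y; z] -> u w / p%:R \in Aint by move=> /vA; rewrite evC_quadQ.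
have [x1 y1 z1] : [/\ u x / p%:R \in Aint, u y / p%:R \in Aint & u z / p%:R \in Aint].
  by split; apply: uA; rewrite !inE eqxx ?orbT.
have dv (k : int) (q : algC) : k%:~R = p%:R * q -> q \in Aint -> (p%:Z %| k)%Z.
  move=> E qA; apply: Cint_Aint_dvd; first by rewrite eqz_nat -lt0n prime_gt0.
  by rewrite E mulrAC mulfV // mul1r.
pose s1 : int := - t. pose s2 : int := A. pose s3 : int := - B.
(* The elementary symmetric functions of [u x], [u y], [u z], expanded in those of the roots; this
   shows that they are integers. *)
pose e1 : int := c * (s1 ^+ 2 - 2 * s2) + b * s1 + 3 * a.
pose e2 : int := c ^+ 2 * (s2 ^+ 2 - 2 * s1 * s3) + b ^+ 2 * s2 + 3 * a ^+ 2
  + b * c * (s1 * s2 - 3 * s3) + 2 * a * b * s1 + 2 * a * c * (s1 ^+ 2 - 2 * s2).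
pose e3 : int := c ^+ 3 * s3 ^+ 2 + b ^+ 3 * s3 + a ^+ 3 + c ^+ 2 * b * s2 * s3
  + c * b ^+ 2 * s1 * s3 + c ^+ 2 * a * (s2 ^+ 2 - 2 * s1 * s3) + b ^+ 2 * a * s2
  + a ^+ 2 * c * (s1 ^+ 2 - 2 * s2) + a ^+ 2 * b * s1 + a * b * c * (s1 * s2 - 3 * s3).
have [h1 h2 h3] : [/\ s1%:~R = x + y + z, s2%:~R = x * y + x * z + y * z & s3%:~R = x * y * z :> algC].
  by rewrite /s1 /s2 /s3 !rmorphN /= Et EA EB !opprK.
clearbody s1 s2 s3.
have E1 : e1%:~R = u x + u y + u z.
  transitivity (c%:~R * (s1%:~R ^+ 2 - 2 * s2%:~R) + b%:~R * s1%:~R + 3 * a%:~R : algC); first by rewrite /e1; ring.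
  by rewrite h1 h2 /u; ring.
have E2 : e2%:~R = u x * u y + u x * u z + u y * u z.
  transitivity (c%:~R ^+ 2 * (s2%:~R ^+ 2 - 2 * s1%:~R * s3%:~R) + b%:~R ^+ 2 * s2%:~R + 3 * a%:~R ^+ 2
  + b%:~R * c%:~R * (s1%:~R * s2%:~R - 3 * s3%:~R) + 2 * a%:~R * b%:~R * s1%:~R + 2 * a%:~R * c%:~R * (s1%:~R ^+ 2 - 2 * s2%:~R) : algC); first by rewrite /e2; ring.
  by rewrite h1 h2 h3 /u; ring.
have E3 : e3%:~R = u x * u y * u z.
  transitivity (c%:~R ^+ 3 * s3%:~R ^+ 2 + b%:~R ^+ 3 * s3%:~R + a%:~R ^+ 3 + c%:~R ^+ 2 * b%:~R * s2%:~R * s3%:~R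
  + c%:~R * b%:~R ^+ 2 * s1%:~R * s3%:~R + c%:~R ^+ 2 * a%:~R * (s2%:~R ^+ 2 - 2 * s1%:~R * s3%:~R) + b%:~R ^+ 2 * a%:~R * s2%:~R
  + a%:~R ^+ 2 * c%:~R * (s1%:~R ^+ 2 - 2 * s2%:~R) + a%:~R ^+ 2 * b%:~R * s1%:~R + a%:~R * b%:~R * c%:~R * (s1%:~R * s2%:~R - 3 * s3%:~R) : algC); first by rewrite /e3; ring.
  by rewrite h1 h2 h3 /u; ring.
clearbody e1 e2 e3.
have uA' w : w \in [:: x; y; z] -> u w \in Aint.
  by move=> wx; rewrite -(divfK p0 (u w)); apply: rpredM; [exact: uA | apply: Aint_Cnat; exact: natr_nat].
have [x2 y2 z2] : [/\ u x \in Aint, u y \in Aint & u z \in Aint].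
  by split; apply: uA'; rewrite !inE eqxx ?orbT.
(* Each term of [e1], [e2], [e3] contains a factor [u w], and [u w / p] is integral; so all three
   vanish modulo [p] and only [U ^+ 3] survives in [G]. *)
have d1 : (p%:Z %| e1)%Z.
  apply: (dv _ (u x / p%:R + u y / p%:R + u z / p%:R)); first by rewrite E1; field.
  by apply: rpredD => //; apply: rpredD.
have d2 : (p%:Z %| e2)%Z.
  apply: (dv _ (u x / p%:R * u y + u x / p%:R * u z + u y / p%:R * u z)); first by rewrite E2; field.
  by apply: rpredD; [apply: rpredD|]; apply: rpredM.
have d3 : (p%:Z %| e3)%Z.
  apply: (dv _ (u x / p%:R * u y * u z)); first by rewrite E3; field.
  by apply: rpredM => //; apply: rpredM.
pose G := U ^+ 3 - e1%:P * U ^+ 2 + e2%:P * U - e3%:P.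
have Gw w : w \in [:: x; y; z] -> (map_poly (intr : int -> algC) G).[w] = 0.
  move=> wx.
  have Uw : (map_poly (intr : int -> algC) U).[w] = u w.
    rewrite /U !rmorphD /= ![map_poly _ (_ * _)]rmorphM /=.
    by rewrite !map_polyC map_polyX map_polyXn /= !(hornerXn, hornerX, hornerC, hornerD, hornerM).
  rewrite /G !(rmorphB, rmorphD) /= ![map_poly _ (_ * _)]rmorphM /= !map_polyC /=.
  rewrite !(hornerD, hornerN) !hornerM !hornerC Uw ![map_poly _ (U ^+ _)]rmorphXn !horner_exp /= Uw E1 E2 E3.
  by move: wx; rewrite !inE => /or3P[] /eqP ->; ring.
(* Division by a monic cubic stays over the integers. The remainder has degree at most two and
   vanishes at three distinct points, hence is zero. *)
have Eq := Pdiv.RingMonic.rdivp_eq (cubic_monic t A B) G.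
have q0 : Pdiv.Ring.rmodp G (cubic t A B) = 0.
  move: Eq; set q := Pdiv.Ring.rmodp _ _ => Eq.
  have sq : (size q < 4)%N by rewrite -(size_cubic t A B) Pdiv.Ring.ltn_rmodpN0 // monic_neq0 ?cubic_monic.
  pose qC : {poly algC} := map_poly intr q.
  have sqC : size qC = size q by rewrite /qC size_map_inj_poly //; exact: intr_inj.
  apply/eqP; rewrite -size_poly_eq0 -sqC size_poly_eq0.
  apply: contraTT sq => q0; rewrite -leqNgt -sqC.
  apply: (@max_poly_roots _ qC [:: x; y; z]) => //.
  apply/allP => w wx; apply/rootP.
  have := Gw w wx; rewrite {1}Eq rmorphD rmorphM /= hornerD hornerM map_cubic /= Et EA EB cubic_vieta.
  rewrite !hornerM !hornerXsubC -/qC.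
  by move: wx; rewrite !inE => /or3P[] /eqP ->; rewrite subrr !(mul0r, mulr0) add0r.
have red0 (e : int) : (p%:Z %| e)%Z -> e%:~R = 0 :> 'F_p.
  by case/dvdzP=> k ->; rewrite rmorphM /= -[p%:~R]/(p%:R) pchar_Fp_0 // mulr0.
have := congr1 (map_poly (intr : int -> 'F_p)) Eq.
rewrite q0 addr0 [map_poly _ (_ * _)]rmorphM /= map_cubic /=.
suff -> : map_poly (intr : int -> 'F_p) G = (c%:~R%:P * 'X^2 + b%:~R%:P * 'X + a%:~R%:P) ^+ 3.
  by move=> ->; exact: dvdp_mull.
have -> : c%:~R%:P * 'X^2 + b%:~R%:P * 'X + a%:~R%:P = map_poly (intr : int -> 'F_p) U.
  by rewrite /U !rmorphD /= ![map_poly _ (_%:P * _)]rmorphM /= !map_polyC map_polyX map_polyXn.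
rewrite /G !(rmorphB, rmorphD) /= ![map_poly _ (_%:P * _)]rmorphM /= !map_polyC /=.
have r0 e : (p%:Z %| e)%Z -> (e%:~R)%:P = 0 :> {poly 'F_p} by move=> /red0 ->; exact: polyC0.
by rewrite (r0 _ d1) (r0 _ d2) (r0 _ d3) !mul0r !subr0 addr0 rmorphXn /= /U !rmorphD /= ![map_poly _ (_%:P * _)]rmorphM /= !map_polyC.
Qed.

Lemma Fp_int (p : nat) (r : 'F_p) : (nat_of_ord r)%:~R = r.
Proof. by rewrite -[_%:~R]/(_%:R) natr_Zp. Qed.

Lemma Fp_eq0 (p : nat) (e : int) : prime p -> (e%:~R == 0 :> 'F_p) = (p%:Z %| e)%Z.
Proof.
move=> pp; rewrite dvdzE /=; have := dvdn_pcharf (pchar_Fp pp) `|e| => /= ->.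
case: (intP e) => [|n|n]; rewrite ?abszN /= //.
by rewrite rmorphN oppr_eq0.
Qed.

(** The hard direction of Dedekind's criterion. Modulo [p] the numerator [u] is nonzero and some
    power of it is divisible by the cubic, so the cubic has a double root that is also a root of
    [u]; lifted to an integer, it is a valid centre for [integral_double_root]. *)
Lemma integral_ex_double_root (f : VZ) (p : nat) (a b c : int) :
  prime p -> discZ f != 0 ->
  let t := tcoef f in let A := Acoef f in let B := Bcoef f in
  integral_elt f (quadQ p a b c) ->
  ~~ [&& (p%:Z %| a)%Z, (p%:Z %| b)%Z & (p%:Z %| c)%Z] ->
  exists r : int, (p%:Z %| 3 * r ^+ 2 + 2 * t * r + A)%Z /\
    (p%:Z ^+ 2 %| r ^+ 3 + t * r ^+ 2 + A * r + B)%Z.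
Proof.
move=> pp f0 t A B fI nd; have fd := integral_nilpotent pp f0 fI.
move: fd; set u : {poly 'F_p} := c%:~R%:P * 'X^2 + b%:~R%:P * 'X + a%:~R%:P => fd.
have su : (size u <= 3)%N.
  apply: leq_trans (size_polyD _ _) _; rewrite geq_max; apply/andP; split; last first.
    exact: leq_trans (size_polyC_leq1 _) _.
  apply: leq_trans (size_polyD _ _) _; rewrite geq_max; apply/andP; split; rewrite mul_polyC;
    by apply: leq_trans (size_scale_leq _ _) _; rewrite ?size_polyX ?size_polyXn.
have u0 : u != 0.
  apply: contra nd => /eqP /polyP u0; rewrite -!Fp_eq0 //.
  have := u0 2; have := u0 1%N; have := u0 0%N.
  rewrite /u !coefD !coefCM !coefXn !coefX !coefC /= !(mulr0,mulr1,addr0,add0r).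
  by move=> -> -> ->; rewrite eqxx.
have [r [r1 r2 r3]] := double_root_exists (size_cubic _ _ _) u0 su fd.
move: r1 r2 r3; rewrite -(Fp_int r); set R := Posz r => r1 r2 r3.
have h1 : (p%:Z %| 3 * R ^+ 2 + 2 * t * R + A)%Z.
  rewrite -Fp_eq0 //; move: r2; rewrite /cubic !(derivXn, derivD, derivC, derivX, derivM) /root /=.
  rewrite !(hornerXn, hornerX, hornerC, hornerMn, hornerD, hornerM) /=.
  by move=> /eqP E; apply/eqP; rewrite -[RHS]E; ring.
have h2 : (p%:Z %| R ^+ 3 + t * R ^+ 2 + A * R + B)%Z.
  rewrite -Fp_eq0 //; move: r1; rewrite /root cubic_horner.
  by move=> /eqP E; apply/eqP; rewrite -[RHS]E; ring.
have h3 : (p%:Z %| a + b * R + c * R ^+ 2)%Z.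
  rewrite -Fp_eq0 //; move: r3; rewrite /root /u !(hornerXn, hornerX, hornerC, hornerD, hornerM).
  by move=> /eqP E; apply/eqP; rewrite -[RHS]E; ring.
exists R; split=> //.
(* These are the Taylor coefficients of [a + b*x + c*x^2] at [R]. *)
apply: (@integral_double_root f p R (a + b * R + c * R ^+ 2) (b + 2 * c * R) c) => //.
  apply: contra nd => /andP[d1 d2].
  have d3 : (p%:Z %| b)%Z.
    by rewrite -(addrK (2 * c * R) b); apply: rpredB => //; rewrite mulrAC dvdz_mull.
  rewrite d3 d2 !andbT.
  have -> : a = a + b * R + c * R ^+ 2 - b * R - c * R ^+ 2 by ring.
  by rewrite !rpredB ?dvdz_mulr.
have -> : a + b * R + c * R ^+ 2 - (b + 2 * c * R) * R + c * R ^+ 2 = a by ring.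
by have -> : b + 2 * c * R - 2 * c * R = b by ring.
Qed.

Lemma coef_quadQ p a b c i :
  (quadQ p a b c)`_i = (nth 0 [:: a; b; c] i)%:~R / p%:R.
Proof.
rewrite /quadQ coefZ !coefD !coefCM coefXn coefX coefC mulrC.
by case: i => [|[|[|i]]] /=; rewrite ?nth_nil !(mulr0, mulr1, addr0, add0r).
Qed.

Lemma quadQ_inj p a b c q a' b' c' : (0 < p)%N -> (0 < q)%N ->
  a * q%:Z = a' * p%:Z -> b * q%:Z = b' * p%:Z -> c * q%:Z = c' * p%:Z ->
  quadQ p a b c = quadQ q a' b' c'.
Proof.
move=> p0 q0 Ea Eb Ec; apply/polyP => i; rewrite !coef_quadQ.
have H (x y : int) : x * q%:Z = y * p%:Z -> x%:~R / p%:R = y%:~R / q%:R :> rat.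
  move=> E; have : x%:~R * q%:R = y%:~R * p%:R :> rat by rewrite -[q%:R]/(q%:~R) -[p%:R]/(p%:~R) -!rmorphM /= E.
  move=> E'; apply: (canRL (mulfK _)); first by rewrite pnatr_eq0 -lt0n.
  by rewrite mulrAC E' mulfK // pnatr_eq0 -lt0n.
by apply: H; case: i => [|[|[|i]]] //=; rewrite nth_nil.
Qed.

Lemma quadQD p a b c a' b' c' :
  quadQ p a b c + quadQ p a' b' c' = quadQ p (a + a') (b + b') (c + c').
Proof.
apply/polyP => i; rewrite coefD !coef_quadQ -mulrDl -rmorphD /=.
by case: i => [|[|[|i]]] //=; rewrite nth_nil.
Qed.

Lemma same_coset_quadQ p a b c a' b' c' : (0 < p)%N ->
  same_coset (quadQ p a b c) (quadQ p a' b' c') <->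
  [/\ (p%:Z %| a - a')%Z, (p%:Z %| b - b')%Z & (p%:Z %| c - c')%Z].
Proof.
move=> p0; have pz : (p%:R : rat) != 0 by rewrite pnatr_eq0 -lt0n.
have H (x y : int) : (x%:~R / p%:R - y%:~R / p%:R : rat) \in Num.int <-> (p%:Z %| x - y)%Z.
  rewrite -mulrBl -rmorphB /=; split.
    case/intrP => k; move/(canRL (mulfVK pz)) => E; apply/dvdzP; exists k.
    by apply/eqP; rewrite -(eqr_int rat) E rmorphM.
  by case/dvdzP => k ->; rewrite rmorphM /= mulfK // intr_int.
split=> [/polyOverP h|[h0 h1 h2]].
  split; apply/H.
  - by have := h 0%N; rewrite coefB !coef_quadQ.
  - by have := h 1%N; rewrite coefB !coef_quadQ.
  - by have := h 2; rewrite coefB !coef_quadQ.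
apply/polyOverP => i; rewrite coefB !coef_quadQ; apply/H.
by case: i => [|[|[|i]]] //=; rewrite nth_nil subrr dvdz0.
Qed.

(** Sending each entry of the first list to an entry of the second in the same coset is injective,
    because the entries of the first list lie in distinct cosets. *)
Lemma is_ind_le f k k' : is_ind f k -> is_ind f k' -> (k <= k')%N.
Proof.
move=> [s [<- sI sN sC]] [s' [<- sI' sN' sC']].
have /boolp.choice[h hP] : forall i : 'I_(size s), exists j : 'I_(size s'),
    same_coset (nth 0 s i) (nth 0 s' j).
  move=> i.
  have [|q qs' qc] := sC' (nth 0 s i); first by apply: sI; rewrite mem_nth.
  have qi : (index q s' < size s')%N by rewrite index_mem.
  by exists (Ordinal qi); rewrite /= nth_index.
suff /leq_card : injective h by rewrite !card_ord.
move=> i j E; apply: contrapT => ij; apply: (sN i j) => //.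
  by move=> /val_inj.
have := hP j; rewrite -E => hj; have hi := hP i.
rewrite /same_coset.
have -> : nth 0 s i - nth 0 s j = (nth 0 s i - nth 0 s' (h i)) - (nth 0 s j - nth 0 s' (h i)) by ring.
by apply/polyOverP => n; rewrite coefB; apply: rpredB; [exact: (polyOverP hi) | exact: (polyOverP hj)].
Qed.

Lemma is_ind_uniq f k k' : is_ind f k -> is_ind f k' -> k = k'.
Proof. by move=> h h'; apply/eqP; rewrite eqn_leq (is_ind_le h h') (is_ind_le h' h). Qed.

Lemma pairMn (U V : nmodType) (x : U) (y : V) n : (x, y) *+ n = (x *+ n, y *+ n).
Proof. by elim: n => [|n IH]; rewrite ?mulr0n // !mulrS IH. Qed.

(** * The index as the order of a finite group *)

Section Index.
Variables (f : VZ) (D : nat).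
Hypothesis f0 : discZ f != 0.
Hypothesis ED : `|discZ f|%N = D.+1.
(** By [integral_elt_disc] the coefficients of an integral element have denominator dividing [D.+1],
    the absolute discriminant. Its coset is thus a triple of numerators modulo [D.+1]. *)
Let G := ('I_D.+1 * 'I_D.+1 * 'I_D.+1)%type.
Let pol (u : G) : {poly rat} := quadQ D.+1 (u.1.1 : nat) (u.1.2 : nat) (u.2 : nat).
Let cls (a b c : int) : G := (redZ D a, redZ D b, redZ D c).
Let Hs : {set G} := [set u | `[< integral_elt f (pol u) >]].

Lemma in_Hs u : (u \in Hs) = `[< integral_elt f (pol u) >].
Proof. by rewrite inE. Qed.

Lemma redZE (k : nat) (a : int) : (redZ k a : nat)%:Z = (a %% k.+1%:Z)%Z.
Proof.
by rewrite /redZ inordK; [rewrite gez0_abs // modz_ge0 | rewrite -ltz_nat gez0_abs ?modz_ge0 // ltz_pmod].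
Qed.

Lemma pol_cls a b c : same_coset (quadQ D.+1 a b c) (pol (cls a b c)).
Proof.
by rewrite /pol /cls /=; apply/same_coset_quadQ => //; rewrite !redZE; split; rewrite -eqz_mod_dvd modz_mod.
Qed.

Lemma pol_inj u v : same_coset (pol u) (pol v) -> u = v.
Proof.
move=> /same_coset_quadQ [] //.
have K (x y : 'I_D.+1) : (D.+1%:Z %| (x : nat)%:Z - (y : nat)%:Z)%Z -> x = y.
  by rewrite -eqz_mod_dvd !modz_small ?ltz_nat ?ltn_ord // => /eqP[] /val_inj.
by case: u v => [[a b] c] [[a' b'] c'] /= /K -> /K -> /K ->.
Qed.

Lemma integral_quadQ p : integral_elt f p -> exists a b c, p = quadQ D.+1 a b c.
Proof.
move=> fp; have sp := fp.1; have /polyOverP pZ := integral_elt_disc f0 fp.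
have H i : exists a : int, p`_i = a%:~R / D.+1%:R.
  have d0 : (D.+1%:R : rat) != 0 by rewrite pnatr_eq0.
  have := pZ i; rewrite coefZ; case/intrP => k E.
  have [E1|E1] : discZ f = D.+1%:Z \/ discZ f = - D.+1%:Z.
  - by rewrite -ED; case: (intP (discZ f)) => *; rewrite ?abszN; [left|left|right].
  - by exists k; apply: (canRL (mulfK d0)); rewrite -E E1 mulrC.
  - by exists (- k); apply: (canRL (mulfK d0)); rewrite rmorphN /= -E E1 rmorphN /= mulNr opprK mulrC.
have [a Ea] := H 0%N; have [b Eb] := H 1%N; have [c Ec] := H 2.
exists a, b, c; apply/polyP => i; rewrite coef_quadQ.
case: i => [|[|[|i]]] //=; rewrite nth_nil mul0r nth_default //.
exact: leq_trans sp _.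
Qed.

Lemma is_ind_card : is_ind f #|Hs|.
Proof.
exists [seq pol u | u <- enum Hs]; split.
- by rewrite size_map cardE.
- by move=> p /mapP[u]; rewrite mem_enum in_Hs => /asboolW uI ->.
- move=> i j; rewrite size_map => il jl ij.
  rewrite !(nth_map (0 : G)) // => /pol_inj /eqP; rewrite nth_uniq ?enum_uniq //.
  by move=> /eqP.
- move=> p pI; have [a [b [c E]]] := integral_quadQ pI.
  have pc := pol_cls a b c; exists (pol (cls a b c)); last by rewrite E.
  apply: map_f; rewrite mem_enum in_Hs; apply/asboolP.
  by apply: (same_coset_integral f0 pI); [exact: size_quadQ | rewrite E].
Qed.

Lemma index_group : group_set Hs.
Proof.
apply/group_setP; split.
  rewrite in_Hs; apply/asboolP; apply: integral_elt_int => //; first exact: size_quadQ.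
  by apply/polyOverP => i; rewrite coef_quadQ /=; case: i => [|[|[|i]]] /=; rewrite ?nth_nil mul0r rpred0.
move=> u v; rewrite !in_Hs => /asboolW uI /asboolW vI; apply/asboolP.
apply: (same_coset_integral f0 (integral_eltD f0 uI vI)); first exact: size_quadQ.
rewrite quadQD; apply/same_coset_quadQ => //; split; rewrite -eqz_mod_dvd /= -PoszD !modz_nat eqz_nat modn_mod //.
Qed.

(** By Cauchy's theorem a prime divisor of the order yields a coset of order [p]. Being killed by
    [p] means having denominator [p], and being nontrivial means that the numerators are not all
    divisible by [p]. The converse is Lagrange's theorem. *)
Lemma dvd_index p : prime p -> (p %| #|Hs|)%N <->
  exists a b c : int, integral_elt f (quadQ p a b c) /\
    ~~ [&& (p%:Z %| a)%Z, (p%:Z %| b)%Z & (p%:Z %| c)%Z].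
Proof.
move=> pp; have p0 := prime_gt0 pp; split.
  move=> pH; have [u uH ou] := Cauchy (G := Group index_group) pp pH.
  have up : (u *+ p = 0)%R by rewrite -ou; exact: (expg_order u).
  have K (x : 'I_D.+1) : x *+ p = 0 -> exists a, (x : nat)%:Z * p%:Z = a * D.+1%:Z.
    rewrite Zp_mulrn => /(congr1 val) /= /eqP; rewrite -/(dvdn _ _) => /dvdnP[a E].
    by exists a%:Z; rewrite -!PoszM E.
  case: u uH ou up => [[a b] c] uH ou up.
  have [|a' Ea] := K a; first by have := congr1 (fst \o fst) up; rewrite /= !raddfMn.
  have [|b' Eb] := K b; first by have := congr1 (snd \o fst) up; rewrite /= !raddfMn.
  have [|c' Ec] := K c; first by have := congr1 snd up; rewrite /= !raddfMn.
  exists a', b', c'; split.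
    by move: uH; rewrite in_Hs => /asboolW; rewrite /pol /= (quadQ_inj _ p0 Ea Eb Ec).
  apply/negP => /and3P[da db dc].
  have Z (x : 'I_D.+1) (a1 : int) : (x : nat)%:Z * p%:Z = a1 * D.+1%:Z -> (p%:Z %| a1)%Z -> x = 0.
    move=> E /dvdzP[k Ek]; apply/val_inj => /=; move: E; rewrite Ek mulrAC.
    have pz : p%:Z != 0 by rewrite eqz_nat -lt0n.
    move=> /(mulIf pz) E; have : (D.+1 %| x)%N by rewrite -[(_ %| _)%N]/(D.+1%:Z %| x%:Z)%Z E dvdz_mull.
    by rewrite /dvdn modn_small ?ltn_ord // => /eqP.
  have E1 : (a, b, c) = 1%g :> G by rewrite (Z _ _ Ea da) (Z _ _ Eb db) (Z _ _ Ec dc).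
  by move: ou; rewrite E1 order1 => E; rewrite -E in pp.
move=> [a [b [c [fI nd]]]].
have [a' [b' [c' E]]] := integral_quadQ fI.
have pz : (p%:R : rat) != 0 by rewrite pnatr_eq0 -lt0n.
have K i : nth 0 [:: a; b; c] i * D.+1%:Z = nth 0 [:: a'; b'; c'] i * p%:Z.
  have := congr1 (fun q : {poly rat} => q`_i) E; rewrite /= !coef_quadQ.
  set x := nth 0 _ i; set y := nth 0 _ i => /(congr1 (fun z => z * (p%:R * D.+1%:R))).
  rewrite mulrA mulfVK // mulrCA mulfVK ?pnatr_eq0 // mulrC => E'.
  by apply/eqP; rewrite -(eqr_int rat) !rmorphM /= mulrC E' mulrC.
pose u := cls a' b' c'.
have uH : u \in Hs.
  rewrite in_Hs; apply/asboolP; apply: (same_coset_integral f0 fI); first exact: size_quadQ.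
  by rewrite E; exact: pol_cls.
have up : (u ^+ p = 1)%g.
  have Z (x y : int) : x * D.+1%:Z = y * p%:Z -> redZ D y *+ p = 0.
    move=> Exy; rewrite Zp_mulrn; apply/val_inj => /=; apply/eqP.
    rewrite -/(dvdn _ _) -[(_ %| _)%N]/(D.+1%:Z %| (redZ D y * p)%N%:Z)%Z PoszM redZE.
    apply/dvdzP; exists (x - (y %/ D.+1%:Z)%Z * p%:Z).
    by rewrite /modz mulrBl [RHS]mulrBl Exy; ring.
  have E3 : (u *+ p = 0)%R.
    by rewrite /u /cls !pairMn (Z a a' (K 0%N)) (Z b b' (K 1%N)) (Z c c' (K 2)).
  exact: E3.
have u1 : (u != 1)%g.
  apply: contra nd => /eqP u1.
  have Z (x y : int) : x * D.+1%:Z = y * p%:Z -> redZ D y = 0 -> (p%:Z %| x)%Z.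
    move=> Exy /(congr1 (fun z : 'I_D.+1 => (z : nat)%:Z)); rewrite redZE /= => /dvdz_mod0P/dvdzP[k Ek].
    have d0 : D.+1%:Z != 0 by [].
    by apply/dvdzP; exists k; apply: (mulIf d0); rewrite Exy Ek mulrAC.
  have E1 : (redZ D a', redZ D b', redZ D c') = (0, 0, 0) :> G := u1.
  case: E1 => Ea Eb Ec.
  by rewrite (Z a a' (K 0%N) Ea) (Z b b' (K 1%N) Eb) (Z c c' (K 2) Ec).
have <- : #[u]%g = p.
  by apply/prime_nt_dvdP => //; [rewrite order_eq1 | rewrite order_dvdn up].
exact: (order_dvdG (G := Group index_group)).
Qed.
End Index.

Lemma prime_dvd_ind (f : VZ) (p k : nat) : discZ f != 0 -> prime p -> is_ind f k ->
  (p %| k)%N <-> exists r : int,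
    (p%:Z %| 3 * r ^+ 2 + 2 * tcoef f * r + Acoef f)%Z /\
    (p%:Z ^+ 2 %| r ^+ 3 + tcoef f * r ^+ 2 + Acoef f * r + Bcoef f)%Z.
Proof.
move=> f0 pp kI.
have ED : `|discZ f|%N = (`|discZ f|.-1.+1)%N by rewrite prednK // absz_gt0.
rewrite (is_ind_uniq kI (is_ind_card f0 ED)) (dvd_index f0 ED pp); split=> [[a [b [c [fI nd]]]]|[r [r1 r2]]].
  exact: integral_ex_double_root fI nd.
have [b [c bc]] := double_root_integral pp f0 r1 r2.
exists c, b, 1; split; first by rewrite /quadQ mul1r.
by apply/negP => /and3P[_ _]; rewrite dvdzE /= dvdn1 => /eqP E; rewrite E in pp.
Qed.

Lemma is_ind_ex (f : VZ) : discZ f != 0 -> exists k, is_ind f k.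
Proof.
move=> f0; have ED : `|discZ f|%N = (`|discZ f|.-1.+1)%N by rewrite prednK // absz_gt0.
eexists; exact: (is_ind_card f0 ED).
Qed.

(** * Double roots modulo a squarefree integer *)

Lemma squarefree_dvd n d : squarefree n -> (d %| n)%N -> squarefree d.
Proof. by move=> sn dn p pp; apply: contra (sn p pp) => H; exact: dvdn_trans H dn. Qed.

Lemma squarefree_ind (P : nat -> Prop) : P 1%N ->
  (forall p n, prime p -> coprime p n -> (0 < n)%N -> squarefree n -> P n -> P (p * n)%N) ->
  forall n, (0 < n)%N -> squarefree n -> P n.
Proof.
move=> P1 PM n; elim/ltn_ind: n => n IH n0 sn.
have [n1|n1] := leqP n 1; first by have -> : n = 1%N by apply/eqP; rewrite eqn_leq n1.
have pp := pdiv_prime n1; have /dvdnP[k Ek] := pdiv_dvd n.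
set p := pdiv n in pp Ek; rewrite mulnC in Ek.
have k0 : (0 < k)%N by move: n0; rewrite Ek muln_gt0 => /andP[].
have cop : coprime p k.
  rewrite prime_coprime //; apply/negP => /dvdnP[j Ej].
  by move: (sn p pp); rewrite Ek Ej mulnCA dvdn_mull.
have sk : squarefree k by apply: (squarefree_dvd sn); rewrite Ek dvdn_mull.
rewrite Ek; apply: PM => //; apply: IH => //.
by rewrite Ek -[X in (X < _)%N]mul1n ltn_pmul2r // prime_gt1.
Qed.

Definition dbl_root (t A B : int) (n : nat) (r : int) : bool :=
  (n%:Z %| 3 * r ^+ 2 + 2 * t * r + A)%Z &&
  (n%:Z ^+ 2 %| r ^+ 3 + t * r ^+ 2 + A * r + B)%Z.

(** Taylor expansion: [f(r + k*n) = f(r) + k*n*f'(r)] modulo [n^2], and [n] divides [f'(r)]. So the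
    condition modulo [n^2] depends on [r] modulo [n] only. *)
Lemma dbl_root_shift t A B n r k : dbl_root t A B n r -> dbl_root t A B n (r + k * n%:Z).
Proof.
move=> /andP[h1 h2]; apply/andP; split.
  have -> : 3 * (r + k * n%:Z) ^+ 2 + 2 * t * (r + k * n%:Z) + A =
    3 * r ^+ 2 + 2 * t * r + A + (k * (6 * r + 3 * k * n%:Z + 2 * t)) * n%:Z by ring.
  by apply: rpredD => //; exact: dvdz_mull.
have -> : (r + k * n%:Z) ^+ 3 + t * (r + k * n%:Z) ^+ 2 + A * (r + k * n%:Z) + B =
  r ^+ 3 + t * r ^+ 2 + A * r + B + k * (n%:Z * (3 * r ^+ 2 + 2 * t * r + A))
   + (k ^+ 2 * (3 * r + t + k * n%:Z)) * n%:Z ^+ 2 by ring.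
apply: rpredD; last exact: dvdz_mull.
by apply: rpredD => //; apply: dvdz_mull; rewrite expr2 dvdz_mul.
Qed.

Lemma dbl_root_dvd t A B d n r : (d %| n)%N -> dbl_root t A B n r -> dbl_root t A B d r.
Proof.
move=> dn /andP[h1 h2]; have dz : (d%:Z %| n%:Z)%Z by rewrite dvdzE.
by apply/andP; split; [exact: dvdz_trans h1 | apply: dvdz_trans h2; rewrite !expr2 dvdz_mul].
Qed.

Lemma dbl_rootM t A B p n r : coprime p n ->
  dbl_root t A B p r -> dbl_root t A B n r -> dbl_root t A B (p * n) r.
Proof.
move=> cop /andP[p1 p2] /andP[n1 n2]; rewrite /dbl_root PoszM exprMn.
by apply/andP; split; rewrite Gauss_dvdz ?coprimezXl ?coprimezXr ?coprimezE // ?p1 ?p2.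
Qed.

(** With [d = r - s], [p] divides both [f(r) - f(s) - d*f'(s) = d^2*(3*s + t + d)] and
    [f'(r) - f'(s) = d*(2*(3*s + t) + 3*d)]. If [p] did not divide [d] it would divide both
    cofactors, and [d] is an integral combination of these. The argument is uniform in [p],
    including [2] and [3]. *)
Lemma dbl_root_uniq_prime t A B p r s : prime p ->
  dbl_root t A B p r -> dbl_root t A B p s -> (p%:Z %| r - s)%Z.
Proof.
move=> pp /andP[r1 r2] /andP[s1 s2].
have r3 : (p%:Z %| r ^+ 3 + t * r ^+ 2 + A * r + B)%Z by apply: dvdz_trans r2; rewrite expr2 dvdz_mulr.
have s3 : (p%:Z %| s ^+ 3 + t * s ^+ 2 + A * s + B)%Z by apply: dvdz_trans s2; rewrite expr2 dvdz_mulr.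
set d := r - s.
have pdvM (x y : int) : (p%:Z %| x * y)%Z -> (p%:Z %| x)%Z || (p%:Z %| y)%Z.
  by rewrite !dvdzE abszM /= Euclid_dvdM.
have h1 : (p%:Z %| d ^+ 2 * (3 * s + t + d))%Z.
  have -> : d ^+ 2 * (3 * s + t + d) = (r ^+ 3 + t * r ^+ 2 + A * r + B)
    - (s ^+ 3 + t * s ^+ 2 + A * s + B) - d * (3 * s ^+ 2 + 2 * t * s + A) by rewrite /d; ring.
  by apply: rpredB; [exact: rpredB | exact: dvdz_mull].
have h2 : (p%:Z %| d * (2 * (3 * s + t) + 3 * d))%Z.
  have -> : d * (2 * (3 * s + t) + 3 * d) = (3 * r ^+ 2 + 2 * t * r + A) - (3 * s ^+ 2 + 2 * t * s + A).
    by rewrite /d; ring.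
  exact: rpredB.
case/orP: (pdvM _ _ h2) => // h3; move: h1; rewrite expr2 => /pdvM/orP[/pdvM/orP[]//|h4].
have -> : d = (2 * (3 * s + t) + 3 * d) - 2 * (3 * s + t + d) by ring.
by apply: rpredB => //; exact: dvdz_mull.
Qed.

Lemma dbl_root_uniq t A B n r s : (0 < n)%N -> squarefree n ->
  dbl_root t A B n r -> dbl_root t A B n s -> (n%:Z %| r - s)%Z.
Proof.
move: n; apply: (squarefree_ind (P := fun n => dbl_root t A B n r -> dbl_root t A B n s -> (n%:Z %| r - s)%Z)).
  by move=> *; exact: dvd1z.
move=> p n pp cop _ _ IH h1 h2.
rewrite PoszM Gauss_dvdz ?coprimezE //; apply/andP; split.
  by apply: (dbl_root_uniq_prime pp); [apply: dbl_root_dvd h1 | apply: dbl_root_dvd h2]; rewrite dvdn_mulr.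
by apply: IH; [apply: dbl_root_dvd h1 | apply: dbl_root_dvd h2]; rewrite dvdn_mull.
Qed.

Lemma Sigma_dbl_root (f : VZ) (n : nat) : (0 < n)%N -> squarefree n ->
  Sigma n f <-> discZ f != 0 /\
     exists r : int, dbl_root (tcoef f) (Acoef f) (Bcoef f) n r.
Proof.
move=> n0 sn; split=> [[f0 [k [kI nk]]]|[f0 [r rr]]]; split=> //.
  move: n n0 sn nk; apply: (squarefree_ind (P := fun n => (n %| k)%N -> exists r, dbl_root (tcoef f) (Acoef f) (Bcoef f) n r)).
    by move=> _; exists 0; rewrite /dbl_root expr1n !dvd1z.
  move=> p n pp cop _ _ IH nk.
  have [|r rr] := IH; first by apply: dvdn_trans nk; rewrite dvdn_mull.
  have [|s [s1 s2]] := (prime_dvd_ind f0 pp kI).1; first by apply: dvdn_trans nk; rewrite dvdn_mulr.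
  have copz : coprimez p%:Z n%:Z by rewrite coprimezE.
  (* The roots at [p] and at [n] are glued by the Chinese remainder theorem; [dbl_root_shift] allows
     the change of representative. *)
  pose w := zchinese p%:Z n%:Z s r; exists w.
  have /eqP := zchinese_modl copz s r; rewrite eqz_mod_dvd => /dvdzP[i Ei].
  have /eqP := zchinese_modr copz s r; rewrite eqz_mod_dvd => /dvdzP[j Ej].
  apply: dbl_rootM => //.
    by rewrite -(subrK s w) Ei addrC; apply: dbl_root_shift; rewrite /dbl_root s1.
  by rewrite -(subrK r w) Ej addrC; apply: dbl_root_shift.
have [k kI] := is_ind_ex f0; exists k; split=> //.
move: n n0 sn rr; apply: (squarefree_ind (P := fun n => dbl_root (tcoef f) (Acoef f) (Bcoef f) n r -> (n %| k)%N)).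
  by rewrite dvd1n.
move=> p n pp cop _ _ IH rr.
rewrite Gauss_dvd // IH ?andbT; last by apply: dbl_root_dvd rr; rewrite dvdn_mull.
apply/(prime_dvd_ind f0 pp kI); exists r.
by have /andP[] : dbl_root (tcoef f) (Acoef f) (Bcoef f) p r by apply: dbl_root_dvd rr; rewrite dvdn_mulr.
Qed.

(** * The root bound *)

(* The symmetric function prod_(i<j) (Y^2 - a_i a_j) of the roots a_i. *)
Definition pairprod (R : comNzRingType) (Y t A B : R) : R :=
  Y ^+ 6 - A * Y ^+ 4 + t * B * Y ^+ 2 - B ^+ 2.

(** The first two conditions are [f(Y) > 0] and [f(-Y) < 0]. The three together still allow two real
    roots beyond [Y] on the same side, which [jury_hR_lt] and [jury_hR_lt_small] exclude by extra
    information on [t] or [B]. *)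
Definition jury (R : realType) (Y t A B : R) : Prop :=
  [/\ 0 < Y ^+ 3 + t * Y ^+ 2 + A * Y + B,
      - Y ^+ 3 + t * Y ^+ 2 - A * Y + B < 0 &
      0 < pairprod Y t A B].

Lemma pairprod_vieta (R : comNzRingType) (Y x y z : R) :
  pairprod Y (- (x + y + z)) (x * y + x * z + y * z) (- (x * y * z)) =
  (Y ^+ 2 - x * y) * (Y ^+ 2 - x * z) * (Y ^+ 2 - y * z).
Proof. by rewrite /pairprod; ring. Qed.

Section Jury.
Variable R : realType.
Implicit Types t A B Y : R.

Lemma hR_lt t A B Y (x y z : R[i]) :
  t%:C%C = - (x + y + z) -> A%:C%C = x * y + x * z + y * z -> B%:C%C = - (x * y * z) ->
  hR t A B < Y <-> [/\ Normc.normc x < Y, Normc.normc y < Y & Normc.normc z < Y].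
Proof.
move=> Et EA EB; rewrite /hR.
have -> : [set Normc.normc w | w in [set w : R[i] | root (map_poly (real_complex R) (cubic t A B)) w]]
  = [set Normc.normc x; Normc.normc y; Normc.normc z].
  rewrite map_cubic /= Et EA EB cubic_vieta.
  have rE w : root (('X - x%:P) * ('X - y%:P) * ('X - z%:P)) w = [|| w == x, w == y | w == z].
    by rewrite !rootM !root_XsubC orbA.
  apply/seteqP; split=> [_ [w + <-]|w].
    by rewrite /= rE => /or3P[] /eqP ->; [left; left|left; right|right].
  by move=> [[->|->]|->]; [exists x|exists y|exists z]; rewrite //= rE eqxx ?orbT.
set S := [set _; _; _].
have Sub : has_sup S.
  split; first by exists (Normc.normc x); left; left.
  exists (Num.max (Num.max (Normc.normc x) (Normc.normc y)) (Normc.normc z)).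
  by move=> _ [[->|->]|->]; rewrite !le_max lexx ?orbT.
split=> [sY|[hx hy hz]].
  have H w : S w -> w < Y by move=> Sw; apply: le_lt_trans sY; apply: sup_upper_bound.
  by split; apply: H; [left; left|left; right|right].
apply: (@le_lt_trans _ _ (Num.max (Num.max (Normc.normc x) (Normc.normc y)) (Normc.normc z))).
  apply: sup_le_ub; first by case: Sub.
  by move=> _ [[->|->]|->]; rewrite !le_max lexx ?orbT.
by rewrite !gt_max hx hy hz.
Qed.

(** Here [p] and [q] are the sum and the product of the two roots other than the real root [x]; the
    sign of [p^2 - 4*q] tells whether they are real or conjugate. *)
Lemma real_cubic_split t A B : exists (x p q : R),
  [/\ t = - (x + p), A = x * p + q, B = - (x * q) &
   (exists y z, p = y + z /\ q = y * z) \/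
   (exists u v, p = 2 * u /\ q = u ^+ 2 + v ^+ 2)].
Proof.
have [x rx] : exists x, root (cubic t A B) x.
  (* Cauchy's root bound: at [M] and [-M] the leading term dominates, so the cubic changes sign in
     between. *)
  pose M := 1 + `|t| + `|A| + `|B|.
  have M1 : 1 <= M by rewrite /M -!addrA lerDl !addr_ge0.
  have tM : `|t| + `|A| + `|B| = M - 1 by rewrite /M; ring.
  have bnd e : `|e| = 1 -> `|t * (e * M) ^+ 2 + A * (e * M) + B| < M ^+ 3.
    move=> e1; apply: (@le_lt_trans _ _ ((`|t| + `|A| + `|B|) * M ^+ 2)); last first.
      by rewrite tM [M ^+ 3]exprS ltr_pM2r ?exprn_gt0 //; lra.
    rewrite !mulrDl; apply: le_trans (ler_normD _ _) _; apply: lerD; last first.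
      by rewrite ler_peMr // exprn_ege1.
    have EM : `|M| = M by rewrite ger0_norm; lra.
    apply: le_trans (ler_normD _ _) _; apply: lerD.
      by rewrite normrM normrX normrM e1 mul1r EM.
    rewrite !normrM e1 mul1r EM ler_wpM2l // expr2 ler_peMr //; lra.
  have [x _ rx] : exists2 x, x \in `[- M, M] & root (cubic t A B) x.
    apply: poly_ivt; first by lra.
    rewrite !cubic_horner.
    have := bnd 1 (normr1 _); rewrite mul1r ltr_norml => /andP[h1 _].
    have := bnd (-1) (normrN1 _); rewrite mulN1r ltr_norml => /andP[_ h2].
    have -> : (- M) ^+ 3 = - M ^+ 3 by ring.
    by apply/andP; split; lra.
  by exists x.
move/rootP: rx; rewrite cubic_horner => rx.
pose p := - t - x; pose q := A - x * p.
exists x, p, q; split.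
- by rewrite /p; ring.
- by rewrite /q; ring.
- rewrite /q /p; apply/eqP; rewrite -subr_eq0; apply/eqP; rewrite -rx; ring.
have [d0|d0] := leP 0 (p ^+ 2 - 4 * q).
  left; pose d := Num.sqrt (p ^+ 2 - 4 * q).
  have dd : d ^+ 2 = p ^+ 2 - 4 * q by rewrite sqr_sqrtr.
  exists ((p + d) / 2), ((p - d) / 2); split; first by field.
  have -> : (p + d) / 2 * ((p - d) / 2) = (p ^+ 2 - d ^+ 2) / 4 by field.
  by rewrite dd; field.
right; pose d := Num.sqrt (4 * q - p ^+ 2).
have dd : d ^+ 2 = 4 * q - p ^+ 2 by rewrite sqr_sqrtr //; lra.
exists (p / 2), (d / 2); split; first by field.
by rewrite !exprMn dd; field.
Qed.

Lemma hR_lt_cases t A B Y : exists (x p q : R),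
  [/\ t = - (x + p), A = x * p + q, B = - (x * q) &
   (exists y z, [/\ p = y + z, q = y * z & hR t A B < Y <-> [/\ `|x| < Y, `|y| < Y & `|z| < Y]]) \/
   (exists u v, [/\ p = 2 * u, q = u ^+ 2 + v ^+ 2 & 0 < Y ->
      (hR t A B < Y <-> `|x| < Y /\ u ^+ 2 + v ^+ 2 < Y ^+ 2)])].
Proof.
have [x [p [q [Et EA EB H]]]] := real_cubic_split t A B.
exists x, p, q; split=> //.
have nc (w : R) : Normc.normc w%:C%C = `|w|.
  by rewrite /= expr0n /= addr0 sqrtr_sqr.
case: H => [[y [z [Ep Eq]]]|[u [v [Ep Eq]]]]; [left|right].
  exists y, z; split=> //.
  rewrite (@hR_lt t A B Y x%:C%C y%:C%C z%:C%C) ?nc //.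
  - by rewrite Et Ep -!rmorphD -rmorphN /= addrA.
  - by rewrite EA Ep Eq -!rmorphM -!rmorphD /=; congr (_%:C)%C; ring.
  - by rewrite EB Eq -!rmorphM -rmorphN /= mulrA.
exists u, v; split=> // Y0.
rewrite (@hR_lt t A B Y x%:C%C (u +i* v)%C (u -i* v)%C) ?nc.
- have E : (Normc.normc (u +i* v)%C < Y) = (u ^+ 2 + v ^+ 2 < Y ^+ 2).
    rewrite /= -(@ltr_pXn2r _ 2) ?nnegrE ?sqrtr_ge0 ?(ltW Y0) //.
    by rewrite sqr_sqrtr // addr_ge0 ?sqr_ge0.
  have E' : (Normc.normc (u -i* v)%C < Y) = (u ^+ 2 + v ^+ 2 < Y ^+ 2).
    by rewrite -E /= sqrrN.
  by rewrite E E'; split=> [[]//|[]].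
- by rewrite Et Ep; apply/eqP; rewrite eq_complex /=; apply/andP; split; apply/eqP; ring.
- by rewrite EA Ep Eq; apply/eqP; rewrite eq_complex /=; apply/andP; split; apply/eqP; ring.
- by rewrite EB Eq; apply/eqP; rewrite eq_complex /=; apply/andP; split; apply/eqP; ring.
Qed.

Lemma prodr_lt2 (x y Y : R) : `|x| < Y -> `|y| < Y -> 0 < Y ^+ 2 - x * y.
Proof.
move=> hx hy; rewrite subr_gt0; apply: le_lt_trans (ler_norm _) _.
by rewrite normrM expr2 ltr_pM.
Qed.

(** Each quantity factors over the roots with factors of known sign. For a conjugate pair [w], [w'],
    [pairprod] is [(Y^2 - w*w')] times the squared modulus of [Y^2 - x*w]. *)
Lemma hR_lt_jury t A B Y : 0 < Y -> hR t A B < Y -> jury Y t A B /\ `|B| < Y ^+ 3.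
Proof.
move=> Y0 hY; have [x [p [q [Et EA EB H]]]] := hR_lt_cases t A B Y.
case: H => [[y [z [Ep Eq /iffLR/(_ hY)[hx hy hz]]]]|[u [v [Ep Eq /(_ Y0)/iffLR/(_ hY)[hx huv]]]]].
  subst p q; split; last first.
    by rewrite EB normrN !normrM !exprS expr0 mulr1; apply: ltr_pM => //; rewrite ?mulr_ge0 ?ltr_pM.
  have EP : pairprod Y t A B = (Y ^+ 2 - x * y) * (Y ^+ 2 - x * z) * (Y ^+ 2 - y * z).
    by rewrite -pairprod_vieta Et EA EB; congr pairprod; ring.
  move: (hx) (hy) (hz); rewrite !ltr_norml => /andP[x1 x2] /andP[y1 y2] /andP[z1 z2].
  split; last by rewrite EP !mulr_gt0 ?prodr_lt2.
  - have -> : Y ^+ 3 + t * Y ^+ 2 + A * Y + B = (Y - x) * (Y - y) * (Y - z) by rewrite Et EA EB; ring.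
    by rewrite !mulr_gt0 // subr_gt0.
  - have -> : - Y ^+ 3 + t * Y ^+ 2 - A * Y + B = - ((Y + x) * (Y + y) * (Y + z)) by rewrite Et EA EB; ring.
    by rewrite oppr_lt0 !mulr_gt0 //; lra.
subst p q; split; last first.
  rewrite EB normrN normrM [ `|_ + _|]ger0_norm ?addr_ge0 ?sqr_ge0 //.
  by rewrite exprS; apply: ltr_pM => //; rewrite addr_ge0 ?sqr_ge0.
move: (hx); rewrite !ltr_norml => /andP[x1 x2].
have u2 : `|u| < Y.
  rewrite -(ltr_pXn2r (n := 2)) ?nnegrE ?normr_ge0 ?(ltW Y0) // real_normK ?num_real //.
  by have := sqr_ge0 v; lra.
move: u2; rewrite ltr_norml => /andP[u1 u2].
split.
- have -> : Y ^+ 3 + t * Y ^+ 2 + A * Y + B = (Y - x) * ((Y - u) ^+ 2 + v ^+ 2) by rewrite Et EA EB; ring.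
  by rewrite mulr_gt0 ?subr_gt0 // ltr_wpDr ?sqr_ge0 // exprn_gt0 // subr_gt0.
- have -> : - Y ^+ 3 + t * Y ^+ 2 - A * Y + B = - ((Y + x) * ((Y + u) ^+ 2 + v ^+ 2)) by rewrite Et EA EB; ring.
  by rewrite oppr_lt0 mulr_gt0 //; [lra | rewrite ltr_wpDr ?sqr_ge0 // exprn_gt0 //; lra].
rewrite (_ : pairprod Y t A B = (Y ^+ 2 - (u ^+ 2 + v ^+ 2)) * ((Y ^+ 2 - x * u) ^+ 2 + (x * v) ^+ 2));
  last by rewrite /pairprod Et EA EB; ring.
rewrite mulr_gt0 ?subr_gt0 // ltr_wpDr ?sqr_ge0 // exprn_gt0 //.
by apply: prodr_lt2 => //; rewrite ltr_norml u1.
Qed.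

(** The signs at [Y] and at [-Y] force an even number of real roots beyond [Y] and beyond [-Y], so
    with three real roots either none or exactly two on one side lie outside. With a conjugate pair,
    the sign of [pairprod] decides whether the pair lies inside. *)
Lemma jury_hR_cases t A B Y : 0 < Y -> jury Y t A B -> hR t A B < Y \/
  exists x y z, [/\ t = - (x + y + z), B = - (x * y * z),
    0 < (Y ^+ 2 - x * y) * (Y ^+ 2 - x * z) * (Y ^+ 2 - y * z), `|z| < Y &
    (Y < x /\ Y < y) \/ (x < - Y /\ y < - Y)].
Proof.
move=> Y0 [f1 f2 P].
have [x [p [q [Et EA EB H]]]] := hR_lt_cases t A B Y.
case: H => [[y [z [Ep Eq ->]]]|[u [v [Ep Eq /(_ Y0) ->]]]]; subst p q; last first.
  left; move: f1 f2 P.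
  have -> : Y ^+ 3 + t * Y ^+ 2 + A * Y + B = (Y - x) * ((Y - u) ^+ 2 + v ^+ 2) by rewrite Et EA EB; ring.
  have -> : - Y ^+ 3 + t * Y ^+ 2 - A * Y + B = - ((Y + x) * ((Y + u) ^+ 2 + v ^+ 2)) by rewrite Et EA EB; ring.
  have -> : pairprod Y t A B = (Y ^+ 2 - (u ^+ 2 + v ^+ 2)) * ((Y ^+ 2 - x * u) ^+ 2 + (x * v) ^+ 2).
    by rewrite /pairprod Et EA EB; ring.
  have pos (a b c : R) : 0 < a * (b ^+ 2 + c ^+ 2) -> 0 < a.
    move=> h; rewrite ltNge; apply/negP => a0; move: h; rewrite ltNge => /negP; apply.
    by apply: mulr_le0_ge0 => //; rewrite addr_ge0 ?sqr_ge0.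
  rewrite oppr_lt0 => /pos f1 /pos f2 /pos P.
  by split; [rewrite ltr_norml; apply/andP; split; lra | lra].
move: f1 f2 P.
have -> : Y ^+ 3 + t * Y ^+ 2 + A * Y + B = (Y - x) * (Y - y) * (Y - z) by rewrite Et EA EB; ring.
have -> : - Y ^+ 3 + t * Y ^+ 2 - A * Y + B = - ((Y + x) * (Y + y) * (Y + z)) by rewrite Et EA EB; ring.
rewrite oppr_lt0.
have sgn3 (a b c : R) : 0 < a * b * c ->
  [\/ [/\ 0 < a, 0 < b & 0 < c], [/\ 0 < a, b < 0 & c < 0], [/\ a < 0, 0 < b & c < 0] | [/\ a < 0, b < 0 & 0 < c]].
  move=> h; case: (ltgtP 0 a) h => [a0|a0|<-]; last by rewrite !mul0r ltxx.
    rewrite -mulrA pmulr_rgt0 //; case: (ltgtP 0 b) => [b0|b0|<-]; last by rewrite mul0r ltxx.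
      by rewrite pmulr_rgt0 // => c0; constructor 1.
    by rewrite nmulr_rgt0 // => c0; constructor 2.
  rewrite -mulrA nmulr_rgt0 //; case: (ltgtP 0 b) => [b0|b0|<-]; last by rewrite mul0r ltxx.
    by rewrite pmulr_rlt0 // => c0; constructor 3.
  by rewrite nmulr_rlt0 // => c0; constructor 4.
have -> : pairprod Y t A B = (Y ^+ 2 - x * y) * (Y ^+ 2 - x * z) * (Y ^+ 2 - y * z).
  by rewrite /pairprod Et EA EB; ring.
have nl (w : R) : 0 < Y - w -> 0 < Y + w -> `|w| < Y by move=> *; rewrite ltr_norml; apply/andP; split; lra.
have bad x' y' z' : t = - (x' + y' + z') -> B = - (x' * y' * z') ->
    0 < Y - z' -> 0 < Y + z' -> (Y - x' < 0 /\ Y - y' < 0) \/ (Y + x' < 0 /\ Y + y' < 0) ->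
    0 < (Y ^+ 2 - x' * y') * (Y ^+ 2 - x' * z') * (Y ^+ 2 - y' * z') ->
    exists x y z, [/\ t = - (x + y + z), B = - (x * y * z),
      0 < (Y ^+ 2 - x * y) * (Y ^+ 2 - x * z) * (Y ^+ 2 - y * z), `|z| < Y &
      (Y < x /\ Y < y) \/ (x < - Y /\ y < - Y)].
  move=> h1 h2 h3 h4 h5 h6; exists x', y', z'; split=> //; first exact: nl.
  by case: h5 => -[h7 h8]; [left | right]; split; lra.
move=> /sgn3[] [a1 a2 a3] /sgn3[] [b1 b2 b3] P; try (exfalso; lra).
- by left; split; exact: nl.
- right; apply: (bad y z x) => //; [lra | rewrite EB; ring | by right | by move: P; congr (0 < _); ring].
- right; apply: (bad x z y) => //; [lra | rewrite EB; ring | by right | by move: P; congr (0 < _); ring].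
- right; apply: (bad x y z) => //; [lra | rewrite EB; ring | by right].
- right; apply: (bad y z x) => //; [lra | rewrite EB; ring | by left | by move: P; congr (0 < _); ring].
- right; apply: (bad x z y) => //; [lra | rewrite EB; ring | by left | by move: P; congr (0 < _); ring].
- right; apply: (bad x y z) => //; [lra | rewrite EB; ring | by left].
Qed.

(** Two roots beyond [Y] on the same side and a third of modulus less than [Y] have a sum exceeding
    [Y >= 1] in absolute value, which contradicts the bound on [t]. *)
Lemma jury_hR_lt t A B Y : 1 <= Y -> `|t| <= 1 -> jury Y t A B -> hR t A B < Y.
Proof.
move=> Y1 t1 J; have Y0 : 0 < Y by lra.
have [//|[x [y [z [Et _ _ hz H]]]]] := jury_hR_cases Y0 J.
move: t1 hz; rewrite ler_norml ltr_norml => /andP[t1 t2] /andP[z1 z2].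
by exfalso; case: H => -[h1 h2]; lra.
Qed.

(** If [a] and [b] are roots beyond [Y], then [Y^2 - a*b < 0], and positivity of [pairprod] makes
    one of [a*c], [b*c] exceed [Y^2]; then the product of the roots is at least [Y^3]. This version
    is valid for [Y < 1]. *)
Lemma jury_hR_lt_small t A B Y : 0 < Y -> jury Y t A B -> `|B| < Y ^+ 3 -> hR t A B < Y.
Proof.
move=> Y0 J; have [//|[x [y [z [_ EB P hz H]]]]] := jury_hR_cases Y0 J.
have big (a b c : R) : Y < a -> Y < b ->
    0 < (Y ^+ 2 - a * b) * (Y ^+ 2 - a * c) * (Y ^+ 2 - b * c) -> Y ^+ 3 <= a * b * c.
  move=> ha hb; have ab : Y ^+ 2 - a * b < 0.
    by rewrite subr_lt0 expr2; apply: ltr_pM => //; exact: ltW.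
  rewrite -mulrA nmulr_rgt0 // => h.
  have [h1|h1] := ltP (Y ^+ 2) (a * c).
    rewrite mulrAC exprSr; apply: ler_pM; rewrite ?sqr_ge0 //; exact: ltW.
  have [h2|h2] := ltP (Y ^+ 2) (b * c).
    rewrite -mulrA mulrC exprSr; apply: ler_pM; rewrite ?sqr_ge0 //; exact: ltW.
  by move: h; rewrite ltNge mulr_ge0 // subr_ge0.
rewrite EB normrN => hB; case: H => -[h1 h2]; exfalso.
  have h := big _ _ z h1 h2 P.
  by have := lt_le_trans hB h; rewrite ltNge ler_norm.
have h : Y ^+ 3 <= - x * - y * - z.
  by apply: big; [lra | lra | move: P; congr (0 < _); ring].
have := lt_le_trans hB h; rewrite ltNge -normrN; apply/negP; rewrite negbK.
by apply: le_trans (ler_norm _); rewrite le_eqVlt; apply/orP; left; apply/eqP; ring.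
Qed.

(** The lower bound is [f(Y) > f(-Y)] divided by [2*Y]; the upper one is [pairprod > 0] with [t*B]
    bounded by [Y^3]. *)
Lemma jury_bounds t A B Y : 0 < Y -> `|t| <= 1 -> jury Y t A B -> `|B| < Y ^+ 3 ->
  - Y ^+ 2 < A < Y ^+ 2 + Y.
Proof.
move=> Y0 t1 [f1 f2 P] B1; apply/andP; split.
  have : 0 < Y * (Y ^+ 2 + A) by nra.
  by rewrite pmulr_rgt0 //; lra.
have tB : t * B * Y ^+ 2 <= Y ^+ 3 * Y ^+ 2.
  apply: ler_wpM2r; first exact: sqr_ge0.
  apply: le_trans (ler_norm _) _; rewrite normrM -[leRHS]mul1r.
  by apply: ler_pM => //; exact: ltW.
have : 0 < Y ^+ 4 * (Y ^+ 2 + Y - A).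
  by move: P tB; rewrite /pairprod; have := sqr_ge0 B; nra.
by rewrite pmulr_rgt0 ?exprn_gt0 //; lra.
Qed.
End Jury.

(** * Counting points in slices *)

Section Breakpoints.
Variable R : realType.
Implicit Types (E F : set R) (s : seq R).

(* [E] is, up to its finitely many boundary points, a union of at most [K + 1] intervals. *)
Definition breakpoints (K : nat) E : Prop := exists s : seq R, (size s <= K)%N /\
  forall x y, x <= y -> (forall z, z \in s -> ~~ (x <= z <= y)) -> (E x <-> E y).

Lemma breakpointsI K L E F : breakpoints K E -> breakpoints L F -> breakpoints (K + L) (E `&` F).
Proof.
move=> [s [sK sE]] [u [uL uF]]; exists (s ++ u); rewrite size_cat leq_add //; split=> // x y xy H.
have HE : E x <-> E y by apply: sE => // z zs; apply: H; rewrite mem_cat zs.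
have HF : F x <-> F y by apply: uF => // z zs; apply: H; rewrite mem_cat zs orbT.
by split=> -[ex fx]; split; tauto.
Qed.

(** The roots serve as breakpoints, by the intermediate value theorem; the zero polynomial has none
    and its positivity set is empty. *)
Lemma breakpoints_poly (p : {poly R}) K : (size p <= K.+1)%N ->
  breakpoints K [set x | 0 < p.[x]].
Proof.
move=> sp; have [p0|p0] := eqVneq p 0.
  by exists [::]; split=> // x y _ _; rewrite /= p0 !horner0 ltxx.
have [s [us rs]] : exists s : seq R, uniq s /\ forall x, root p x = (x \in s).
  have [s us rs] : exists2 s : seq R, uniq s & (forall x, root p x -> x \in s).
    have H n : forall u : seq R, uniq u -> all (root p) u -> (size p <= size u + n)%N ->
        exists2 s : seq R, uniq s & (forall x, root p x -> x \in s).
      elim: n => [|n IH] u uu ru su.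
        by have := max_poly_roots p0 ru uu; rewrite addn0 in su; rewrite ltnNge su.
      have [[x [rx xu]]|nx] := pselect (exists x, root p x /\ x \notin u).
        by apply: (IH (x :: u)); rewrite /= ?xu ?rx // addSnnS.
      exists u => // x rx; apply: contrapT => xu; apply: nx; exists x; split=> //; exact/negP.
    exact: (H (size p) [::]).
  exists [seq x <- s | root p x]; rewrite filter_uniq //; split=> // x.
  by rewrite mem_filter; case: (boolP (root p x)) => // /rs ->.
exists s; split.
  rewrite -ltnS; apply: leq_trans sp; apply: max_poly_roots => //.
  by apply/allP => x; rewrite rs.
move=> x y xy H.
have nr z : x <= z <= y -> p.[z] != 0.
  move=> xzy; apply/negP => pz; have := H z; rewrite -rs /root pz => /(_ isT).
  by rewrite xzy.
have px : p.[x] != 0 by apply: nr; rewrite lexx.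
have py : p.[y] != 0 by apply: nr; rewrite lexx xy.
have noivt (q : {poly R}) : (forall z, x <= z <= y -> q.[z] != 0) -> ~ (q.[x] <= 0 <= q.[y]).
  move=> nq /(poly_ivt xy)[z zxy /rootP qz].
  by have := nq z zxy; rewrite qz eqxx.
rewrite /=; split=> h.
  rewrite lt_neqAle eq_sym py //= leNgt; apply/negP => h'.
  apply: (noivt (- p)); last by rewrite !hornerN oppr_le0 oppr_ge0 (ltW h) (ltW h').
  by move=> z /nr; rewrite hornerN oppr_eq0.
rewrite lt_neqAle eq_sym px //= leNgt; apply/negP => h'.
by apply: (noivt p) => //; rewrite (ltW h) (ltW h').
Qed.

Definition cnt (c d : R) (J : nat) E : R := \sum_(j < J) (\1_E (c + d * j%:R) : R).

Lemma cell_trivIset (c d : R) : 0 < d ->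
  trivIset setT (fun j : nat => `[c + d * j%:R, c + d * (j.+1)%:R[%classic).
Proof.
move=> d0; apply/trivIsetP => i j _ _ ij; apply/seteqP; split=> // x [] /=.
rewrite !in_itv /= => /andP[i1 i2] /andP[j1 j2].
have := le_lt_trans i1 j2; have := le_lt_trans j1 i2.
rewrite !ltrD2l !ltr_pM2l // !ltr_nat !ltnS => h1 h2.
by move/eqP: ij; apply; apply/eqP; rewrite eqn_leq h1 h2.
Qed.

Lemma cell_cover (c d : R) J x : 0 < d -> c <= x < c + d * J%:R ->
  exists j : 'I_J, `[c + d * j%:R, c + d * (j.+1)%:R[%classic x.
Proof.
move=> d0 /andP[cx xJ].
have q0 : 0 <= (x - c) / d by rewrite divr_ge0 ?subr_ge0 // ltW.
have := truncn_itv q0; set k := Num.truncn _ => /andP[k1 k2].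
have kJ : (k < J)%N.
  rewrite -(ltr_nat R); apply: le_lt_trans k1 _.
  by rewrite ltr_pdivrMr // mulrC ltrBlDl.
exists (Ordinal kJ); rewrite /= in_itv /=.
move: k1 k2; rewrite ler_pdivlMr // ltr_pdivrMr // => k1 k2.
by rewrite -lerBrDl mulrC k1 /= -ltrBlDl mulrC.
Qed.

Local Notation mu := (@lebesgue_measure R).

Lemma le_mu E F : measurable E -> measurable F -> E `<=` F -> (mu E <= mu F)%E.
Proof. by move=> mE mF EF; apply: le_measure; rewrite ?inE. Qed.

(* A half-open cell containing no breakpoint of [E] is either inside or outside [E], according
   to its left endpoint. *)
Lemma cnt_measure K E (c d : R) J : measurable E -> breakpoints K E -> 0 < d ->
  (forall x, E x -> c <= x < c + d * J%:R) ->
  (mu E < +oo)%E /\ `|cnt c d J E - fine (mu E) / d| <= K%:R.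
Proof.
move=> mE [s [sK sE]] d0 Ecov.
pose I (j : nat) := `[c + d * j%:R, c + d * (j.+1)%:R[%classic.
have mI j : measurable (I j) by exact: measurable_itv.
have muI j : mu (I j) = d%:E.
  rewrite /I lebesgue_measure_itv /= lte_fin ltrD2l ltr_pM2l // ltr_nat ltnSn.
  by rewrite -EFinB; congr EFin; rewrite -natr1; ring.
have EI : E = \big[setU/set0]_(j < J) (E `&` I j).
  rewrite -(bigcup_mkord J (fun j => E `&` I j)); apply/seteqP; split=> x.
    by move=> Ex; have [j jx] := cell_cover d0 (Ecov x Ex); exists j => //; exact: ltn_ord.
  by case=> j _ [].
have muE : mu E = (\sum_(j < J) mu (E `&` I j))%E.
  rewrite {1}EI (@measure_bigsetU _ _ _ mu (fun j => E `&` I j)) //.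
    by move=> j; apply: measurableI; [exact: mE | exact: mI].
  by apply: (@trivIset_setIl _ _ setT I (fun=> E)); exact: cell_trivIset.
have mEI j : measurable (E `&` I j) by apply: measurableI; [exact: mE | exact: mI].
have EIle j : (mu (E `&` I j) <= mu (I j))%E by apply: le_mu (mEI j) (mI j) _ => x [].
have fin j : (mu (E `&` I j) < +oo)%E.
  by apply: le_lt_trans (EIle j) _; rewrite muI ltry.
have finE j : mu (E `&` I j) = (fine (mu (E `&` I j)))%:E.
  by rewrite fineK // ge0_fin_numE.
split; first by rewrite muE lte_sum_pinfty.
have -> : fine (mu E) = \sum_(j < J) fine (mu (E `&` I j)).
  by rewrite muE; under eq_bigr do rewrite finE; rewrite sumEFin.
rewrite /cnt mulr_suml -sumrB.
pose bad (j : 'I_J) := has (fun z => z \in `[c + d * j%:R, c + d * (j.+1)%:R[) s.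
apply: le_trans (ler_norm_sum _ _ _) _.
apply: (@le_trans _ _ (\sum_(j < J) (bad j)%:R)).
  apply: ler_sum => j _; have [bj|gj] := boolP (bad j).
    have h1 : 0 <= fine (mu (E `&` I j)) / d <= 1.
      rewrite divr_ge0 ?fine_ge0 ?(ltW d0) //= ler_pdivrMr // mul1r -lee_fin -finE -(muI j).
      exact: EIle.
    rewrite indicE; case: (_ \in _) => /=; rewrite ler_norml; apply/andP; split; lra.
  have EE x : I j x -> (E (c + d * j%:R) <-> E x).
    rewrite /I /= in_itv /= => /andP[x1 x2]; apply: sE => // z zs.
    apply: contra gj => /andP[z1 z2]; apply/hasP; exists z => //.
    by rewrite in_itv /= z1 (le_lt_trans z2).
  rewrite indicE; have [Ej|nEj] := pselect (E (c + d * j%:R)).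
    rewrite mem_set //; have -> : E `&` I j = I j.
      by apply/seteqP; split=> x; [case|move=> xI; split=> //; apply/(EE x xI)].
    by rewrite muI /= divff ?gt_eqF // subrr normr0.
  rewrite memNset //; have -> : E `&` I j = set0.
    by apply/seteqP; split=> x // [Ex xI]; apply: nEj; apply/(EE x xI).
  by rewrite measure0 mul0r subr0 normr0.
rewrite -natr_sum ler_nat; apply: leq_trans sK.
apply: (@leq_trans (\sum_(j < J) count (fun z => z \in `[c + d * j%:R, c + d * (j.+1)%:R[%R) s)%N).
  by apply: leq_sum => j _; rewrite /bad has_count; case: (count _ _).
rewrite (eq_bigr (fun j : 'I_J => \sum_(z <- s) ((z \in `[c + d * j%:R, c + d * (j.+1)%:R[%R) : nat))%N); last first.
  by move=> j _; rewrite -sum1_count big_mkcond.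
(* Double counting: the cells are disjoint, so each breakpoint spoils at most one of them. *)
rewrite exchange_big /= -sum1_size; apply: leq_sum => z _.
have [[j zj]|nz] := pselect (exists j : 'I_J, z \in `[c + d * j%:R, c + d * (j.+1)%:R[).
  rewrite (bigD1 j) //= zj big1 // => i ij; apply/eqP; rewrite eqb0; apply/negP => zi.
  move/eqP: ij; apply; apply/val_inj.
  by apply: (@cell_trivIset c d d0) => //; exists z.
by rewrite big1 // => j _; apply/eqP; rewrite eqb0; apply/negP => zj; apply: nz; exists j.
Qed.

Lemma mu_le_itv E (a b : R) : measurable E -> a <= b -> (forall x, E x -> a <= x <= b) ->
  (mu E <= (b - a)%:E)%E.
Proof.
move=> mE ab H; apply: (@le_trans _ _ (mu `[a, b]%classic)).
  by apply: le_measure; rewrite ?inE //= => x /H; rewrite in_itv.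
by rewrite lebesgue_measure_itv /= lte_fin; case: ltP => // _; rewrite lee_fin subr_ge0.
Qed.

Lemma mu_fin E (a b : R) : measurable E -> a <= b -> (forall x, E x -> a <= x <= b) ->
  mu E = (fine (mu E))%:E.
Proof.
move=> mE ab H; rewrite fineK // ge0_fin_numE //.
by apply: le_lt_trans (mu_le_itv mE ab H) _; rewrite ltry.
Qed.

Lemma integral_indicT E : measurable E -> (\int[mu]_x (\1_E x)%:E)%E = mu E.
Proof.
move=> mE; have := @integral_indic _ _ R mu setT measurableT E mE.
by rewrite setIT.
Qed.

(** By Tonelli, the sum of slice lengths is the integral over [y] of the number of points [c + d*j]
    in the horizontal section at [y], while the measure of [D] is the integral of the lengths of
    these sections. [cnt_measure] compares the two for every [y], and its error [K] is integrated
    over [[-b, b]]. *)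
Lemma slices_measure K (D : set (R * R)) (c d b : R) J :
  measurable D -> 0 < d -> 0 < b ->
  (forall x y, D (x, y) -> c <= x < c + d * J%:R /\ - b <= y <= b) ->
  (forall y, breakpoints K [set x | D (x, y)]) ->
  ((mu \x mu)%E D < +oo)%E /\
  `| \sum_(j < J) fine (mu [set y | D (c + d * j%:R, y)]) - fine ((mu \x mu)%E D) / d| <= K%:R * (2 * b).
Proof.
move=> mD d0 b0 Dbox DK.
have xsE x : [set y | D (x, y)] = xsection D x.
  by apply/seteqP; split=> y; rewrite /xsection /= inE.
have ysE y : [set x | D (x, y)] = ysection D y.
  by apply/seteqP; split=> x; rewrite /ysection /= inE.
have mxs x : measurable [set y | D (x, y)] by rewrite xsE; exact: measurable_xsection.
have mys y : measurable [set x | D (x, y)] by rewrite ysE; exact: measurable_ysection.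
pose g y := mu [set x | D (x, y)].
pose h y : \bar R := (\sum_(j < J) (\1_[set y | D (c + d * j%:R, y)] y)%:E)%E.
pose k y : \bar R := ((d * K%:R)%:E * (\1_(`[- b, b]%classic : set R) y)%:E)%E.
have VE : (mu \x mu)%E D = (\int[mu]_y g y)%E.
  have := @indic_fubini_tonelli _ _ _ _ R mu mu D mD.
  rewrite indic_fubini_tonelli_FE // indic_fubini_tonelli_GE //.
  rewrite /product_measure1 => ->; apply: eq_integral => y _ /=.
  by rewrite /g ysE.
have mg : measurable_fun setT g.
  have := @measurable_fun_ysection _ _ _ _ R mu D mD.
  by congr (measurable_fun _ _); apply/funext => y /=; rewrite /g ysE.
have g0 y : (0 <= g y)%E by exact: measure_ge0.
have m1 (j : 'I_J) : measurable_fun setT (fun y => (\1_[set y | D (c + d * j%:R, y)] y)%:E : \bar R).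
  by apply/measurable_EFinP; exact: measurable_indic.
have h0 y : (0 <= h y)%E by apply: sume_ge0 => j _; rewrite lee_fin indicE.
have mh : measurable_fun setT h by apply: emeasurable_sum => j; exact: m1.
have k0 y : (0 <= k y)%E by rewrite mule_ge0 // lee_fin ?indicE // mulr_ge0 // ltW.
have mind : measurable_fun setT (fun y => (\1_(`[- b, b]%classic : set R) y)%:E : \bar R).
  by apply/measurable_EFinP; exact: measurable_indic.
have mk : measurable_fun setT k by apply: measurable_funeM.
have Ih : (\int[mu]_y h y = \sum_(j < J) mu [set y | D ((c + d * j%:R)%R, y)])%E.
  rewrite /h ge0_integral_sum //; apply: eq_bigr => j _.
  exact: integral_indicT.
have Ik : (\int[mu]_y k y = (d * K%:R * (2 * b))%R%:E)%E.
  rewrite /k ge0_integralZl_EFin //; last by rewrite mulr_ge0 // ltW.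
  rewrite integral_indicT // lebesgue_measure_itv /= lte_fin gtrN //.
  by rewrite -EFinB -EFinM; congr EFin; ring.
have pt y : (d%:E * h y <= g y + k y)%E /\ (g y <= d%:E * h y + k y)%E.
  have hE : h y = (cnt c d J [set x | D (x, y)])%:E.
    have E1 (j : 'I_J) : \1_[set y | D (c + d * j%:R, y)] y = \1_[set x | D (x, y)] (c + d * j%:R) :> R.
      by rewrite !indicE; congr (_%:R); congr nat_of_bool; apply/idP/idP; rewrite !inE.
    by rewrite /h /cnt sumEFin (eq_bigr _ (fun j _ => E1 j)).
  have [yb|yb] := boolP (- b <= y <= b).
    have [gfin gb] := cnt_measure (mys y) (DK y) d0 (fun x Dx => (Dbox x y Dx).1).
    have gE : g y = (fine (g y))%:E by rewrite fineK // ge0_fin_numE.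
    have kE : k y = (d * K%:R)%:E.
      by rewrite /k indicE mem_set ?mule1 // /= in_itv.
    rewrite hE kE gE -!EFinM -!EFinD !lee_fin.
    move: gb; rewrite -/(g y) ler_norml => /andP[].
    rewrite lerBrDr lerBlDr => h1 h2.
    have e1 : d * (fine (g y) / d) = fine (g y) by rewrite mulrC divfK // gt_eqF.
    split; first by rewrite -e1 -mulrDr ler_pM2l // addrC.
    have h3 : d * (- K%:R + fine (g y) / d) <= d * cnt c d J [set x | D (x, y)] by rewrite ler_pM2l.
    move: h3; rewrite mulrDr mulrN e1; lra.
  have e0 : [set x | D (x, y)] = set0.
    by apply/seteqP; split=> // x /= /Dbox[_]; apply/negP.
  have gE : g y = 0%E by rewrite /g e0 measure0.
  have hE0 : h y = 0%E by rewrite hE /cnt big1 // => j _; rewrite e0 indicE in_set0.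
  by rewrite gE hE0 mule0 !add0e; split.
have dh0 y : (0 <= d%:E * h y)%E by rewrite mule_ge0 // lee_fin ltW.
have mdh : measurable_fun setT (fun y => d%:E * h y)%E by exact: measurable_funeM.
have Idh : (\int[mu]_y (d%:E * h y) = d%:E * \int[mu]_y h y)%E by rewrite ge0_integralZl_EFin // ltW.
have c1 : (d%:E * \int[mu]_y h y <= (mu \x mu)%E D + (d * K%:R * (2 * b))%R%:E)%E.
  rewrite -Idh VE -Ik -ge0_integralD //; apply: ge0_le_integral => //.
  - exact: emeasurable_funD.
  - by move=> y _; case: (pt y).
have c2 : ((mu \x mu)%E D <= d%:E * \int[mu]_y h y + (d * K%:R * (2 * b))%R%:E)%E.
  rewrite -Idh VE -Ik -ge0_integralD //; apply: ge0_le_integral => //.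
  - exact: emeasurable_funD.
  - by move=> y _; case: (pt y).
have sfin x : mu [set y | D (x, y)] = (fine (mu [set y | D (x, y)]))%:E.
  by apply: (@mu_fin _ (- b) b) => //; [lra | move=> y /Dbox[]].
have Ih2 : (\int[mu]_y h y = (\sum_(j < J) fine (mu [set y | D ((c + d * j%:R)%R, y)]))%R%:E)%E.
  by rewrite Ih -sumEFin; apply: eq_bigr => j _; exact: sfin.
move: c1 c2; rewrite Ih2 -EFinM; set S := \sum_(j < J) _ => c1 c2.
have Vfin : ((mu \x mu)%E D < +oo)%E by apply: le_lt_trans c2 _; rewrite -EFinD ltry.
split=> //; move: c1 c2.
have -> : (mu \x mu)%E D = (fine ((mu \x mu)%E D))%:E by rewrite fineK // ge0_fin_numE.
rewrite -!EFinD !lee_fin /=; set V := fine _ => c1 c2.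
have -> : S - V / d = (d * S - V) / d by field; rewrite gt_eqF.
rewrite normrM [ `|d^-1|]gtr0_norm ?invr_gt0 // ler_pdivrMr // ler_norml.
by apply/andP; split; lra.
Qed.

End Breakpoints.

(** * The regions and their slices *)

Section Regions.
Variable R : realType.
Local Notation mu := (@lebesgue_measure R).

(** [VR_region] with Jury's inequalities in place of the root bound, so that sections in either
    variable have boundedly many breakpoints. The two sets agree for [Y >= 1] by [VR_regionE]. *)
Definition region (s X Y t : R) : set (R * R) :=
  [set AB | 0 < s * disc t AB.1 AB.2 /\ `|disc t AB.1 AB.2| < X /\ jury Y t AB.1 AB.2].

Lemma region_setI s X Y t : region s X Y t =
  [set z | 0 < s * disc t z.1 z.2] `&` ([set z | 0 < X - disc t z.1 z.2] `&`
  ([set z | 0 < X + disc t z.1 z.2] `&` ([set z | 0 < Y ^+ 3 + t * Y ^+ 2 + z.1 * Y + z.2] `&`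
  ([set z | 0 < Y ^+ 3 - t * Y ^+ 2 + z.1 * Y - z.2] `&` [set z | 0 < pairprod Y t z.1 z.2])))).
Proof.
rewrite /region; apply/seteqP; split=> [[A B]|[A B]] /=.
  move=> [h1 [h2 [h3 h4 h5]]]; move: h2; rewrite ltr_norml => /andP[h6 h7].
  by do ![split] => //; lra.
move=> [h1 [h2 [h3 [h4 [h5 h6]]]]]; split=> //; split.
  by rewrite ltr_norml; apply/andP; split; lra.
by split=> //; lra.
Qed.

Lemma measurable_pos (f : R * R -> R) : measurable_fun setT f -> measurable [set z | 0 < f z].
Proof.
move=> mf; have -> : [set z | 0 < f z] = setT `&` f @^-1` `]0, +oo[%classic.
  by rewrite setTI; apply/seteqP; split=> z /=; rewrite in_itv /= andbT.
by apply: mf => //; exact: measurable_itv.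
Qed.

Lemma measurable_region s X Y t : measurable (region s X Y t).
Proof.
have m1 : measurable_fun setT (fst : R * R -> R) by exact: measurable_fst.
have m2 : measurable_fun setT (snd : R * R -> R) by exact: measurable_snd.
have md : measurable_fun setT (fun z : R * R => disc t z.1 z.2).
  rewrite /disc; repeat first [exact: m1 | exact: m2 | exact: measurable_cst |
    apply: measurable_funB | apply: measurable_funD | apply: measurable_funM | apply: measurable_funX].
have mp : measurable_fun setT (fun z : R * R => pairprod Y t z.1 z.2).
  rewrite /pairprod; repeat first [exact: m1 | exact: m2 | exact: measurable_cst |
    apply: measurable_funB | apply: measurable_funD | apply: measurable_funM | apply: measurable_funX].
rewrite region_setI; do ![apply: measurableI]; apply: measurable_pos => //;
  repeat first [exact: m1 | exact: m2 | exact: md | exact: measurable_cst |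
    apply: measurable_funB | apply: measurable_funD | apply: measurable_funM | apply: measurable_funX].
Qed.

Lemma region_box s X Y t A B : 1 <= Y -> `|t| <= 1 -> region s X Y t (A, B) ->
  - Y ^+ 2 < A < 2 * Y ^+ 2 /\ - Y ^+ 3 <= B <= Y ^+ 3.
Proof.
move=> Y1 t1 [_ [_ /= J]]; have Y0 : 0 < Y by lra.
have [_ B1] := hR_lt_jury Y0 (jury_hR_lt Y1 t1 J).
have /andP[h1 h2] := jury_bounds Y0 t1 J B1.
split; last by rewrite -ler_norml ltW.
by rewrite h1 /=; nra.
Qed.

Lemma VR_regionE s X Y (i : 'I_3) : 1 <= Y ->
  VR_region s X Y i = region s X Y (Defs.tval i)%:~R.
Proof.
move=> Y1; have Y0 : 0 < Y by lra.
have t1 : `|(Defs.tval i)%:~R : R| <= 1.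
  by case: i => [[|[|[|i]]] //= hi]; rewrite /Defs.tval /=; rewrite ?normr1 ?normr0 // normrN1.
apply/seteqP; split=> [[A B]|[A B]] /= [h1 [h2 h3]]; split=> //; split=> //.
  by have [] := hR_lt_jury Y0 h3.
exact: jury_hR_lt.
Qed.

Lemma breakpoints_cubic (a b c d : R) : breakpoints 3 [set x | 0 < a * x ^+ 3 + b * x ^+ 2 + c * x + d].
Proof.
have := @breakpoints_poly R (a *: 'X^3 + b *: 'X^2 + c *: 'X + d%:P) 3.
have -> : [set x | 0 < (a *: 'X^3 + b *: 'X^2 + c *: 'X + d%:P).[x]] =
   [set x | 0 < a * x ^+ 3 + b * x ^+ 2 + c * x + d].
  by apply/seteqP; split=> x /=; rewrite !(hornerD, hornerZ, hornerXn, hornerX, hornerC).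
apply; have S (e : R) n : (n < 4)%N -> (size (e *: 'X^n : {poly R})%R <= 4)%N.
  by move=> n4; apply: leq_trans (size_scale_leq _ _) _; rewrite size_polyXn.
have szD (p q : {poly R}) : (size p <= 4)%N -> (size q <= 4)%N -> (size (p + q)%R <= 4)%N.
  by move=> sp sq; apply: leq_trans (size_polyD _ _) _; rewrite geq_max sp.
apply: (szD _ _); last by apply: leq_trans (size_polyC_leq1 _) _.
by apply: (szD _ _); [apply: (szD _ _); exact: S | exact: (S c 1%N)].
Qed.

Lemma breakpoints_ext K (E F : set R) : E = F -> breakpoints K E -> breakpoints K F.
Proof. by move=> ->. Qed.

(** Six polynomial inequalities, each of degree at most three in [A], contribute three breakpoints
    each. *)
Lemma region_breakpointsA s X Y t B : breakpoints 18 [set A | region s X Y t (A, B)].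
Proof.
rewrite region_setI -[18%N]/(3 + (3 + (3 + (3 + (3 + 3)))))%N.
do ![apply: breakpointsI].
- apply: breakpoints_ext (breakpoints_cubic (- 4 * s) (s * t ^+ 2) (s * 18 * t * B) (s * (- 4 * t ^+ 3 * B - 27 * B ^+ 2))).
  by apply/seteqP; split=> A /= /lt_le_trans; apply; rewrite le_eqVlt; apply/orP; left; apply/eqP; rewrite /disc; ring.
- apply: breakpoints_ext (breakpoints_cubic 4 (- t ^+ 2) (- 18 * t * B) (X - (- 4 * t ^+ 3 * B - 27 * B ^+ 2))).
  by apply/seteqP; split=> A /= /lt_le_trans; apply; rewrite le_eqVlt; apply/orP; left; apply/eqP; rewrite /disc; ring.
- apply: breakpoints_ext (breakpoints_cubic (- 4) (t ^+ 2) (18 * t * B) (X + (- 4 * t ^+ 3 * B - 27 * B ^+ 2))).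
  by apply/seteqP; split=> A /= /lt_le_trans; apply; rewrite le_eqVlt; apply/orP; left; apply/eqP; rewrite /disc; ring.
- apply: breakpoints_ext (breakpoints_cubic 0 0 Y (Y ^+ 3 + t * Y ^+ 2 + B)).
  by apply/seteqP; split=> A /= /lt_le_trans; apply; rewrite le_eqVlt; apply/orP; left; apply/eqP; ring.
- apply: breakpoints_ext (breakpoints_cubic 0 0 Y (Y ^+ 3 - t * Y ^+ 2 - B)).
  by apply/seteqP; split=> A /= /lt_le_trans; apply; rewrite le_eqVlt; apply/orP; left; apply/eqP; ring.
- apply: breakpoints_ext (breakpoints_cubic 0 0 (- Y ^+ 4) (Y ^+ 6 + t * B * Y ^+ 2 - B ^+ 2)).
  by apply/seteqP; split=> A /= /lt_le_trans; apply; rewrite le_eqVlt; apply/orP; left; apply/eqP; rewrite /pairprod; ring.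
Qed.

Lemma region_breakpointsB s X Y t A : breakpoints 18 [set B | region s X Y t (A, B)].
Proof.
rewrite region_setI -[18%N]/(3 + (3 + (3 + (3 + (3 + 3)))))%N.
do ![apply: breakpointsI].
- apply: breakpoints_ext (breakpoints_cubic 0 (- 27 * s) (s * (18 * t * A - 4 * t ^+ 3)) (s * (t ^+ 2 * A ^+ 2 - 4 * A ^+ 3))).
  by apply/seteqP; split=> B /= /lt_le_trans; apply; rewrite le_eqVlt; apply/orP; left; apply/eqP; rewrite /disc; ring.
- apply: breakpoints_ext (breakpoints_cubic 0 27 (- (18 * t * A - 4 * t ^+ 3)) (X - (t ^+ 2 * A ^+ 2 - 4 * A ^+ 3))).
  by apply/seteqP; split=> B /= /lt_le_trans; apply; rewrite le_eqVlt; apply/orP; left; apply/eqP; rewrite /disc; ring.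
- apply: breakpoints_ext (breakpoints_cubic 0 (- 27) (18 * t * A - 4 * t ^+ 3) (X + (t ^+ 2 * A ^+ 2 - 4 * A ^+ 3))).
  by apply/seteqP; split=> B /= /lt_le_trans; apply; rewrite le_eqVlt; apply/orP; left; apply/eqP; rewrite /disc; ring.
- apply: breakpoints_ext (breakpoints_cubic 0 0 1 (Y ^+ 3 + t * Y ^+ 2 + A * Y)).
  by apply/seteqP; split=> B /= /lt_le_trans; apply; rewrite le_eqVlt; apply/orP; left; apply/eqP; ring.
- apply: breakpoints_ext (breakpoints_cubic 0 0 (-1) (Y ^+ 3 - t * Y ^+ 2 + A * Y)).
  by apply/seteqP; split=> B /= /lt_le_trans; apply; rewrite le_eqVlt; apply/orP; left; apply/eqP; ring.
- apply: breakpoints_ext (breakpoints_cubic 0 (-1) (t * Y ^+ 2) (Y ^+ 6 - A * Y ^+ 4)).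
  by apply/seteqP; split=> B /= /lt_le_trans; apply; rewrite le_eqVlt; apply/orP; left; apply/eqP; rewrite /pairprod; ring.
Qed.

(** * Lengths of slices and their dependence on the ends *)

Lemma sqr_lt_sqrt (b w : R) : (b ^+ 2 < w) = (`|b| < Num.sqrt w).
Proof.
rewrite -sqrtr_sqr; have [w0|w0] := ltP 0 w; first by rewrite ltr_sqrt.
by rewrite (ler0_sqrtr w0) !ltNge sqrtr_ge0 (le_trans w0) ?sqr_ge0.
Qed.

(** Only one implication: for [w < 0] the square root is [0] by convention, and at [b = 0] the right
    side holds while the left side fails. In [sqr_lt_sqrt] both sides are false for [w <= 0]. *)
Lemma sqr_gt_sqrt (b w : R) : Num.sqrt w < `|b| -> w < b ^+ 2.
Proof.
rewrite -sqrtr_sqr; have [b0|] := ltP 0 (b ^+ 2); first by rewrite ltr_sqrt.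
by move=> b0; rewrite (ler0_sqrtr b0) ltNge sqrtr_ge0.
Qed.

Definition pos (x : R) := Num.max 0 x.

(** For [0 <= b1 <= b2], the length of the set of [b] with [b1 < |b| < b2] and [-x < b < y]: the
    first term is the part with [b > 0], the second the reflection of the part with [b < 0]. *)
Definition slen (b1 b2 x y : R) :=
  pos (Num.min b2 y - Num.max b1 (- x)) + pos (Num.min b2 x - Num.max b1 (- y)).

Lemma mu_oo (l r : R) : mu `]l, r[%classic = (pos (r - l))%:E.
Proof.
rewrite lebesgue_measure_itv /= lte_fin /pos; case: ltP => h.
  by rewrite -EFinB max_r // subr_ge0 ltW.
by rewrite max_l // subr_le0.
Qed.

Lemma slice_len (c1 c2 k x y : R) (S : set R) : measurable S -> c1 <= c2 ->
  (forall B, S B <-> c1 < (B + k) ^+ 2 < c2 /\ - x < B + k < y) ->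
  mu S = (slen (Num.sqrt c1) (Num.sqrt c2) x y)%:E.
Proof.
move=> mS c12 SE; set b1 := Num.sqrt c1; set b2 := Num.sqrt c2.
have b10 : 0 <= b1 by exact: sqrtr_ge0.
have b20 : 0 <= b2 by exact: sqrtr_ge0.
pose I1 := `]Num.max b1 (- x) - k, Num.min b2 y - k[%classic.
pose I2 := `]Num.max (- b2) (- x) - k, Num.min (- b1) y - k[%classic.
have I1E B : I1 B <-> [/\ b1 < B + k, - x < B + k, B + k < b2 & B + k < y].
  rewrite /I1 /= in_itv /= ltrBlDr ltrBrDr gt_max lt_min.
  by split=> [/andP[/andP[? ?] /andP[? ?]]|[-> -> -> ->]].
have I2E B : I2 B <-> [/\ - b2 < B + k, - x < B + k, B + k < - b1 & B + k < y].
  rewrite /I2 /= in_itv /= ltrBlDr ltrBrDr gt_max lt_min.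
  by split=> [/andP[/andP[? ?] /andP[? ?]]|[-> -> -> ->]].
have mI1 : measurable I1 by exact: measurable_itv.
have mI2 : measurable I2 by exact: measurable_itv.
have dis : I1 `&` I2 = set0.
  by apply/seteqP; split=> // B [/I1E[? ? ? ?] /I2E[? ? ? ?]]; lra.
have sub1 : I1 `|` I2 `<=` S.
  move=> B [/I1E[h1 h2 h3 h4]|/I2E[h1 h2 h3 h4]]; apply/SE; split; apply/andP; split=> //.
  - by apply: sqr_gt_sqrt; rewrite -/b1 gtr0_norm //; lra.
  - by rewrite sqr_lt_sqrt -/b2 gtr0_norm //; lra.
  - by apply: sqr_gt_sqrt; rewrite -/b1 ltr0_norm //; lra.
  - by rewrite sqr_lt_sqrt -/b2 ltr0_norm //; lra.
(* The point [- k] may belong to [S] when [c1 < 0] although both open intervals omit it; it is a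
   null set. *)
have sub2 : S `<=` (I1 `|` I2) `|` [set - k].
  move=> B /SE[/andP[h1 h2] /andP[h3 h4]].
  rewrite sqr_lt_sqrt -/b2 ltr_norml in h2; case/andP: h2 => h2 h2'.
  have h1' : B + k != 0 -> b1 < `|B + k|.
    move=> bk; rewrite /b1 -sqrtr_sqr ltr_sqrt // exprn_even_gt0 //.
  case: (ltgtP (B + k) 0) h1' => [b0 h|b0 h|b0 _].
  - left; right; apply/I2E; have := h isT; rewrite ltr0_norm // => h'; split=> //; lra.
  - left; left; apply/I1E; have := h isT; rewrite gtr0_norm // => h'; split=> //; lra.
  - by right => /=; lra.
have muU : mu (I1 `|` I2) = (slen b1 b2 x y)%:E.
  have e1 : mu I1 = _ := mu_oo _ _.
  have e2 : mu I2 = _ := mu_oo _ _.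
  have -> : mu (I1 `|` I2) = (mu I1 + mu I2)%E by apply: measureU.
  rewrite e1 e2 /slen -EFinD; congr (_ + _)%:E; congr pos; first by ring.
  by rewrite -[- b1]opprK; rewrite /Num.min /Num.max; case: ltP => ?; case: ltP => ?; case: ltP => ?; case: ltP => ?; lra.
apply/eqP; rewrite eq_le -muU; apply/andP; split; last first.
  by apply: le_mu => //; exact: measurableU.
apply: (@le_trans _ _ (mu ((I1 `|` I2) `|` [set - k]))).
  by apply: le_mu => //; apply: measurableU; [exact: measurableU | exact: measurable_set1].
have h : (mu ((I1 `|` I2) `|` [set (- k)%R]) <= mu (I1 `|` I2) + mu [set (- k)%R])%E.
  by apply: measureU2; [exact: measurableU | exact: measurable_set1].
by apply: le_trans h _; rewrite lebesgue_measure_set1 adde0.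
Qed.

Lemma pos_le0 (x : R) : x <= 0 -> pos x = 0.
Proof. by move=> h; rewrite /pos max_l. Qed.

Lemma pos_ge0 (x : R) : 0 <= x -> pos x = x.
Proof. by move=> h; rewrite /pos max_r. Qed.

Lemma pos_lip (x y : R) : `|pos x - pos y| <= `|x - y|.
Proof.
rewrite /pos /Num.max; case: ltP => h1; case: ltP => h2 //; rewrite ?subr0 ?sub0r ?normrN ?normr0 //.
- by rewrite !ger0_norm; lra.
- by rewrite ger0_norm ?[ `|_ - _|]ler0_norm; lra.
Qed.

Lemma min_lip (p q p0 q0 V : R) : `|p - p0| <= V -> `|q - q0| <= V ->
  `|Num.min p q - Num.min p0 q0| <= V.
Proof.
rewrite !ler_norml => /andP[h1 h2] /andP[h3 h4].
by rewrite /Num.min; case: ltP => ?; case: ltP => ?; apply/andP; split; lra.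
Qed.

Lemma max_lip (p q p0 q0 V : R) : `|p - p0| <= V -> `|q - q0| <= V ->
  `|Num.max p q - Num.max p0 q0| <= V.
Proof.
rewrite !ler_norml => /andP[h1 h2] /andP[h3 h4].
by rewrite /Num.max; case: ltP => ?; case: ltP => ?; apply/andP; split; lra.
Qed.

(** Two [pos] terms, in each of which both ends move by at most [V]. *)
Lemma slen_lip (b1 b2 x y x0 V : R) : `|x - x0| <= V -> `|y - x0| <= V ->
  `|slen b1 b2 x y - slen b1 b2 x0 x0| <= 4 * V.
Proof.
move=> hx hy; have V0 : 0 <= V by apply: le_trans hx.
have H u v : `|u - x0| <= V -> `|v - x0| <= V ->
  `|pos (Num.min b2 v - Num.max b1 (- u)) - pos (Num.min b2 x0 - Num.max b1 (- x0))| <= 2 * V.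
  move=> hu hv; apply: le_trans (pos_lip _ _) _.
  have h1 : `|Num.min b2 v - Num.min b2 x0| <= V by apply: min_lip; rewrite // subrr normr0.
  have h2 : `|Num.max b1 (- u) - Num.max b1 (- x0)| <= V.
    by apply: max_lip; rewrite ?subrr ?normr0 // -opprD normrN.
  move: h1 h2; rewrite !ler_norml => /andP[? ?] /andP[? ?]; apply/andP; split; lra.
rewrite /slen; have := H x y hx hy; have := H y x hy hx.
rewrite !ler_norml => /andP[? ?] /andP[? ?]; apply/andP; split; lra.
Qed.

(** No corner [0], [b1], [b2] lies within [V] of [x0], so [x], [y] and [x0] are in the same linear
    piece. There [slen] is zero, or [x + y - 2*b1], or constant, and it depends on [x] and [y] only
    through their sum. *)
Lemma slen_lin (b1 b2 x y x0 V : R) : 0 <= b1 -> b1 <= b2 -> `|x - x0| <= V -> `|y - x0| <= V ->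
  V < `|x0| -> V < `|x0 - b1| -> V < `|x0 - b2| ->
  `|slen b1 b2 x y - slen b1 b2 x0 x0| <= `|x + y - 2 * x0|.
Proof.
move=> b10 b12 hx hy h0 h1 h2; have V0 : 0 <= V by apply: le_trans hx.
have /andP[x1 x2] : - V <= x - x0 <= V by rewrite -ler_norml.
have /andP[y1 y2] : - V <= y - x0 <= V by rewrite -ler_norml.
have [x0n|x0p] := ltP x0 0.
  rewrite ltr0_norm // in h0.
  have Z u v : u < 0 -> v < 0 -> pos (Num.min b2 v - Num.max b1 (- u)) = 0.
    move=> u0 v0; apply: pos_le0; rewrite subr_le0.
    by apply: (@le_trans _ _ 0); rewrite ?ge_min ?le_max ?(ltW v0) ?b10 ?orbT.
  by rewrite /slen !Z ?addr0 ?subrr ?normr0 //; lra.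
rewrite ger0_norm // in h0.
have mx u : 0 <= u -> Num.max b1 (- u) = b1 by move=> u0; rewrite max_l //; lra.
rewrite /slen !mx; try lra.
have [c1|c1] := ltP x0 b1.
  rewrite ltr0_norm ?subr_lt0 // in h1.
  have Z v : v <= b1 -> pos (Num.min b2 v - b1) = 0.
    by move=> vb; apply: pos_le0; rewrite subr_le0 ge_min vb orbT.
  by rewrite !Z ?addr0 ?subrr ?normr0 //; lra.
rewrite ger0_norm ?subr_ge0 // in h1.
have [c2|c2] : x0 < b2 \/ b2 <= x0 by case: (ltP x0 b2); [left|right].
  rewrite ltr0_norm ?subr_lt0 // in h2.
  have Z v : b1 <= v -> v <= b2 -> pos (Num.min b2 v - b1) = v - b1.
    by move=> v1 v2; rewrite min_r // pos_ge0 // subr_ge0.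
  rewrite !Z; try lra.
  have -> : y - b1 + (x - b1) - (x0 - b1 + (x0 - b1)) = x + y - 2 * x0 by ring.
  by [].
rewrite ger0_norm ?subr_ge0 // in h2.
have Z v : b2 <= v -> Num.min b2 v = b2 by move=> ?; rewrite min_l.
by rewrite !Z ?subrr ?normr0 //; lra.
Qed.

(** Positions at which a perturbation of size [V] can change the piece of [slen] at [Num.min p0 q0]:
    [p0] and [q0] may cross, hence [2 * V] as both move, or one of them may pass a corner [0], [b1],
    [b2]. *)
Definition kink (b1 b2 p0 q0 V : R) : bool :=
  [|| `|p0 - q0| <= 2 * V, `|p0| <= V, `|q0| <= V, `|p0 - b1| <= V, `|p0 - b2| <= V,
      `|q0 - b1| <= V | `|q0 - b2| <= V].

(* Away from the kinks the slice length is locally linear, and the first-order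
   contributions of the two ends cancel. *)
Lemma slen_kink (b1 b2 p1 p2 q1 q2 p0 q0 V e : R) : 0 <= b1 -> b1 <= b2 ->
  `|p1 - p0| <= V -> `|p2 - p0| <= V -> `|q1 - q0| <= V -> `|q2 - q0| <= V ->
  `|p1 + p2 - 2 * p0| <= e -> `|q1 + q2 - 2 * q0| <= e ->
  `|slen b1 b2 (Num.min p1 q1) (Num.min p2 q2) - slen b1 b2 (Num.min p0 q0) (Num.min p0 q0)|
    <= e + 4 * V * (kink b1 b2 p0 q0 V)%:R.
Proof.
move=> b10 b12 hp1 hp2 hq1 hq2 hp hq.
have V0 : 0 <= V by apply: le_trans hp1.
have e0 : 0 <= e by apply: le_trans hp.
have hx := min_lip hp1 hq1; have hy := min_lip hp2 hq2.
have [k|] := boolP (kink _ _ _ _ _).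
  by apply: le_trans (slen_lip _ _ hx hy) _; rewrite mulr1; lra.
rewrite /kink !negb_or -!ltNge mulr0 addr0 => /and5P[k1 k2 k3 k4 /and3P[k5 k6 k7]].
apply: le_trans (slen_lin b10 b12 hx hy _ _ _) _.
- by rewrite /Num.min; case: (ltP p0 q0).
- by rewrite /Num.min; case: (ltP p0 q0).
- by rewrite /Num.min; case: (ltP p0 q0).
have /andP[? ?] : - V <= p1 - p0 <= V by rewrite -ler_norml.
have /andP[? ?] : - V <= p2 - p0 <= V by rewrite -ler_norml.
have /andP[? ?] : - V <= q1 - q0 <= V by rewrite -ler_norml.
have /andP[? ?] : - V <= q2 - q0 <= V by rewrite -ler_norml.
case: (ltP p0 q0) k1 => pq k1.
  rewrite ltr0_norm ?subr_lt0 // in k1.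
  have m1 : Num.min p1 q1 = p1 by apply: min_l; lra.
  have m2 : Num.min p2 q2 = p2 by apply: min_l; lra.
  by rewrite m1 m2.
rewrite ger0_norm ?subr_ge0 // in k1.
have m1 : Num.min p1 q1 = q1 by apply: min_r; lra.
have m2 : Num.min p2 q2 = q2 by apply: min_r; lra.
by rewrite m1 m2.
Qed.

(* In the coordinates [a = A - t^2/3] and [b = B - tA/3 + 2t^3/27] the discriminant is
   [-4a^3 - 27b^2]; the sign and size conditions on it are [cbnd _ true _ _ < b^2 < cbnd _ false _ _],
   the conditions on [f(Y)] and [f(-Y)] bound [b] by [pend], and solving [pairprod > 0] for [b]
   gives the interval of centre [vend] and radius [qend]. *)
Definition cbnd (b lo : bool) (X a : R) : R :=
  ((if b then (if lo then - X else 0) else (if lo then 0 else X)) - 4 * a ^+ 3) / 27.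

Definition pend (Y u a : R) : R := (Y + u) ^+ 3 + a * (Y + u).
Definition qend (Y t a : R) : R := Y ^+ 2 * Num.sqrt (Y ^+ 2 - a - t ^+ 2 / 12).
Definition vend (Y t a : R) : R := t * (Y ^+ 2 / 2 - a / 3 - t ^+ 2 / 27).

(** The translation [b = B + k] to the depressed cubic removes the linear term of the discriminant
    in [B], and completing the square in [pairprod] makes it an interval condition. What remains has
    the form required by [slice_len]. *)
Lemma region_slice b X Y t a : 1 <= Y -> 0 < X ->
  mu [set B | region (sgnb R b) X Y t (a + t ^+ 2 / 3, B)] =
  (slen (Num.sqrt (cbnd b true X a)) (Num.sqrt (cbnd b false X a))
    (Num.min (pend Y (t / 3) a) (qend Y t a - vend Y t a))
    (Num.min (pend Y (- (t / 3)) a) (qend Y t a + vend Y t a)))%:E.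
Proof.
move=> Y1 X0; have Y0 : 0 < Y by lra.
set A := a + t ^+ 2 / 3.
have mS : measurable [set B | region (sgnb R b) X Y t (A, B)].
  have -> : [set B | region (sgnb R b) X Y t (A, B)] = xsection (region (sgnb R b) X Y t) A.
    by apply/seteqP; split=> y; rewrite /xsection /= inE.
  by apply: measurable_xsection; exact: measurable_region.
apply: (@slice_len _ _ (- t * A / 3 + 2 * t ^+ 3 / 27)) => //.
  by rewrite /cbnd ler_pM2r ?invr_gt0 //; case: b mS => _; lra.
move=> B; set k := - t * A / 3 + _.
have dE : disc t A B = - 4 * a ^+ 3 - 27 * (B + k) ^+ 2 by rewrite /disc /k /A; field.
have h1 : (0 < sgnb R b * disc t A B /\ `|disc t A B| < X) <->
   cbnd b true X a < (B + k) ^+ 2 < cbnd b false X a.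
  rewrite dE /cbnd ltr_pdivrMr // ltr_pdivlMr // ltr_norml.
  move: X0; clear; case: b => X0 /=; split.
  - by move=> [? /andP[? ?]]; apply/andP; split; lra.
  - by move=> /andP[? ?]; split; [lra | apply/andP; split; lra].
  - by move=> [? /andP[? ?]]; apply/andP; split; lra.
  - by move=> /andP[? ?]; split; [lra | apply/andP; split; lra].
have h2 : Y ^+ 3 + t * Y ^+ 2 + A * Y + B = pend Y (t / 3) a + (B + k).
  by rewrite /pend /k /A; field.
have h3 : - Y ^+ 3 + t * Y ^+ 2 - A * Y + B = (B + k) - pend Y (- (t / 3)) a.
  by rewrite /pend /k /A; field.
have h4 : (0 < pairprod Y t A B) = (- (qend Y t a - vend Y t a) < B + k < qend Y t a + vend Y t a).
  have Y2 : 0 < Y ^+ 2 by rewrite exprn_gt0.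
  have -> : pairprod Y t A B = (Y ^+ 2) ^+ 2 * (Y ^+ 2 - a - t ^+ 2 / 12 - ((B + k - vend Y t a) / Y ^+ 2) ^+ 2).
    by rewrite /pairprod /vend /k /A; field; rewrite gt_eqF.
  rewrite pmulr_rgt0 ?exprn_gt0 // subr_gt0 sqr_lt_sqrt normrM [ `|_^-1|]gtr0_norm ?invr_gt0 //.
  rewrite ltr_pdivrMr // mulrC -/(qend Y t a) ltr_norml.
  by apply/idP/idP => /andP[? ?]; apply/andP; split; lra.
have h5 P Q : (- Num.min P Q < B + k) = (- P < B + k) && (- Q < B + k).
  by rewrite ltrNl lt_min !(ltrNl (B + k)).
rewrite /= /region /= /jury h2 h3 h4 h5 lt_min.
split=> [[g1 [g2 [g3 g4 /andP[g5 g6]]]]|[g1 /andP[/andP[g2 g3] /andP[g4 g5]]]].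
  split; first exact/h1.
  by rewrite g6 andbT; apply/andP; split; [apply/andP; split|]; lra.
have [g6 g7] := h1.2 g1; split=> //; split=> //; split; [lra|lra|].
by apply/andP; split; lra.
Qed.

(** All hits lie within distance [L] of the first one, and the sample points have spacing one. *)
Lemma count_diam (P : R -> bool) (c L : R) J : 0 <= L ->
  (forall x y, x <= y -> P x -> P y -> y - x <= L) ->
  \sum_(j < J) ((P (c + j%:R))%:R : R) <= L + 1.
Proof.
move=> L0 H; have [[i Pi]|nP] := pselect (exists i : 'I_J, P (c + i%:R)); last first.
  rewrite big1 ?addr_ge0 // => j _; case E: (P _) => //.
  by case: nP; exists j.
have [i0 Pi0 min0] : exists2 i0 : 'I_J, P (c + i0%:R) & forall j : 'I_J, P (c + j%:R) -> (i0 <= j)%N.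
  by case: (@arg_minnP _ i (fun j : 'I_J => P (c + j%:R)) (fun j => j : nat) Pi) => i0 h1 h2; exists i0.
have := truncn_itv L0; set k := Num.truncn L => /andP[k1 k2].
apply: (@le_trans _ _ (k.+1)%:R); last by rewrite -natr1 lerD2r.
rewrite -natr_sum ler_nat.
have -> : (\sum_(j < J) P (c + j%:R)%R = #|[set j : 'I_J | P (c + j%:R)%R]%SET|)%N.
  rewrite -sum1_card [RHS]big_mkcond /=; apply: eq_bigr => j _.
  by rewrite finset.inE; case: (P _).
have bnd (j : 'I_J) : j \in [set j : 'I_J | P (c + j%:R)%R]%SET -> (i0 <= j <= i0 + k)%N.
  rewrite finset.inE => Pj; have ij := min0 j Pj; rewrite ij /=.
  have := H (c + i0%:R) (c + j%:R); rewrite lerD2l ler_nat => /(_ ij Pi0 Pj).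
  have -> : c + j%:R - (c + i0%:R) = (j - i0)%:R :> R by rewrite natrB //; ring.
  move=> /le_lt_trans/(_ k2); rewrite ltr_nat ltnS leq_subLR //.
pose f (j : 'I_J) : 'I_k.+1 := inord (j - i0).
have <- : #|f @: [set j : 'I_J | P (c + j%:R)%R]%SET| = #|[set j : 'I_J | P (c + j%:R)%R]%SET|.
  apply: card_in_imset => x y /bnd/andP[x1 x2] /bnd/andP[y1 y2] /(congr1 val).
  rewrite /f /= !inordK ?ltnS ?leq_subLR // => E; apply/val_inj => /=.
  by rewrite -(subnK x1) E subnK.
by apply: leq_trans (max_card _) _; rewrite card_ord.
Qed.

Lemma pend_mono Y a a' : a <= a' -> pend Y 0 a' - pend Y 0 a = Y * (a' - a).
Proof. by move=> _; rewrite /pend; ring. Qed.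

Lemma qend_anti Y t a a' : a <= a' -> qend Y t a' <= qend Y t a.
Proof. by move=> aa; rewrite /qend ler_wpM2l ?sqr_ge0 // ler_wsqrtr // lerB // lerB. Qed.

Lemma cbnd_anti b lo X a a' : a <= a' -> cbnd b lo X a' <= cbnd b lo X a.
Proof.
move=> aa; rewrite /cbnd ler_pM2r ?invr_gt0 // lerB // ler_pM2l //.
have -> : a' ^+ 3 = a ^+ 3 + (a' - a) * ((a' + a / 2) ^+ 2 + 3 / 4 * a ^+ 2) by field.
rewrite lerDl mulr_ge0 ?subr_ge0 // addr_ge0 ?sqr_ge0 // mulr_ge0 ?sqr_ge0 //.
Qed.

(** * Each kind of kink is confined to an interval of length [O(Y)] *)

Section KinkCount.
Variables (b : bool) (X Y : R).
Local Notation inr a := (- (4 / 3) * Y ^+ 2 <= a <= Y ^+ 2).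
Local Notation V := (3 * Y ^+ 2).
Local Notation p0 := (pend Y 0).
Local Notation q0 := (qend Y 0).

(** [p0] has slope [Y] and [q0] decreases, so [p0 - q0] crosses a band of width [4 * V = 12*Y^2]
    within length [12*Y]. The next two lemmas use the same argument with width [2 * V]. *)
Lemma kink_pq (Y1 : 1 <= Y) (x y : R) : x <= y -> `|p0 x - q0 x| <= 2 * V -> `|p0 y - q0 y| <= 2 * V ->
  y - x <= 12 * Y.
Proof.
move=> xy; rewrite !ler_norml => /andP[h1 h2] /andP[h3 h4].
have e1 : p0 y - p0 x = Y * (y - x) := pend_mono Y xy.
have e2 : q0 y <= q0 x := qend_anti Y 0 xy.
have : Y * (y - x) <= Y * (12 * Y) by rewrite -e1; lra.
by rewrite ler_pM2l //; lra.
Qed.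

Lemma kink_p0 (Y1 : 1 <= Y) (x y : R) : x <= y -> `|p0 x| <= V -> `|p0 y| <= V -> y - x <= 6 * Y.
Proof.
move=> xy; rewrite !ler_norml => /andP[h1 h2] /andP[h3 h4].
have e1 : p0 y - p0 x = Y * (y - x) := pend_mono Y xy.
have : Y * (y - x) <= Y * (6 * Y) by rewrite -e1; lra.
by rewrite ler_pM2l //; lra.
Qed.

Lemma kink_pb (Y1 : 1 <= Y) lo (x y : R) : x <= y -> `|p0 x - Num.sqrt (cbnd b lo X x)| <= V ->
  `|p0 y - Num.sqrt (cbnd b lo X y)| <= V -> y - x <= 6 * Y.
Proof.
move=> xy; rewrite !ler_norml => /andP[h1 h2] /andP[h3 h4].
have e1 : p0 y - p0 x = Y * (y - x) := pend_mono Y xy.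
have e2 : Num.sqrt (cbnd b lo X y) <= Num.sqrt (cbnd b lo X x).
  by rewrite ler_wsqrtr // cbnd_anti.
have : Y * (y - x) <= Y * (6 * Y) by rewrite -e1; lra.
by rewrite ler_pM2l //; lra.
Qed.

Lemma q0_sq a : a <= Y ^+ 2 -> q0 a ^+ 2 = Y ^+ 4 * (Y ^+ 2 - a).
Proof.
move=> aY; rewrite /qend expr0n /= mul0r subr0 exprMn sqr_sqrtr ?subr_ge0 //.
by ring.
Qed.

(** As [q0^2 = Y^4*(Y^2 - a)], the bound forces [Y^2 - a <= 9] at the left end. *)
Lemma kink_q0 (Y1 : 1 <= Y) (x y : R) : x <= y -> inr y -> `|q0 x| <= V -> y - x <= 9 * Y.
Proof.
move=> xy /andP[_ yY] h; have xY : x <= Y ^+ 2 by lra.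
have : q0 x ^+ 2 <= V ^+ 2.
  by rewrite -[q0 x ^+ 2]real_normK ?num_real // lerXn2r ?nnegrE ?normr_ge0 // mulr_ge0 ?sqr_ge0.
rewrite q0_sq //.
have -> : (3 * Y ^+ 2) ^+ 2 = Y ^+ 4 * 9 by ring.
by rewrite ler_pM2l ?exprn_gt0 //; lra.
Qed.

Lemma q0_le (Y1 : 1 <= Y) (a : R) : inr a -> 0 <= q0 a <= 2 * Y ^+ 3.
Proof.
move=> /andP[a1 a2]; have Y0 : 0 <= Y by lra.
have q : 0 <= q0 a by rewrite /qend mulr_ge0 ?sqr_ge0 ?sqrtr_ge0.
rewrite q /=; rewrite -(@ler_pXn2r _ 2) ?nnegrE //; last by rewrite mulr_ge0 ?exprn_ge0.
rewrite q0_sq //; have -> : (2 * Y ^+ 3) ^+ 2 = Y ^+ 4 * (4 * Y ^+ 2) by ring.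
by rewrite ler_wpM2l ?exprn_ge0 //; have := sqr_ge0 Y; lra.
Qed.

(** Both curves may decrease, so their squares are compared. The difference of squares is at most
    [3*Y^2 * 7*Y^3 = 21*Y^5] in absolute value, and it falls at rate at least
    [Y^4 - (4/9)*a^2 >= (17/81)*Y^4], as [|a| <= (4/3)*Y^2]. The length is at most [42*(81/17)*Y],
    which is below [201*Y]. *)
Lemma kink_qb (Y1 : 1 <= Y) lo (x y : R) : x <= y -> inr x -> inr y -> 0 <= cbnd b lo X x -> 0 <= cbnd b lo X y ->
  `|q0 x - Num.sqrt (cbnd b lo X x)| <= V -> `|q0 y - Num.sqrt (cbnd b lo X y)| <= V ->
  y - x <= 201 * Y.
Proof.
move=> xy ix iy cx cy hx hy; have Y0 : 0 < Y by lra.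
have H a : inr a -> 0 <= cbnd b lo X a -> `|q0 a - Num.sqrt (cbnd b lo X a)| <= V ->
   `|Y ^+ 4 * (Y ^+ 2 - a) - cbnd b lo X a| <= 21 * Y ^+ 5.
  move=> ia ca ha; have /andP[qa1 qa2] := q0_le Y1 ia; set s := Num.sqrt _ in ha.
  have s0 : 0 <= s by exact: sqrtr_ge0.
  have -> : Y ^+ 4 * (Y ^+ 2 - a) - cbnd b lo X a = (q0 a - s) * (q0 a + s).
    have s2 : s ^+ 2 = cbnd b lo X a by exact: sqr_sqrtr.
    by rewrite -q0_sq; [rewrite -s2; ring | case/andP: ia].
  rewrite normrM [ `|q0 a + s|]ger0_norm ?addr_ge0 //.
  have s1 : q0 a + s <= 7 * Y ^+ 3.
    have V3 : V <= 3 * Y ^+ 3.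
      have -> : Y ^+ 3 = Y * Y ^+ 2 by ring.
      by rewrite ler_pM2l // ler_peMl // sqr_ge0.
    by move: ha; rewrite ler_norml => /andP[? ?]; lra.
  have -> : 21 * Y ^+ 5 = V * (7 * Y ^+ 3) by ring.
  by apply: ler_pM => //; rewrite addr_ge0.
have /ler_normlP[h1 h2] := H x ix cx hx; have /ler_normlP[h3 h4] := H y iy cy hy.
have : Y ^+ 4 * (y - x) - (4 / 27) * (y ^+ 3 - x ^+ 3) <= 42 * Y ^+ 5.
  have -> : (4 / 27) * (y ^+ 3 - x ^+ 3) = cbnd b lo X x - cbnd b lo X y by rewrite /cbnd; field.
  lra.
have e3 : (4 / 27) * (y ^+ 3 - x ^+ 3) <= (64 / 81) * (Y ^+ 4 * (y - x)).
  have -> : y ^+ 3 - x ^+ 3 = (y - x) * (y ^+ 2 + x * y + x ^+ 2) by ring.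
  have B1 a : inr a -> `|a| <= 4 / 3 * Y ^+ 2.
    by move=> /andP[? ?]; rewrite ler_norml; have := sqr_ge0 Y => ?; apply/andP; split; lra.
  have B2 a a' : inr a -> inr a' -> a * a' <= 16 / 9 * Y ^+ 4.
    move=> ia ia'; apply: le_trans (ler_norm _) _; rewrite normrM.
    have -> : 16 / 9 * Y ^+ 4 = (4 / 3 * Y ^+ 2) * (4 / 3 * Y ^+ 2) by field.
    by apply: ler_pM => //; exact: B1.
  have -> : 64 / 81 * (Y ^+ 4 * (y - x)) = 4 / 27 * ((y - x) * (16 / 3 * Y ^+ 4)) by field.
  rewrite ler_pM2l //; apply: ler_wpM2l; first by rewrite subr_ge0.
  by have := B2 y y iy iy; have := B2 x x ix ix; have := B2 x y ix iy; rewrite -!expr2; lra.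
move=> e4; have : Y ^+ 4 * (y - x) <= Y ^+ 4 * (201 * Y).
  have -> : Y ^+ 4 * (201 * Y) = 201 * Y ^+ 5 by ring.
  by have := exprn_gt0 5 Y0; lra.
by rewrite ler_pM2l // exprn_gt0.
Qed.
End KinkCount.

End Regions.

(** * Comparison of the volumes *)

Section VolumeComparison.
Variable R : realType.
Local Notation mu := (@lebesgue_measure R).
Local Notation Vol s X Y t := (fine ((mu \x mu)%E (region s X Y t))).

(** The left limit is [A > - Y^2] with the shift [t^2/3 <= 1/3] absorbed by [Y^2 / 3]; the right
    limit comes from [pairprod] as a quadratic in [B]. *)
Lemma region_slice_out s X Y t a : 1 <= Y -> `|t| <= 1 ->
  ~~ (- (4 / 3) * Y ^+ 2 <= a <= Y ^+ 2) ->
  mu [set B | region s X Y t (a + t ^+ 2 / 3, B)] = 0%E.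
Proof.
move=> Y1 t1 out; have -> : [set B | region s X Y t (a + t ^+ 2 / 3, B)] = set0; last exact: measure0.
apply/seteqP; split=> // B DB; move/negP: out; apply.
have [/andP[h1 _] _] := region_box Y1 t1 DB.
have t2 : t ^+ 2 <= 1 by rewrite -[t ^+ 2]real_normK ?num_real // expr_le1.
have Y2 : 1 <= Y ^+ 2 by rewrite exprn_ege1.
have t20 := sqr_ge0 t.
move: DB => [_ [_ [_ _ /=]]].
have -> : pairprod Y t (a + t ^+ 2 / 3) B = Y ^+ 4 * (Y ^+ 2 - a - t ^+ 2 / 12) - (B - t * Y ^+ 2 / 2) ^+ 2.
  by rewrite /pairprod; field.
rewrite subr_gt0 => /(le_lt_trans (sqr_ge0 _)).
rewrite pmulr_rgt0 ?exprn_gt0 //; last by lra.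
by move=> h2; apply/andP; split; lra.
Qed.

Lemma sqrt_le_add1 (w w' : R) : w <= w' + 1 -> Num.sqrt w <= Num.sqrt w' + 1.
Proof.
move=> h; have s0 := sqrtr_ge0 w'.
rewrite -[leRHS]ger0_norm ?addr_ge0 // -sqrtr_sqr ler_wsqrtr //.
apply: le_trans h _; have : w' <= Num.sqrt w' ^+ 2.
  have [w0|w0] := leP 0 w'; first by rewrite sqr_sqrtr.
  by apply: le_trans (sqr_ge0 _); rewrite ltW.
have -> : (Num.sqrt w' + 1) ^+ 2 = Num.sqrt w' ^+ 2 + 2 * Num.sqrt w' + 1 by ring.
by lra.
Qed.

(** [slen_kink] applies with [V = 3*Y^2]. The two values of [pend] sum to [2 * pend Y 0 a] up to
    [2*Y/3]. In the sum of the other two ends [vend] cancels, leaving [2*Y^2] times a difference of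
    square roots, which is enlarged to the difference between [a] and [a + 1] so that it telescopes
    over the slices. *)
Lemma slice_diff b X Y t a : 1 <= Y -> 0 < X -> t = 1 \/ t = -1 ->
  - (4 / 3) * Y ^+ 2 <= a <= Y ^+ 2 ->
  `|fine (mu [set B | region (sgnb R b) X Y t (a + t ^+ 2 / 3, B)])
    - fine (mu [set B | region (sgnb R b) X Y 0 (a + 0 ^+ 2 / 3, B)])| <=
  Y + 2 * Y ^+ 2 * (Num.sqrt (Y ^+ 2 - a) - Num.sqrt (Y ^+ 2 - (a + 1)))
  + 12 * Y ^+ 2 * (kink (Num.sqrt (cbnd b true X a)) (Num.sqrt (cbnd b false X a))
     (pend Y 0 a) (qend Y 0 a) (3 * Y ^+ 2))%:R.
Proof.
move=> Y1 X0 t1 /andP[a1 a2].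
have t2 : t ^+ 2 = 1 by case: t1 => ->; rewrite ?sqrrN expr1n.
rewrite !region_slice //=.
have -> : vend Y 0 a = 0 by rewrite /vend mul0r.
rewrite !mul0r !oppr0 !addr0.
have Y2 : Y <= Y ^+ 2 by rewrite expr2 ler_peMr //; lra.
pose w := Y ^+ 2 - a.
have g0 : Num.sqrt w - Num.sqrt (Y ^+ 2 - (a + 1)) >= 0.
  by rewrite subr_ge0 ler_wsqrtr // /w; lra.
have qE0 : qend Y 0 a = Y ^+ 2 * Num.sqrt w by rewrite /qend expr0n /= mul0r subr0.
have qEt : qend Y t a = Y ^+ 2 * Num.sqrt (w - 1 / 12) by rewrite /qend t2.
have d1 : Num.sqrt w <= Num.sqrt (w - 1 / 12) + 1 by apply: sqrt_le_add1; lra.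
have d2 : Num.sqrt (w - 1 / 12) <= Num.sqrt w by apply: ler_wsqrtr; lra.
have d3 : Num.sqrt (Y ^+ 2 - (a + 1)) <= Num.sqrt (w - 1 / 12) by apply: ler_wsqrtr; rewrite /w; lra.
have q1 : Y ^+ 2 * Num.sqrt w <= Y ^+ 2 * Num.sqrt (w - 1 / 12) + Y ^+ 2.
  by rewrite -[X in _ + X]mulr1 -mulrDr ler_wpM2l // sqr_ge0.
have q2 : Y ^+ 2 * Num.sqrt (w - 1 / 12) <= Y ^+ 2 * Num.sqrt w by rewrite ler_wpM2l // sqr_ge0.
have q3 : Y ^+ 2 * Num.sqrt (Y ^+ 2 - (a + 1)) <= Y ^+ 2 * Num.sqrt (w - 1 / 12) by rewrite ler_wpM2l // sqr_ge0.
rewrite -/w qE0 qEt.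
set G := Num.sqrt w in q1 q2 g0 *; set G1 := Num.sqrt (Y ^+ 2 - (a + 1)) in q3 g0 *.
set G2 := Num.sqrt (w - 1 / 12) in q1 q2 q3 *.
have g0' : 0 <= Y ^+ 2 * (G - G1) by rewrite mulr_ge0 ?sqr_ge0.
have -> : 12 * Y ^+ 2 = 4 * (3 * Y ^+ 2) by ring.
apply: slen_kink; first exact: sqrtr_ge0.
- by apply: ler_wsqrtr; rewrite /cbnd ler_pM2r ?invr_gt0 //; case: b; lra.
- by case: t1 => ->; rewrite /pend ler_norml; apply/andP; split; lra.
- by case: t1 => ->; rewrite /pend ler_norml; apply/andP; split; lra.
- by case: t1 => ->; rewrite /vend ?sqrrN expr1n ler_norml; apply/andP; split; lra.
- by case: t1 => ->; rewrite /vend ?sqrrN expr1n ler_norml; apply/andP; split; lra.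
- by case: t1 => ->; rewrite /pend ler_norml; apply/andP; split; lra.
- by rewrite ler_norml; apply/andP; split; lra.
Qed.

(** Seven kinds of kinks: [12 + 6 + 9 + 6 + 6 + 201 + 201 = 441], and the seven extra units of
    [count_diam] are at most [7*Y]. *)
Lemma kink_count b X Y (c : R) J : 1 <= Y ->
  \sum_(j < J) (((- (4 / 3) * Y ^+ 2 <= c + j%:R <= Y ^+ 2) &&
    kink (Num.sqrt (cbnd b true X (c + j%:R))) (Num.sqrt (cbnd b false X (c + j%:R)))
     (pend Y 0 (c + j%:R)) (qend Y 0 (c + j%:R)) (3 * Y ^+ 2))%:R : R) <= 448 * Y.
Proof.
move=> Y1; have Y0 : 0 <= Y by lra.
pose inr a := - (4 / 3) * Y ^+ 2 <= a <= Y ^+ 2.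
pose V := 3 * Y ^+ 2; pose p a := pend Y 0 a; pose q a := qend Y 0 a.
pose be lo a := Num.sqrt (cbnd b lo X a).
pose P1 a := `|p a - q a| <= 2 * V.
pose P2 a := `|p a| <= V.
pose P3 a := inr a && (`|q a| <= V).
pose P4 lo a := `|p a - be lo a| <= V.
pose P5 lo a := [&& inr a, 0 <= cbnd b lo X a & `|q a - be lo a| <= V].
have orn (b1 b2 : bool) n : (b2 <= n)%N -> (b1 || b2 <= b1 + n)%N by case: b1; case: b2.
have B (a : R) : (inr a && kink (be true a) (be false a) (p a) (q a) V <=
    P3 a + (P1 a + (P2 a + (P4 true a + (P4 false a + (P5 true a + P5 false a))))))%N.
  have [ia|//] := boolP (inr a).
  rewrite /kink -/(P1 a) -/(P2 a) -/(P4 true a) -/(P4 false a) andTb.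
  have [q0|q0] := boolP (`|q a| <= V).
    have -> : P3 a by rewrite /P3 ia.
    by apply: leq_trans (leq_b1 _) _; rewrite leq_addr.
  (* For negative [cbnd] the square root is [0], and the kink is one of [q] near [0], already
     counted by [P3]. *)
  have H lo : (`|q a - be lo a| <= V) = P5 lo a.
    rewrite /P5 ia /=; have [//|c0] := leP 0 (cbnd b lo X a).
    by rewrite /be ltr0_sqrtr // subr0 (negPf q0).
  rewrite !H orFb; apply: leq_trans (leq_addl _ _).
  by do 5![apply: (orn _ _ _)]; exact: leqnn.
have S1 := @count_diam R P1 c (12 * Y) J.
have S2 := @count_diam R P2 c (6 * Y) J.
have S3 := @count_diam R P3 c (9 * Y) J.
have S4 lo := @count_diam R (P4 lo) c (6 * Y) J.
have S5 lo := @count_diam R (P5 lo) c (201 * Y) J.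
apply: (@le_trans _ _ (\sum_(j < J) ((P3 (c + j%:R))%:R + ((P1 (c + j%:R))%:R + ((P2 (c + j%:R))%:R
   + ((P4 true (c + j%:R))%:R + ((P4 false (c + j%:R))%:R + ((P5 true (c + j%:R))%:R + (P5 false (c + j%:R))%:R)))))))).
  by apply: ler_sum => j _; rewrite -!natrD ler_nat; exact: B.
rewrite !big_split /=.
have {}S1 : \sum_(j < J) (P1 (c + j%:R))%:R <= 12 * Y + 1.
  by apply: S1 => [|x y xy hx hy]; [lra | exact: (kink_pq Y1 xy hx hy)].
have {}S2 : \sum_(j < J) (P2 (c + j%:R))%:R <= 6 * Y + 1.
  by apply: S2 => [|x y xy hx hy]; [lra | exact: (kink_p0 Y1 xy hx hy)].
have {}S3 : \sum_(j < J) (P3 (c + j%:R))%:R <= 9 * Y + 1.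
  by apply: S3 => [|x y xy /andP[ix hx] /andP[iy hy]]; [lra | exact: (kink_q0 Y1 xy iy hx)].
have {}S4 lo : \sum_(j < J) (P4 lo (c + j%:R))%:R <= 6 * Y + 1.
  by apply: S4 => [|x y xy hx hy]; [lra | exact: (kink_pb Y1 xy hx hy)].
have {}S5 lo : \sum_(j < J) (P5 lo (c + j%:R))%:R <= 201 * Y + 1.
  apply: S5 => [|x y xy /and3P[ix cx hx] /and3P[iy cy hy]]; first lra.
  exact: (kink_qb Y1 xy ix iy cx cy hx hy).
apply: le_trans (lerD S3 (lerD S1 (lerD S2 (lerD (S4 true) (lerD (S4 false) (lerD (S5 true) (S5 false))))))) _.
clear -Y1; lra.
Qed.

Lemma vol_slices s X Y t N : 1 <= Y -> `|t| <= 1 -> 3 * Y ^+ 2 + 2 <= N%:R ->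
  `| \sum_(j < (2 * N)%N) fine (mu [set B | region s X Y t (- N%:R + j%:R + t ^+ 2 / 3, B)])
     - Vol s X Y t| <= 36 * Y ^+ 3.
Proof.
move=> Y1 t1 hN; have Y0 : 0 < Y by lra.
have t2 : t ^+ 2 <= 1 by rewrite -[t ^+ 2]real_normK ?num_real // expr_le1.
have Y2 : 1 <= Y ^+ 2 by rewrite exprn_ege1.
have t20 := sqr_ge0 t.
have [|x y /(region_box Y1 t1)[/andP[x1 x2] hy]|y|_] :=
   @slices_measure R 18 (region s X Y t) (- N%:R + t ^+ 2 / 3) 1 (Y ^+ 3) (2 * N)%N (measurable_region _ _ _ _) ltr01.
- by rewrite exprn_gt0.
- by split=> //; rewrite natrM; apply/andP; split; lra.
- exact: region_breakpointsA.
rewrite divr1 => h; apply: le_trans (_ : 18%:R * (2 * Y ^+ 3) <= _); last by lra.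
apply: le_trans h; rewrite le_eqVlt; apply/orP; left; apply/eqP; congr (`|_ - _|).
apply: eq_bigr => j _; congr (fine (mu _)).
by have -> : - N%:R + j%:R + t ^+ 2 / 3 = - N%:R + t ^+ 2 / 3 + 1 * j%:R by ring.
Qed.

Lemma dist_trans3 (x y z w d e f : R) :
  `|x - y| <= d -> `|z - w| <= e -> `|x - z| <= f -> `|y - w| <= d + e + f.
Proof.
rewrite !ler_norml => /andP[? ?] /andP[? ?] /andP[? ?]; apply/andP; split; lra.
Qed.

(** Both volumes are replaced by sums over slices at the same integral values of [a], so that
    [slice_diff] compares them slice by slice. *)
Lemma vol_cmp b X Y t : 1 <= Y -> 0 < X -> t = 1 \/ t = -1 ->
  `|Vol (sgnb R b) X Y t - Vol (sgnb R b) X Y 0| <= 5500 * Y ^+ 3.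
Proof.
move=> Y1 X0 t1; have Y0 : 0 < Y by lra.
have t1' : `|t| <= 1 by case: t1 => ->; rewrite ?normrN1 ?normr1.
have Y2 : 1 <= Y ^+ 2 by rewrite exprn_ege1.
have Yq0 : 0 <= 3 * Y ^+ 2 by lra.
have := truncn_itv Yq0; set k := Num.truncn _ => /andP[k1 k2].
pose N := (k + 3)%N.
have NR : N%:R = k%:R + 3 :> R by rewrite natrD.
have N1 : 3 * Y ^+ 2 + 2 <= N%:R by rewrite NR -natr1 in k2 *; lra.
have N2 : N%:R <= 6 * Y ^+ 2 by rewrite NR; lra.
have Vt := @vol_slices (sgnb R b) X Y t N Y1 t1' N1.
have V0 := @vol_slices (sgnb R b) X Y 0 N Y1 (ltW (_ : `|0| < 1)) N1.
have {}V0 := V0 ltac:(by rewrite normr0).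
set St := \sum_(j < _) _ in Vt; set S0 := \sum_(j < _) _ in V0.
(* At most [12*Y^2] slices with error [Y], the telescoped sum [2*Y^2 * 3*Y], and [448*Y] kinks at
   [12*Y^2] each: [12 + 6 + 5376 = 5394]. The two slice sums add [36] each. *)
suff H : `|St - S0| <= 5394 * Y ^+ 3.
  apply: le_trans (dist_trans3 Vt V0 H) _.
  by move: (Y ^+ 3) (exprn_gt0 3 Y0); clear => z z0; lra.
rewrite /St /S0 -sumrB; apply: le_trans (ler_norm_sum _ _ _) _.
pose a (j : nat) : R := - N%:R + j%:R.
pose g (j : nat) : R := Num.sqrt (Y ^+ 2 - a j).
pose kk (j : nat) : bool := (- (4 / 3) * Y ^+ 2 <= a j <= Y ^+ 2) &&
    kink (Num.sqrt (cbnd b true X (a j))) (Num.sqrt (cbnd b false X (a j)))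
     (pend Y 0 (a j)) (qend Y 0 (a j)) (3 * Y ^+ 2).
have aS j : a j.+1 = a j + 1 by rewrite /a -natr1 addrA.
apply: (@le_trans _ _ (\sum_(j < (2 * N)%N) (Y + 2 * Y ^+ 2 * (g j - g j.+1) + 12 * Y ^+ 2 * (kk j)%:R))).
  apply: ler_sum => j _.
  have gj : 0 <= g j - g j.+1 by rewrite subr_ge0 /g ler_wsqrtr // lerD2l lerN2 aS lerDl.
  have [ia|oa] := boolP (- (4 / 3) * Y ^+ 2 <= a j <= Y ^+ 2).
    have -> : kk j = kink (Num.sqrt (cbnd b true X (a j))) (Num.sqrt (cbnd b false X (a j)))
      (pend Y 0 (a j)) (qend Y 0 (a j)) (3 * Y ^+ 2) by rewrite /kk ia.
    by rewrite /g aS; exact: slice_diff.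
  rewrite !region_slice_out ?normr0 // subrr normr0.
  by rewrite !addr_ge0 ?mulr_ge0 ?sqr_ge0 // ltW.
rewrite !big_split /= -!mulr_sumr sumr_const card_ord.
have tel J : \sum_(j < J) (g j - g j.+1) = g 0%N - g J.
  elim: J => [|J IH]; first by rewrite big_ord0 subrr.
  by rewrite big_ord_recr /= IH; ring.
have g0 : g 0%N <= 3 * Y.
  rewrite /g /a addr0 opprK; have -> : 3 * Y = Num.sqrt ((3 * Y) ^+ 2).
    by rewrite sqrtr_sqr ger0_norm // mulr_ge0 // ltW.
  by apply: ler_wsqrtr; rewrite exprMn; clear - N2 Y2; lra.
have gJ : 0 <= g (2 * N)%N by exact: sqrtr_ge0.
rewrite tel -[Y *+ _]mulr_natr natrM.
have hk : \sum_(j < (2 * N)%N) ((kk j)%:R : R) <= 448 * Y by exact: kink_count.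
have h1 : Y * (2 * N%:R) <= 12 * Y ^+ 3.
  have -> : 12 * Y ^+ 3 = Y * (2 * (6 * Y ^+ 2)) by ring.
  by rewrite ler_pM2l // ler_pM2l.
have h2 : 2 * Y ^+ 2 * (g 0%N - g (2 * N)%N) <= 6 * Y ^+ 3.
  have -> : 6 * Y ^+ 3 = 2 * Y ^+ 2 * (3 * Y) by ring.
  apply: ler_wpM2l; first by rewrite mulr_ge0 // sqr_ge0.
  by rewrite lerBlDr (le_trans g0) // lerDl.
have h3 : 12 * Y ^+ 2 * \sum_(j < (2 * N)%N) ((kk j)%:R : R) <= 5376 * Y ^+ 3.
  have -> : 5376 * Y ^+ 3 = 12 * Y ^+ 2 * (448 * Y) by ring.
  by apply: ler_wpM2l => //; rewrite mulr_ge0 // sqr_ge0.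
apply: le_trans (lerD (lerD h1 h2) h3) _.
by move: (Y ^+ 3); clear => z; lra.
Qed.
End VolumeComparison.

(** * Double roots modulo n and densities *)

(** The derivative [f'(r)]. It does not involve [B], so [A] alone limits the possible [r]. *)
Definition dq (t A r : int) : int := 3 * r ^+ 2 + 2 * t * r + A.

Lemma dq_mod t A n r s : (n%:Z %| r - s)%Z -> (n%:Z %| dq t A r)%Z = (n%:Z %| dq t A s)%Z.
Proof.
move=> h; have e : (n%:Z %| dq t A r - dq t A s)%Z.
  have -> : dq t A r - dq t A s = (r - s) * (3 * (r + s) + 2 * t) by rewrite /dq; ring.
  exact: dvdz_mulr.
apply/idP/idP => h'.
  have -> : dq t A s = dq t A r - (dq t A r - dq t A s) by ring.
  exact: rpredB.
have -> : dq t A r = dq t A s + (dq t A r - dq t A s) by ring.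
exact: rpredD.
Qed.

Definition rootset (t A : int) (n : nat) : {set 'I_n} :=
  [set r : 'I_n | (n%:Z %| dq t A (r : nat)%:Z)%Z]%SET.

(** For [p > 3] a quadratic with nonzero leading coefficient [3] is being solved in a field; for
    [p <= 3] there are at most three residues anyway. *)
Lemma rootset_prime t A p : prime p -> (#|rootset t A p| <= 3)%N.
Proof.
move=> pp; have [p3|p3] := leqP p 3.
  by apply: leq_trans (max_card _) _; rewrite card_ord.
pose Q : {poly 'F_p} := 3%:R%:P * 'X^2 + (2 * t)%:~R%:P * 'X + A%:~R%:P.
have three : (3%:R : 'F_p) != 0.
  rewrite -[3%:R]/((3 : int)%:~R) Fp_eq0 // dvdzE /=; apply/negP => /dvdn_leq => /(_ isT).
  by rewrite leqNgt p3.
have Q0 : Q != 0.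
  apply/eqP => /(congr1 (fun q : {poly 'F_p} => q`_2)).
  rewrite /Q !coefD !coefCM !coefXn !coefX !coefC /= !(mulr0,mulr1,addr0,add0r) => h.
  by rewrite h eqxx in three.
have sQ : (size Q <= 3)%N.
  apply: leq_trans (size_polyD _ _) _; rewrite geq_max; apply/andP; split; last first.
    exact: leq_trans (size_polyC_leq1 _) _.
  apply: leq_trans (size_polyD _ _) _; rewrite geq_max; apply/andP; split; rewrite mul_polyC;
    by apply: leq_trans (size_scale_leq _ _) _; rewrite ?size_polyX ?size_polyXn.
pose s := [seq (nat_of_ord r)%:R : 'F_p | r <- enum (rootset t A p)].
have us : uniq s.
  rewrite map_inj_in_uniq ?enum_uniq // => x y _ _ /eqP.
  rewrite -subr_eq0 => E; apply/val_inj/eqP.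
  have : ((x : nat)%:Z - (y : nat)%:Z)%:~R == 0 :> 'F_p by rewrite rmorphB.
  rewrite Fp_eq0 // -eqz_mod_dvd !modz_small ?ltz_nat ?ltn_ord //.
have rs : all (root Q) s.
  apply/allP => _ /mapP[r + ->]; rewrite mem_enum finset.inE -Fp_eq0 // => /eqP E.
  rewrite /root /Q !(hornerXn, hornerX, hornerC, hornerD, hornerM); apply/eqP; rewrite -[RHS]E /dq; ring.
have := max_poly_roots Q0 rs us; rewrite /s size_map -cardE => h.
exact: leq_trans (ltnW h) sQ.
Qed.

Lemma rootset_mul t A p n : (0 < p)%N -> (0 < n)%N -> coprime p n ->
  (#|rootset t A (p * n)| <= #|rootset t A p| * #|rootset t A n|)%N.
Proof.
move=> p0 n0 cop; rewrite -cardsX.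
pose f (r : 'I_(p * n)) : 'I_p * 'I_n := (Ordinal (ltn_pmod r p0), Ordinal (ltn_pmod r n0)).
have fi : injective f.
  move=> x y [] h1 h2; apply/val_inj => /=.
  have : x = y %[mod p * n] by apply/eqP; rewrite chinese_remainder // h1 h2 !eqxx.
  by rewrite !modn_small.
rewrite -(card_imset _ fi) subset_leq_card //; apply/fintype.subsetP => _ /imsetP[r + ->].
rewrite finset.inE => h; rewrite finset.in_setX !finset.inE /=.
have md (k : nat) : (k%:Z %| (r %% k)%N%:Z - (r : nat)%:Z)%Z.
  by rewrite -eqz_mod_dvd !modz_nat modn_mod.
rewrite !(dq_mod t A (md _)).
by apply/andP; split; apply: dvdz_trans h; rewrite dvdzE /=; [exact: dvdn_mulr | exact: dvdn_mull].
Qed.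

(** Multiplicativity gives a factor at most [3] per prime divisor. A prime [p >= P], with [P] just
    above [3^(1/eps)], has [p^eps >= 3] and pays for its own factor; the fewer than [P] smaller
    primes cost at most [3 ^+ P] in total. *)
Lemma rootset_bound (R : realType) (eps : R) : 0 < eps ->
  exists2 C : R, 1 <= C & forall t A n, (0 < n)%N -> squarefree n ->
    (#|rootset t A n|)%:R <= C * n%:R `^ eps.
Proof.
move=> e0; pose z := 3 `^ (eps^-1) : R.
have z0 : 0 <= z by exact: powR_ge0.
have := truncn_itv z0; set P := (Num.truncn z).+1 => /andP[_ zP].
have bigp p : (P <= p)%N -> 3 <= p%:R `^ eps :> R.
  move=> Pp; have -> : 3 = z `^ eps :> R by rewrite /z -powRrM mulVf ?gt_eqF // powRr1.
  apply: ge0_ler_powR; rewrite ?nnegrE ?z0 ?ler0n ?(ltW e0) //.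
  by apply: ltW; apply: lt_le_trans zP _; rewrite ler_nat.
pose c n := (\sum_(q < P) (prime q && (q %| n)))%N.
have H t A : forall n, (0 < n)%N -> squarefree n -> (#|rootset t A n|)%:R <= 3 ^+ (c n) * n%:R `^ eps :> R.
  apply: squarefree_ind.
    rewrite powR1 mulr1; apply: le_trans (_ : 1%:R <= _); last by rewrite exprn_ege1 // ler1n.
    by rewrite ler_nat; apply: leq_trans (max_card _) _; rewrite card_ord.
  move=> p n pp cop n0 sn IH; have p0 := prime_gt0 pp.
  apply: le_trans (_ : (#|rootset t A p| * #|rootset t A n|)%N%:R <= _); first by rewrite ler_nat rootset_mul.
  rewrite [(p * n)%N%:R]natrM powRM // natrM.
  have h3 : (#|rootset t A p|)%:R <= 3 :> R by rewrite ler_nat rootset_prime.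
  have hc : (c n + (p < P) <= c (p * n))%N.
    have [pP|pP] := ltnP p P.
      rewrite /c (bigD1 (Ordinal pP)) //= [X in (_ <= X)%N](bigD1 (Ordinal pP)) //= pp dvdn_mulr //=.
      have -> : (p %| n)%N = false by apply/negP; move: cop; rewrite prime_coprime // => /negP.
      rewrite add0n addnC leq_add2l; apply: leq_sum => q _.
      by case: (prime q) => //=; case E: (q %| n)%N => //; rewrite dvdn_mull.
    rewrite addn0; apply: leq_sum => q _.
    by case: (prime q) => //=; case E: (q %| n)%N => //; rewrite dvdn_mull.
  have hp : 3 <= 3 ^+ (p < P) * p%:R `^ eps :> R.
    have [pP|pP] := ltnP p P; last by rewrite expr0 mul1r bigp.
    have h1 : 1 `^ eps <= p%:R `^ eps :> R.
      by apply: ge0_ler_powR; rewrite ?nnegrE ?(ltW e0) ?ler0n ?ler01 // ler1n.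
    by rewrite powR1 in h1; rewrite expr1 ler_peMr.
  apply: (@le_trans _ _ ((3 ^+ (p < P) * p%:R `^ eps) * (3 ^+ (c n) * n%:R `^ eps))).
    by apply: ler_pM => //; exact: le_trans h3 hp.
  have -> : 3 ^+ (p < P) * p%:R `^ eps * (3 ^+ c n * n%:R `^ eps) =
     3 ^+ (c n + (p < P)) * (p%:R `^ eps * n%:R `^ eps) :> R by rewrite exprD mulrACA [3 ^+ (p < P) * _]mulrC.
  by apply: ler_wpM2r; [rewrite mulr_ge0 ?powR_ge0 | rewrite ler_weXn2l // ler1n].
exists (3 ^+ P); first by rewrite exprn_ege1 // ler1n.
move=> t A n n0 sn; apply: le_trans (H t A n n0 sn) _.
apply: ler_wpM2r; first exact: powR_ge0.
rewrite ler_weXn2l ?ler1n //.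
apply: (@leq_trans (\sum_(q < P) 1)%N); last by rewrite sum1_card card_ord.
by apply: leq_sum => q _; case: (_ && _).
Qed.

(** * Periodic counts and densities *)

Lemma sum_periodic N K (g : nat -> nat) :
  (\sum_(x < N * K) g (x %% K) = N * \sum_(x < K) g x)%N.
Proof.
elim: N => [|N IH]; first by rewrite mul0n big_ord0.
rewrite -(big_mkord xpredT (fun x => g (x %% K)%N)) mulSn addnC.
rewrite (@big_cat_nat _ _ _ (N * K)%N) //=; last exact: leq_addr.
rewrite big_mkord IH -{1}[(N * K)%N]add0n big_addn addKn big_mkord mulSn addnC; congr addn.
by apply: eq_bigr => x _; rewrite addnC modnMDl modn_small.
Qed.

Definition idvd (n : nat) (z : int) : bool := (n%:Z %| z)%Z.

Lemma sum_residue n (al : int) : (0 < n)%N ->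
  (\sum_(a < n) idvd n ((nat_of_ord a)%:Z - al)%R = 1)%N.
Proof.
move=> n0; have n1 : n%:Z != 0 by rewrite eqz_nat -lt0n.
have m0 : 0 <= (al %% n%:Z)%Z by rewrite modz_ge0.
have mn : (`|(al %% n%:Z)%Z| < n)%N by rewrite -ltz_nat gez0_abs // ltz_pmod.
have E (a : 'I_n) : idvd n ((nat_of_ord a)%:Z - al) = (a == Ordinal mn).
  rewrite /idvd -eqz_mod_dvd (modz_small (m := (a : nat)%:Z)) ?ltz_nat ?ltn_ord //.
  by rewrite -val_eqE /= -eqz_nat gez0_abs.
rewrite (bigD1 (Ordinal mn)) // E eqxx big1 // => a /negPf h; by rewrite E h.
Qed.

Lemma crt_int (p q : nat) (a b : int) : (0 < p)%N -> (0 < q)%N -> coprime p q ->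
  exists2 g : nat, (g < p * q)%N & forall z : int,
    idvd p (z - a) && idvd q (z - b) = idvd (p * q) (z - g%:Z).
Proof.
move=> p0 q0 cop; have copz : coprimez p%:Z q%:Z by rewrite coprimezE.
pose w := zchinese p%:Z q%:Z a b.
have pq0 : (p * q)%N%:Z != 0 by rewrite eqz_nat -lt0n muln_gt0 p0.
exists `|(w %% (p * q)%N%:Z)%Z|%N; first by rewrite -ltz_nat gez0_abs ?modz_ge0 // ltz_pmod // ltz_nat muln_gt0 p0.
move=> z; rewrite /idvd gez0_abs ?modz_ge0 //.
have -> : ((p * q)%N%:Z %| z - (w %% (p * q)%N)%Z)%Z = ((p * q)%N%:Z %| z - w)%Z.
  by rewrite -!eqz_mod_dvd modz_mod.
rewrite PoszM Gauss_dvdz // -!eqz_mod_dvd.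
by rewrite (zchinese_modl copz) (zchinese_modr copz).
Qed.

Lemma idvd_mod n (a b : int) : (a = b %[mod n%:Z])%Z -> forall c, idvd n (a - c) = idvd n (b - c).
Proof. by move=> h c; rewrite /idvd -!eqz_mod_dvd h. Qed.

(* Counting triples of residues modulo [N * K] for an [N]-periodic predicate [W] shows that
   the density of [S] modulo any [K] is at least that of [W] modulo [N]. *)
Section Density.
Variables (R : realType) (S : set VZ) (N : nat) (W : 'I_3 -> nat -> nat -> bool).
Hypothesis N0 : (0 < N)%N.
Hypothesis SW : forall f, S f -> W f.1.1 `|(Acoef f %% N%:Z)%Z|%N `|(Bcoef f %% N%:Z)%Z|%N.
Hypothesis WS : forall K i a b, (0 < K)%N -> W i (a %% N)%N (b %% N)%N ->
  exists2 f, S f & [/\ f.1.1 = i, (Acoef f = a%:Z %[mod (N * K)%N%:Z])%Z &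
    (Bcoef f = b%:Z %[mod (N * K)%N%:Z])%Z].

Let cardW := (\sum_(i < 3) \sum_(a < N) \sum_(b < N) W i a b)%N.

Lemma abs_modz_nat (x : int) (a K : nat) : (0 < K)%N -> (x = a%:Z %[mod K%:Z])%Z ->
  `|(x %% K%:Z)%Z|%N = (a %% K)%N.
Proof. by move=> K0 ->; rewrite modz_nat. Qed.

Lemma redZ_val k (x : int) : (redZ k x : nat) = `|(x %% k.+1%:Z)%Z|%N.
Proof. by apply/eqP; rewrite -eqz_nat redZE gez0_abs // modz_ge0. Qed.

Let inS (k : nat) (i : 'I_3) (a b : nat) : bool :=
  `[< exists2 f, S f & [/\ f.1.1 = i, `|(Acoef f %% k.+1%:Z)%Z|%N = a & `|(Bcoef f %% k.+1%:Z)%Z|%N = b] >].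

Lemma card_red k :
  #|[set x : 'I_3 * 'I_k.+1 * 'I_k.+1 | `[< exists2 f, S f & redV k f = x >]]%SET| =
  (\sum_(i < 3) \sum_(a < k.+1) \sum_(b < k.+1) inS k i a b)%N.
Proof.
rewrite -sum1_card big_mkcond /=.
rewrite (pair_bigA _ (fun (i : 'I_3) (a : 'I_k.+1) => (\sum_(b < k.+1) inS k i a b)%N)) /=.
rewrite (pair_bigA _ (fun (x : 'I_3 * 'I_k.+1) (b : 'I_k.+1) => (inS k x.1 x.2 b : nat))) /=.
apply: eq_bigr => -[[i a] b] _ /=; rewrite finset.inE /inS.
have -> : `[< exists2 f, S f & redV k f = (i, a, b) >] =
  `[< exists2 f, S f & [/\ f.1.1 = i, `|(Acoef f %% k.+1%:Z)%Z|%N = a & `|(Bcoef f %% k.+1%:Z)%Z|%N = b] >].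
  apply/asboolP/asboolP => -[f Sf].
    by rewrite /redV => -[<- <- <-]; exists f => //; rewrite !redZ_val.
  move=> [<- h1 h2]; exists f => //; rewrite /redV; congr (_, _, _); apply/val_inj.
    by rewrite /= redZ_val h1.
  by rewrite /= redZ_val h2.
by case: `[< _ >].
Qed.

Lemma cardW_period k : (k.+1 ^ 2 * cardW =
  \sum_(i < 3) \sum_(a < (N * k.+1)) \sum_(b < (N * k.+1)) W i (a %% N) (b %% N))%N.
Proof.
rewrite /cardW big_distrr /=; apply: eq_bigr => i _.
rewrite [(N * k.+1)%N]mulnC.
rewrite (sum_periodic k.+1 N (fun a => \sum_(b < k.+1 * N) W i a (b %% N))%N).
rewrite -[(k.+1 ^ 2)%N]/(k.+1 * k.+1)%N -mulnA; congr muln; rewrite big_distrr /=.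
by apply: eq_bigr => a _; rewrite (sum_periodic k.+1 N (fun b => W i a b)).
Qed.

Lemma density_ge k : (k.+1 ^ 2 * cardW <= N ^ 2 *
  #|[set x : 'I_3 * 'I_k.+1 * 'I_k.+1 | `[< exists2 f, S f & redV k f = x >]]%SET|)%N.
Proof.
rewrite cardW_period card_red big_distrr /=; apply: leq_sum => i _.
apply: (@leq_trans (\sum_(a < N * k.+1) \sum_(b < N * k.+1) inS k i (a %% k.+1) (b %% k.+1))%N).
  apply: leq_sum => a _; apply: leq_sum => b _.
  case E: (W _ _ _) => //; have [f Sf [f1 f2 f3]] := WS (ltn0Sn k) E.
  rewrite lt0b; apply/asboolP; exists f => //; split=> //; apply: abs_modz_nat => //.
    by apply/eqP; move/eqP: f2; rewrite !eqz_mod_dvd; apply: dvdz_trans; rewrite dvdzE /= dvdn_mull.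
  by apply/eqP; move/eqP: f3; rewrite !eqz_mod_dvd; apply: dvdz_trans; rewrite dvdzE /= dvdn_mull.
rewrite (sum_periodic N k.+1 (fun a => \sum_(b < N * k.+1) inS k i a (b %% k.+1))%N).
rewrite -[(N ^ 2)%N]/(N * N)%N -mulnA leq_mul2l; apply/orP; right.
rewrite big_distrr /=; apply: leq_sum => a _.
by rewrite (sum_periodic N k.+1 (fun b => inS k i a b)).
Qed.

Lemma density_eq : #|[set x : 'I_3 * 'I_N.-1.+1 * 'I_N.-1.+1 | `[< exists2 f, S f & redV N.-1 f = x >]]%SET| = cardW.
Proof.
apply/eqP; rewrite eqn_leq; apply/andP; split; last first.
  have := density_ge N.-1; rewrite {1}prednK // leq_mul2l expn_eq0.
  by rewrite eqn0Ngt N0.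
rewrite card_red /cardW prednK //; apply: leq_sum => i _; apply: leq_sum => a _; apply: leq_sum => b _.
rewrite /inS prednK //; case: asboolP => // -[f Sf [<- <- <-]].
by rewrite lt0b; exact: SW.
Qed.

Lemma red_densityE k : red_density R S k =
  #|[set x : 'I_3 * 'I_k.+1 * 'I_k.+1 | `[< exists2 f, S f & redV k f = x >]]%SET|%:R / (3 * k.+1 ^ 2)%:R.
Proof.
rewrite /red_density; congr (_%:R / _); apply: eq_card => x; rewrite finset.inE.
by apply/idP/idP => [/set_mem|h]; last exact/mem_set.
Qed.

(** The infimum is attained at modulus [N], that is at index [N.-1] of [red_density]; [density_ge]
    bounds every other modulus from below. *)
Lemma nuE : nu R S = cardW%:R / (3 * N ^ 2)%:R.
Proof.
have pos3 (k : nat) : (0 < k)%N -> 0 < (3 * k ^ 2)%:R :> R by move=> k0; rewrite ltr0n muln_gt0 expn_gt0 k0.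
have atN : red_density R S N.-1 = cardW%:R / (3 * N ^ 2)%:R.
  by rewrite red_densityE density_eq prednK.
have lb k : cardW%:R / (3 * N ^ 2)%:R <= red_density R S k.
  rewrite red_densityE ler_pdivrMr ?pos3 // mulrAC ler_pdivlMr ?pos3 // -!natrM ler_nat.
  by rewrite mulnCA [X in (_ <= X)%N]mulnCA leq_mul2l /= mulnC [X in (_ <= X)%N]mulnC density_ge.
apply/eqP; rewrite eq_le; apply/andP; split.
  rewrite -atN; apply: ge_inf; last by exists N.-1.
  by exists (cardW%:R / (3 * N ^ 2)%:R) => _ [k _ <-].
apply: lb_le_inf; first by exists (red_density R S 0), 0%N.
by move=> _ [k _ <-].
Qed.
End Density.

Lemma nu_congruence (R : realType) (m : nat) (L : set VZ) : (0 < m)%N -> congruence_mod m L ->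
  nu R L = (\sum_(i < 3) \sum_(a < m) \sum_(b < m) `[< L (i, (a : nat)%:Z, (b : nat)%:Z) >])%N%:R / (3 * m ^ 2)%:R.
Proof.
move=> m0 cL; have mz : m%:Z != 0 by rewrite eqz_nat -lt0n.
apply: (@nuE R L m (fun i a b => `[< L (i, a%:Z, b%:Z) >])) => //.
  move=> f Lf; apply/asboolP; apply/(cL f _ _ _ _).1 => //=.
    by rewrite /Acoef /= gez0_abs ?modz_ge0 // modz_mod.
  by rewrite /Bcoef /= gez0_abs ?modz_ge0 // modz_mod.
move=> K i a b K0 /asboolP Li; exists (i, a%:Z, b%:Z) => //.
by apply/(cL _ (i, a%:Z, b%:Z) _ _ _).1: Li => //=; rewrite /Acoef /Bcoef /= -modz_nat modz_mod.
Qed.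

(** As a quadratic in [B] the discriminant has leading coefficient [-27], so its second difference
    with step [h] is [-54*h^2]. This moves a residue class representative off the discriminant
    locus, which [Sigma] excludes. *)
Lemma disc_neq0_shift (t A B h : int) : h != 0 ->
  exists k : int, disc t A (B + k * h) != 0.
Proof.
move=> h0; apply: contrapT => nk.
have Z k : disc t A (B + k * h) = 0.
  by apply/eqP; apply: contrapT => kn; apply: nk; exists k; exact/negP.
have : disc t A (B + 0 * h) - 2 * disc t A (B + 1 * h) + disc t A (B + 2 * h) = - 54 * h ^+ 2 by rewrite /disc; ring.
move=> E; have /eqP : - 54 * h ^+ 2 = 0 by rewrite -E !Z; ring.
by rewrite mulf_eq0 expf_eq0 (negPf h0).
Qed.

Lemma dbl_root_congr t A B A' B' n r :
  (A = A' %[mod n%:Z ^+ 2])%Z -> (B = B' %[mod n%:Z ^+ 2])%Z ->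
  dbl_root t A B n r = dbl_root t A' B' n r.
Proof.
move=> /eqP; rewrite eqz_mod_dvd => hA /eqP; rewrite eqz_mod_dvd => hB.
have hA1 : (n%:Z %| A - A')%Z by apply: dvdz_trans hA; rewrite expr2 dvdz_mulr.
have sw (d x y : int) : (d %| x - y)%Z -> (d %| x)%Z = (d %| y)%Z.
  move=> h; apply/idP/idP => h'.
    by rewrite (_ : y = x - (x - y)); [exact: rpredB | ring].
  by rewrite (_ : x = y + (x - y)); [exact: rpredD | ring].
rewrite /dbl_root; congr andb; apply: sw.
  by rewrite (_ : _ - _ = A - A') //; ring.
rewrite (_ : _ - _ = (A - A') * r + (B - B')); last by ring.
by apply: rpredD => //; exact: dvdz_mulr.
Qed.

Lemma dbl_root_mod t A B n r s : (n%:Z %| r - s)%Z -> dbl_root t A B n r -> dbl_root t A B n s.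
Proof.
case/dvdzP => k E h; have -> : s = r + (- k) * n%:Z by rewrite mulNr -E; ring.
exact: dbl_root_shift.
Qed.

(* By uniqueness of the double root modulo [n], this sum has at most one nonzero term. *)
Lemma dbl_root_sum t A B n : (0 < n)%N -> squarefree n ->
  (`[< exists r, dbl_root t A B n r >] = \sum_(r < n) dbl_root t A B n (nat_of_ord r)%:Z :> nat)%N.
Proof.
move=> n0 sn; have nz : n%:Z != 0 by rewrite eqz_nat -lt0n.
case: asboolP => [[r rr]|nr]; last first.
  by rewrite big1 // => r _; case E: (dbl_root _ _ _ _ _) => //; case: nr; exists (nat_of_ord r)%:Z.
have rn : (`|(r %% n%:Z)%Z| < n)%N by rewrite -ltz_nat gez0_abs ?modz_ge0 // ltz_pmod // ltz_nat.
have r0 : dbl_root t A B n (nat_of_ord (Ordinal rn))%:Z.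
  apply: dbl_root_mod rr; rewrite /= gez0_abs ?modz_ge0 //.
  by rewrite -eqz_mod_dvd modz_mod.
rewrite (bigD1 (Ordinal rn)) // r0 big1 // => s /eqP sr; case E: (dbl_root _ _ _ _ _) => //; case: sr.
have := dbl_root_uniq n0 sn E r0; rewrite -eqz_mod_dvd !modz_small ?ltz_nat ?ltn_ord //.
by move=> /eqP[h]; apply/val_inj; exact: h.
Qed.

Lemma Posz_sq n : (n ^ 2)%N%:Z = n%:Z ^+ 2.
Proof. by rewrite -mulnn PoszM. Qed.

Lemma dbl_rootE t A B n r : dbl_root t A B n r =
  idvd n (A - (- (3 * r ^+ 2 + 2 * t * r))) &&
  idvd (n ^ 2) (B - (- (r ^+ 3 + t * r ^+ 2 + A * r))).
Proof.
rewrite /dbl_root /idvd; congr (_ && _); congr (_ \in dvdz _); rewrite ?Posz_sq; ring.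
Qed.

(** For each [t]: there are [n] choices of [r], each allows [n] classes of [A] modulo [n^2], and
    then [B] is determined modulo [n^2]. By uniqueness of [r] this makes [n^2] pairs out of
    [n^4]. *)
Lemma nu_Sigma (R : realType) n : (0 < n)%N -> squarefree n -> nu R (Sigma n) = (n%:R ^+ 2)^-1.
Proof.
move=> n0 sn; have nz : n%:Z != 0 by rewrite eqz_nat -lt0n.
have N0 : (0 < n ^ 2)%N by rewrite expn_gt0 n0.
have Nz : (n ^ 2)%N%:Z != 0 by rewrite eqz_nat -lt0n.
have NE : (n ^ 2)%N%:Z = n%:Z ^+ 2 by exact: Posz_sq.
pose W (i : 'I_3) (a b : nat) := `[< exists r, dbl_root (Defs.tval i) a%:Z b%:Z n r >].
rewrite (@nuE R (Sigma n) (n ^ 2) W) //; last 2 first.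
- move=> f /(Sigma_dbl_root f n0 sn)[_ [r rr]]; apply/asboolP; exists r.
  rewrite (@dbl_root_congr _ _ _ (Acoef f) (Bcoef f)) //; rewrite -NE gez0_abs ?modz_ge0 // modz_mod //.
- move=> K i a b K0 /asboolP[r rr].
  have NK0 : (n ^ 2 * K)%N%:Z != 0 by rewrite eqz_nat -lt0n muln_gt0 N0.
  have [k kd] := disc_neq0_shift (Defs.tval i) a%:Z b%:Z NK0.
  exists (i, a%:Z, b%:Z + k * (n ^ 2 * K)%N%:Z); last first.
    by split=> //; rewrite /Bcoef /= addrC modzMDl.
  apply/(Sigma_dbl_root _ n0 sn); split=> //; exists r; move: rr.
  rewrite (@dbl_root_congr _ _ _ a%:Z (b%:Z + k * (n ^ 2 * K)%N%:Z)) // -NE -modz_nat modz_mod //.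
  by rewrite PoszM [_%:Z * K%:Z]mulrC mulrA addrC modzMDl.
suff -> : (\sum_(i < 3) \sum_(a < n ^ 2) \sum_(b < n ^ 2) W i a b = 3 * n ^ 2)%N.
  by rewrite -!mulnn !natrM; field; rewrite pnatr_eq0 -lt0n n0.
have Wi (i : 'I_3) : (\sum_(a < n ^ 2) \sum_(b < n ^ 2) W i a b = n ^ 2)%N.
  transitivity (\sum_(r < n) \sum_(a < n ^ 2) \sum_(b < n ^ 2) dbl_root (Defs.tval i) (nat_of_ord a)%:Z (nat_of_ord b)%:Z n (nat_of_ord r)%:Z)%N.
    rewrite [RHS]exchange_big /=; apply: eq_bigr => a _.
    rewrite [RHS]exchange_big /=; apply: eq_bigr => b _.
    by rewrite /W dbl_root_sum.
  transitivity (\sum_(r < n) n)%N; last by rewrite sum_nat_const card_ord -[(n ^ 2)%N]/(n * n)%N.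
  apply: eq_bigr => r _.
  pose al : int := - (3 * (nat_of_ord r)%:Z ^+ 2 + 2 * Defs.tval i * (nat_of_ord r)%:Z).
  transitivity (\sum_(a < n ^ 2) idvd n ((nat_of_ord a)%:Z - al))%N.
    apply: eq_bigr => a _.
    under eq_bigr do rewrite dbl_rootE -/al.
    by case: (idvd n _) => /=; [rewrite sum_residue | rewrite big1].
  rewrite -[(n ^ 2)%N]/(n * n)%N.
  rewrite (eq_bigr (fun a : 'I_(n * n) => (fun x => idvd n (x%:Z - al) : nat) (nat_of_ord a %% n)%N)); last first.
    by move=> a _ /=; congr nat_of_bool; apply: idvd_mod; rewrite -modz_nat modz_mod.
  by rewrite (sum_periodic n n (fun x => idvd n (x%:Z - al)%R : nat)) sum_residue // muln1.
by rewrite (eq_bigr _ (fun i _ => Wi i)) sum_nat_const card_ord.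
Qed.

(** * Counting in congruence classes *)

Section Counting.
Variable R : realType.
Local Notation mu := (@lebesgue_measure R).
Local Notation Vol s X Y t := (fine ((mu \x mu)%E (region s X Y t))).

(** Enumerates the integers of [[-H, H)] for [x < 2 * H], so that lattice counts are sums over
    ordinals. *)
Definition shiftZ (H x : nat) : int := x%:Z - H%:Z.

(** Both sides add [g] over the class of [c] modulo [M]: the progression on the right reaches beyond
    [(-H, H)], outside of which [g] vanishes. *)
Lemma reindex_residue (g : int -> R) (H M c : nat) : (0 < H)%N -> (c < M)%N ->
  (forall z, g z != 0 -> - H%:Z < z < H%:Z) ->
  \sum_(x < (2 * H)%N) (idvd M (shiftZ H x - c%:Z))%:R * g (shiftZ H x) =
  \sum_(j < (2 * H)%N) g (c%:Z + M%:Z * shiftZ H j).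
Proof.
move=> H0 cM gH; have M0 : (0 < M)%N by exact: leq_ltn_trans cM.
pose w (j : nat) : int := c%:Z + M%:Z * shiftZ H j.
have wi (j k : nat) : w j = w k -> j = k.
  have Mz : M%:Z != 0 by rewrite eqz_nat -lt0n.
  by move=> /addrI /(mulfI Mz) /addIr [].
transitivity (\sum_(x < (2 * H)%N) \sum_(j < (2 * H)%N) (shiftZ H x == w j)%:R * g (shiftZ H x)).
  apply: eq_bigr => x _; have [->|gx] := eqVneq (g (shiftZ H x)) 0.
    by rewrite mulr0 big1 // => j _; rewrite mulr0.
  have /andP[h1 h2] := gH _ gx.
  have [/dvdzP[k Ek]|nd] := boolP (idvd M (shiftZ H x - c%:Z)).
    have [j Ej] : exists j : 'I_(2 * H)%N, shiftZ H x = w j.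
      have k1 : - H%:Z <= k.
        rewrite leNgt; apply/negP => kH.
        have : k * M%:Z <= (- H%:Z - 1) * M%:Z by rewrite ler_wpM2r //; lia.
        rewrite -Ek; nia.
      have k2 : k < H%:Z.
        rewrite ltNge; apply/negP => kH.
        have : H%:Z * M%:Z <= k * M%:Z by rewrite ler_wpM2r.
        rewrite -Ek; nia.
      have kk : (`|(k + H%:Z)%R| < 2 * H)%N by lia.
      exists (Ordinal kk); rewrite /w /shiftZ /= gez0_abs; last by lia.
      by rewrite addrK mulrC -Ek /shiftZ [RHS]addrC subrK.
    rewrite mul1r (bigD1 j) //= Ej eqxx mul1r big1 ?addr0 // => i ij.
    case: eqP => [/wi h|_]; last by rewrite mul0r.
    by move/eqP: ij; case; apply/val_inj.
  rewrite mul0r big1 // => j _; case: eqP => [E|_]; last by rewrite mul0r.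
  case/negP: nd; rewrite /idvd E /w; have -> : c%:Z + M%:Z * shiftZ H j - c%:Z = M%:Z * shiftZ H j by ring.
  exact: dvdz_mulr.
rewrite exchange_big /=; apply: eq_bigr => j _; rewrite -/(w j).
have [gj|gj] := eqVneq (g (w j)) 0.
  by rewrite gj big1 // => x _; case: eqP => [->|_]; rewrite ?gj ?mulr0 ?mul0r.
have /andP[h1 h2] := gH _ gj.
have xx : (`|(w j + H%:Z)%R| < 2 * H)%N by lia.
have Ex : shiftZ H (Ordinal xx) = w j by rewrite /shiftZ /= gez0_abs ?addrK //; lia.
rewrite (bigD1 (Ordinal xx)) //= Ex eqxx mul1r big1 ?addr0 // => x xn.
case: eqP => [E|_]; last by rewrite mul0r.
by move/eqP: xn; case; apply/val_inj; have /addIr [] := etrans E (esym Ex).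
Qed.

Section Slices.
Variables (s X Y : R) (t : R) (H : nat).
Hypothesis Y1 : 1 <= Y.
Hypothesis t1 : `|t| <= 1.
Hypothesis HY : 2 * Y ^+ 3 + 1 <= H%:R.

Definition sl (z : int) : R := fine (mu [set B | region s X Y t (z%:~R, B)]).
Definition inD (z w : int) : bool := `[< region s X Y t (z%:~R, w%:~R) >].

Lemma Y23 : Y ^+ 2 <= Y ^+ 3.
Proof. by rewrite (exprS _ 2) ler_peMl ?sqr_ge0. Qed.

Lemma H_gt0 : (0 < H)%N.
Proof.
rewrite -(ltr_nat R); apply: lt_le_trans HY; rewrite ltr_pwDr // mulr_ge0 // exprn_ge0 //.
exact: le_trans Y1.
Qed.

Lemma box_int (z : int) : `|z%:~R : R| <= 2 * Y ^+ 3 -> - H%:Z < z < H%:Z.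
Proof.
move=> h; have : `|z%:~R : R| < H%:R by apply: le_lt_trans h _; apply: lt_le_trans HY; rewrite ltrDl.
rewrite ltr_norml -[H%:R]/(H%:~R) -mulrNz !ltr_int //.
Qed.

Lemma slice_box z w : region s X Y t (z, w) -> `|z| <= 2 * Y ^+ 2 /\ `|w| <= Y ^+ 3.
Proof.
move=> /(region_box Y1 t1)[/andP[h1 h2] h3]; split; last by rewrite ler_norml.
by rewrite ler_norml; apply/andP; split; [have := sqr_ge0 Y; lra | exact: ltW].
Qed.

Lemma Y3_ge0 : 0 <= Y ^+ 3.
Proof. by rewrite exprn_ge0 // (le_trans _ Y1). Qed.

Lemma cell_range (c M : nat) (x : R) : (c < M)%N -> `|x| <= 2 * Y ^+ 3 ->
  c%:R - M%:R * H%:R <= x < c%:R - M%:R * H%:R + M%:R * (2 * H)%N%:R.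
Proof.
move=> cM hx; have xH : `|x| <= H%:R - 1 by apply: le_trans hx _; rewrite lerBrDr.
move: xH; rewrite ler_norml => /andP[x1 x2].
have hM : c%:R + 1 <= M%:R :> R by rewrite natr1 ler_nat.
have H1 : 1 <= H%:R :> R by rewrite ler1n H_gt0.
have c0 : 0 <= c%:R :> R by [].
have M1 : 1 <= M%:R :> R by lra.
have p : 0 <= (M%:R - 1) * (H%:R - 1) :> R by rewrite mulr_ge0 // subr_ge0.
by rewrite natrM; apply/andP; split; nra.
Qed.

Lemma measurable_slice z : measurable [set B | region s X Y t (z, B)].
Proof.
have -> : [set B | region s X Y t (z, B)] = xsection (region s X Y t) z.
  by apply/seteqP; split=> y; rewrite /xsection /= inE.
by apply: measurable_xsection; exact: measurable_region.
Qed.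

(** The error is uniform in [M]. The indicator is kept because the errors are later summed over
    [A = z], and only [O(Y^2)] values of [A] meet the region. *)
Lemma inner_count z M c : (c < M)%N ->
  `| \sum_(y < (2 * H)%N) (idvd M (shiftZ H y - c%:Z))%:R * (inD z (shiftZ H y))%:R - sl z / M%:R|
  <= 18 * (`|z%:~R| <= 2 * Y ^+ 2 :> R)%:R.
Proof.
move=> cM; have M0 : 0 < M%:R :> R by rewrite ltr0n; exact: leq_ltn_trans cM.
rewrite (@reindex_residue (fun w => (inD z w)%:R) H M c H_gt0 cM); last first.
  move=> w; rewrite /inD; case: asboolP => [/slice_box[_ h] _|]; last by rewrite eqxx.
  by apply: box_int; apply: le_trans h _; have := Y3_ge0; lra.
set E := [set B | region s X Y t (z%:~R, B)].
have [hz|hz] := boolP (`|z%:~R : R| <= 2 * Y ^+ 2); last first.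
  have E0 : E = set0.
    by apply/seteqP; split=> // B /slice_box[h _]; move/negP: hz.
  rewrite /sl -/E E0 measure0 mul0r subr0 big1 ?normr0 ?mulr0 // => j _.
  rewrite /inD; case: asboolP => // h; move/negP: hz; case.
  by case: (slice_box h).
have [_] := @cnt_measure R 18 E (c%:R - M%:R * H%:R) M%:R (2 * H)%N (measurable_slice _)
  (region_breakpointsB _ _ _ _ _) M0 (fun x Ex => cell_range cM (le_trans (slice_box Ex).2 (ler_peMl Y3_ge0 (ler1n _ 2)))).
rewrite mulr1 -/(sl z); congr (`| _ - _ | <= _); rewrite /cnt; apply: eq_bigr => j _.
have -> : c%:R - M%:R * H%:R + M%:R * j%:R = (c%:Z + M%:Z * shiftZ H j)%:~R :> R by rewrite /shiftZ; ring.
by rewrite indicE /inD; congr (_%:R); congr nat_of_bool; apply/idP/asboolP; rewrite inE.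
Qed.

(** [slices_measure] along the progression of step [M], with [18] breakpoints and [b = Y^3], hence
    [18 * 2 * Y^3] for every [M]. *)
Lemma outer_count M c : (c < M)%N ->
  `| \sum_(x < (2 * H)%N) (idvd M (shiftZ H x - c%:Z))%:R * sl (shiftZ H x) - Vol s X Y t / M%:R|
  <= 36 * Y ^+ 3.
Proof.
move=> cM; have M0 : 0 < M%:R :> R by rewrite ltr0n; exact: leq_ltn_trans cM.
have Y0 : 0 < Y by exact: lt_le_trans Y1.
rewrite (@reindex_residue sl H M c H_gt0 cM); last first.
  move=> z slz; apply: box_int; apply: le_trans (_ : 2 * Y ^+ 2 <= _); last by rewrite ler_pM2l // Y23.
  apply: contraNT slz => hz; rewrite /sl.
  have -> : [set B | region s X Y t (z%:~R, B)] = set0; last by rewrite measure0.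
  by apply/seteqP; split=> // B /slice_box[h _]; move/negP: hz.
have [|x y h|y|_ h] := @slices_measure R 18 (region s X Y t) (c%:R - M%:R * H%:R) M%:R (Y ^+ 3) (2 * H)%N (measurable_region _ _ _ _) M0.
- by rewrite exprn_gt0.
- have [h1 h2] := slice_box h; split; last by rewrite -ler_norml.
  by apply: cell_range => //; apply: le_trans h1 _; rewrite ler_pM2l // Y23.
- exact: region_breakpointsA.
apply: le_trans (_ : 18%:R * (2 * Y ^+ 3) <= _); last by rewrite mulrA -natrM.
apply: le_trans h; rewrite le_eqVlt; apply/orP; left; apply/eqP; congr (`| _ - _ |).
apply: eq_bigr => j _; rewrite /sl.
by have -> : c%:R - M%:R * H%:R + M%:R * j%:R = (c%:Z + M%:Z * shiftZ H j)%:~R :> R by rewrite /shiftZ; ring.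
Qed.

Lemma inner_crt z (m N b : nat) (be : int) : (0 < m)%N -> (0 < N)%N -> coprime m N ->
  `| \sum_(y < (2 * H)%N) (idvd m (shiftZ H y - b%:Z))%:R * (idvd N (shiftZ H y - be))%:R *
       (inD z (shiftZ H y))%:R - sl z / (m * N)%:R|
  <= 18 * (`|z%:~R| <= 2 * Y ^+ 2 :> R)%:R.
Proof.
move=> m0 N0 cop; have [g g1 gE] := crt_int b%:Z be m0 N0 cop.
have := inner_count z g1; congr (`| _ - _| <= _); apply: eq_bigr => y _.
by rewrite -gE -mulnb natrM.
Qed.

Lemma outer_crt (m n a : nat) (al : int) : (0 < m)%N -> (0 < n)%N -> coprime m n ->
  `| \sum_(x < (2 * H)%N) (idvd m (shiftZ H x - a%:Z))%:R * (idvd n (shiftZ H x - al))%:R *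
       sl (shiftZ H x) - Vol s X Y t / (m * n)%:R|
  <= 36 * Y ^+ 3.
Proof.
move=> m0 N0 cop; have [g g1 gE] := crt_int a%:Z al m0 N0 cop.
have := outer_count g1; congr (`| _ - _| <= _); apply: eq_bigr => y _.
by rewrite -gE -mulnb natrM.
Qed.

(** The class of [B] modulo [n^2] varies with [A] through [be], so for each [A] the count over [B]
    is first replaced by the slice length over [m*n^2]; the slice lengths are then summed over the
    class of [A] modulo [m*n]. The error of the second stage is divided by [m*n^2]. *)
Lemma cell_count (m n a b : nat) (al : int) (be : int -> int) :
  (0 < m)%N -> (0 < n)%N -> coprime m n ->
  `| \sum_(x < (2 * H)%N) \sum_(y < (2 * H)%N)
      (idvd m (shiftZ H x - a%:Z))%:R * (idvd n (shiftZ H x - al))%:R *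
      ((idvd m (shiftZ H y - b%:Z))%:R * (idvd (n ^ 2) (shiftZ H y - be (shiftZ H x)))%:R *
        (inD (shiftZ H x) (shiftZ H y))%:R) - Vol s X Y t / (m%:R ^+ 2 * n%:R ^+ 3)|
  <= 18 * \sum_(x < (2 * H)%N) (idvd m (shiftZ H x - a%:Z))%:R * (idvd n (shiftZ H x - al))%:R *
        (`|(shiftZ H x)%:~R| <= 2 * Y ^+ 2 :> R)%:R
     + 36 * Y ^+ 3 / (m%:R * n%:R ^+ 2).
Proof.
move=> m0 n0 cop; have N0 : (0 < n ^ 2)%N by rewrite expn_gt0 n0.
have cop2 : coprime m (n ^ 2) by rewrite coprimeXr.
have mR : 0 < m%:R :> R by rewrite ltr0n.
have nR : 0 < n%:R :> R by rewrite ltr0n.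
have NE : (m * n ^ 2)%:R = m%:R * n%:R ^+ 2 :> R by rewrite natrM natrX.
have M0 : 0 < m%:R * n%:R ^+ 2 :> R by rewrite mulr_gt0 // exprn_gt0.
pose E (x : nat) : R := (idvd m (shiftZ H x - a%:Z))%:R * (idvd n (shiftZ H x - al))%:R.
pose F (x : nat) : R := \sum_(y < (2 * H)%N) (idvd m (shiftZ H y - b%:Z))%:R *
  (idvd (n ^ 2) (shiftZ H y - be (shiftZ H x)))%:R * (inD (shiftZ H x) (shiftZ H y))%:R.
have -> : \sum_(x < (2 * H)%N) \sum_(y < (2 * H)%N)
      (idvd m (shiftZ H x - a%:Z))%:R * (idvd n (shiftZ H x - al))%:R *
      ((idvd m (shiftZ H y - b%:Z))%:R * (idvd (n ^ 2) (shiftZ H y - be (shiftZ H x)))%:R *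
        (inD (shiftZ H x) (shiftZ H y))%:R) = \sum_(x < (2 * H)%N) E x * F x.
  by apply: eq_bigr => x _; rewrite mulr_sumr.
have -> : \sum_(x < (2 * H)%N) E x * F x - Vol s X Y t / (m%:R ^+ 2 * n%:R ^+ 3) =
  \sum_(x < (2 * H)%N) E x * (F x - sl (shiftZ H x) / (m%:R * n%:R ^+ 2)) +
  (\sum_(x < (2 * H)%N) E x * sl (shiftZ H x) - Vol s X Y t / (m * n)%:R) / (m%:R * n%:R ^+ 2).
  rewrite mulrBl mulr_suml addrA -big_split /=; congr (_ - _).
    by apply: eq_bigr => x _; rewrite mulrBr mulrA subrK.
  by rewrite natrM; field; rewrite !lt0r_neq0.
apply: le_trans (ler_normD _ _) _; apply: lerD.
  apply: le_trans (ler_norm_sum _ _ _) _; rewrite mulr_sumr; apply: ler_sum => x _.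
  have E0 : 0 <= E x by rewrite mulr_ge0.
  rewrite normrM (ger0_norm E0) [leRHS]mulrCA; apply: ler_wpM2l => //.
  by rewrite -NE; apply: inner_crt.
rewrite normrM (@ger0_norm _ (_^-1)) ?invr_ge0 ?(ltW M0) //.
by apply: ler_wpM2r; [rewrite invr_ge0 ltW | exact: outer_crt].
Qed.
End Slices.

Lemma sum_pick (m : nat) (A : int) (F : nat -> R) : (0 < m)%N ->
  \sum_(a < m) (idvd m (A - (nat_of_ord a)%:Z))%:R * F a = F `|(A %% m%:Z)%Z|%N.
Proof.
move=> m0; have mz : m%:Z != 0 by rewrite eqz_nat -lt0n.
have km : (`|(A %% m%:Z)%Z| < m)%N by rewrite -ltz_nat gez0_abs ?modz_ge0 // ltz_pmod // ltz_nat.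
rewrite (bigD1 (Ordinal km)) //= big1 ?addr0.
  rewrite /idvd gez0_abs ?modz_ge0 // -eqz_mod_dvd modz_mod eqxx mul1r //.
move=> a /eqP ak; case E: (idvd _ _); last by rewrite mul0r.
case: ak; apply/val_inj => /=; move: E; rewrite /idvd -eqz_mod_dvd => /eqP ->.
by rewrite modz_small // ltz_nat ltn_ord.
Qed.

Lemma congruence_sum (m : nat) (L : set VZ) i (A B : int) : (0 < m)%N -> congruence_mod m L ->
  (`[< L (i, A, B) >])%:R = \sum_(a < m) \sum_(b < m) (`[< L (i, (nat_of_ord a)%:Z, (nat_of_ord b)%:Z) >])%:R *
    ((idvd m (A - (nat_of_ord a)%:Z))%:R * (idvd m (B - (nat_of_ord b)%:Z))%:R) :> R.
Proof.
move=> m0 cL; have mz : m%:Z != 0 by rewrite eqz_nat -lt0n.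
transitivity (\sum_(a < m) (idvd m (A - (nat_of_ord a)%:Z))%:R *
   (fun a : nat => \sum_(b < m) (idvd m (B - (nat_of_ord b)%:Z))%:R *
     (fun b : nat => (`[< L (i, a%:Z, b%:Z) >])%:R : R) b) a); last first.
  apply: eq_bigr => a _; rewrite mulr_sumr; apply: eq_bigr => b _ /=; ring.
rewrite (@sum_pick m A (fun a : nat => \sum_(b < m) (idvd m (B - (nat_of_ord b)%:Z))%:R *
     (`[< L (i, a%:Z, (nat_of_ord b)%:Z) >])%:R) m0).
rewrite (@sum_pick m B (fun b : nat => (`[< L (i, `|(A %% m%:Z)%Z|%N%:Z, b%:Z) >])%:R) m0).
congr (_%:R); congr nat_of_bool; apply: asbool_equiv_eq.
by apply: cL => //=; rewrite gez0_abs ?modz_ge0 // modz_mod.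
Qed.

Lemma rootset_sum (t A : int) n : \sum_(r < n)
  (idvd n (A - (- (3 * (nat_of_ord r)%:Z ^+ 2 + 2 * t * (nat_of_ord r)%:Z))))%:R = #|rootset t A n|%:R :> R.
Proof.
rewrite -sum1_card [in RHS]big_mkcond /= natr_sum; apply: eq_bigr => r _.
rewrite finset.inE /idvd /dq opprK addrC; by case: ifP.
Qed.

Lemma exchange_big3 (p q k : nat) (F : 'I_p -> 'I_q -> 'I_k -> R) :
  \sum_(x < p) \sum_(y < q) \sum_(r < k) F x y r = \sum_(r < k) \sum_(x < p) \sum_(y < q) F x y r.
Proof. by rewrite [RHS]exchange_big /=; apply: eq_bigr => x _; rewrite exchange_big. Qed.

Lemma norm_diam (c x y : R) : `|x| <= 2 * c -> `|y| <= 2 * c -> y - x <= 4 * c.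
Proof. by rewrite !ler_norml => /andP[h1 h2] /andP[h3 h4]; lra. Qed.

Section BoxCount.
Variables (s X Y : R) (i : 'I_3) (H m n : nat) (L : set VZ) (rho : R).
Hypothesis Y1 : 1 <= Y.
Hypothesis HY : 2 * Y ^+ 3 + 1 <= H%:R.
Hypothesis m0 : (0 < m)%N.
Hypothesis n0 : (0 < n)%N.
Hypothesis sn : squarefree n.
Hypothesis cop : coprime m n.
Hypothesis cL : congruence_mod m L.
Hypothesis rho_ge : forall A, #|rootset (Defs.tval i) A n|%:R <= rho.

Let t : R := (Defs.tval i)%:~R.
Let lw (a b : nat) : R := (`[< L (i, a%:Z, b%:Z) >])%:R.
Let al (r : nat) : int := - (3 * r%:Z ^+ 2 + 2 * Defs.tval i * r%:Z).
Let be (r : nat) (A : int) : int := - (r%:Z ^+ 3 + Defs.tval i * r%:Z ^+ 2 + A * r%:Z).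

Definition inN (A B : int) : bool :=
  [&& inD s X Y t A B, `[< L (i, A, B) >] & `[< exists r, dbl_root (Defs.tval i) A B n r >]].

Lemma inN_sum A B : (inN A B)%:R = \sum_(r < n) \sum_(a < m) \sum_(b < m) lw a b *
  ((idvd m (A - (nat_of_ord a)%:Z))%:R * (idvd n (A - al r))%:R *
   ((idvd m (B - (nat_of_ord b)%:Z))%:R * (idvd (n ^ 2) (B - be r A))%:R * (inD s X Y t A B)%:R)) :> R.
Proof.
have E3 (b1 b2 b3 : bool) : ([&& b1, b2 & b3])%:R = b1%:R * (b2%:R * b3%:R) :> R.
  by case: b1 b2 b3 => [] [] [] /=; ring.
rewrite /inN E3 (congruence_sum i A B m0 cL) (dbl_root_sum _ _ _ n0 sn) natr_sum !mulr_sumr.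
apply: eq_bigr => r _; rewrite dbl_rootE -/(al r) -/(be r A) -mulnb natrM [LHS]mulrCA mulr_suml.
apply: eq_bigr => a _; rewrite mulr_suml; apply: eq_bigr => b _; rewrite /lw; ring.
Qed.

Lemma norm_tval_le1 : `|t| <= 1.
Proof. by rewrite /t; case: i => [[|[|[|k]]] Hk] //; rewrite /Defs.tval /= ?normrN1 ?normr0 ?normr1 ?ler01. Qed.

Lemma count_short : \sum_(x < (2 * H)%N) (`|(shiftZ H x)%:~R| <= 2 * Y ^+ 2 :> R)%:R <= 5 * Y ^+ 2 :> R.
Proof.
have Y2 : 1 <= Y ^+ 2 by rewrite exprn_ege1.
apply: le_trans (_ : 4 * Y ^+ 2 + 1 <= _); last by lra.
have := @count_diam R (fun x => `|x| <= 2 * Y ^+ 2) (- H%:R) (4 * Y ^+ 2) (2 * H)%N.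
have h0 : 0 <= 4 * Y ^+ 2 by lra.
move=> /(_ h0) h; apply: le_trans (h _).
  rewrite le_eqVlt; apply/orP; left; apply/eqP; apply: eq_bigr => x _.
  by rewrite /shiftZ; have -> : (x%:Z - H%:Z)%:~R = - H%:R + x%:R :> R by ring.
by move=> x y _; exact: norm_diam.
Qed.

(** The constants are [90 = 18 * 5], from [inner_count] and [count_short], and [36] from
    [outer_count], which occurs for [n*m^2] triples with weight [1/(m*n^2)]. *)
Lemma count_box : `| \sum_(x < (2 * H)%N) \sum_(y < (2 * H)%N) (inN (shiftZ H x) (shiftZ H y))%:R -
    (\sum_(a < m) \sum_(b < m) lw a b) / (m%:R ^+ 2 * n%:R ^+ 2) * Vol s X Y t|
  <= 90 * (m%:R * rho * Y ^+ 2) + 36 * (m%:R * Y ^+ 3 / n%:R).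
Proof.
have mR : 0 < m%:R :> R by rewrite ltr0n.
have nR : 0 < n%:R :> R by rewrite ltr0n.
pose E r a x : R := (idvd m (shiftZ H x - a%:Z))%:R * (idvd n (shiftZ H x - al r))%:R.
pose G r a b : R := \sum_(x < (2 * H)%N) \sum_(y < (2 * H)%N)
  (idvd m (shiftZ H x - a%:Z))%:R * (idvd n (shiftZ H x - al r))%:R *
   ((idvd m (shiftZ H y - b%:Z))%:R * (idvd (n ^ 2) (shiftZ H y - be r (shiftZ H x)))%:R *
     (inD s X Y t (shiftZ H x) (shiftZ H y))%:R).
pose e : R := 36 * Y ^+ 3 / (m%:R * n%:R ^+ 2).
pose v : R := Vol s X Y t / (m%:R ^+ 2 * n%:R ^+ 3).
pose S (x : nat) : R := (`|(shiftZ H x)%:~R| <= 2 * Y ^+ 2 :> R)%:R.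
have -> : \sum_(x < (2 * H)%N) \sum_(y < (2 * H)%N) (inN (shiftZ H x) (shiftZ H y))%:R =
  \sum_(r < n) \sum_(a < m) \sum_(b < m) lw a b * G r a b.
  under eq_bigr do under eq_bigr do rewrite inN_sum.
  rewrite exchange_big3; apply: eq_bigr => r _; rewrite exchange_big3; apply: eq_bigr => a _.
  rewrite exchange_big3; apply: eq_bigr => b _; rewrite /G mulr_sumr; apply: eq_bigr => x _.
  by rewrite mulr_sumr.
have -> : (\sum_(a < m) \sum_(b < m) lw a b) / (m%:R ^+ 2 * n%:R ^+ 2) * Vol s X Y t =
  \sum_(r < n) \sum_(a < m) \sum_(b < m) lw a b * v.
  rewrite [RHS](eq_bigr (fun _ => (\sum_(a < m) \sum_(b < m) lw a b) * v)); last first.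
    by move=> r _; rewrite mulr_suml; apply: eq_bigr => a _; rewrite mulr_suml.
  rewrite sumr_const card_ord -mulr_natl /v; field; by rewrite !lt0r_neq0.
rewrite -sumrB; apply: le_trans (_ : \sum_(r < n) \sum_(a < m) \sum_(b < m)
    (18 * (\sum_(x < (2 * H)%N) E r a x * S x) + e) <= _).
  apply: le_trans (ler_norm_sum _ _ _) _; apply: ler_sum => r _.
  rewrite -sumrB; apply: le_trans (ler_norm_sum _ _ _) _; apply: ler_sum => a _.
  rewrite -sumrB; apply: le_trans (ler_norm_sum _ _ _) _; apply: ler_sum => b _.
  rewrite -mulrBr normrM; have le1 : `|lw a b| <= 1 by rewrite /lw; case: asboolP; rewrite ?normr1 ?normr0.
  apply: le_trans (_ : 1 * `|G r a b - v| <= _); first by apply: ler_wpM2r.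
  rewrite mul1r; exact: (cell_count s X Y1 norm_tval_le1 HY a b (al r) (be r) m0 n0 cop).
(* For fixed [A] exactly one [a] survives and the surviving [r] form [rootset], so the sum over [r]
   costs [rho] instead of [n]. *)
have -> : \sum_(r < n) \sum_(a < m) \sum_(b < m) (18 * (\sum_(x < (2 * H)%N) E r a x * S x) + e) =
  m%:R * (18 * \sum_(x < (2 * H)%N) #|rootset (Defs.tval i) (shiftZ H x) n|%:R * S x) + n%:R * m%:R ^+ 2 * e.
  have const k (f : 'I_k -> R) z : \sum_(j < k) (f j + z) = \sum_(j < k) f j + k%:R * z.
    by rewrite big_split /= sumr_const card_ord mulr_natl.
  rewrite (eq_bigr (fun r : 'I_n => (m%:R * (18 * \sum_(a < m) \sum_(x < (2 * H)%N) E r a x * S x) + m%:R ^+ 2 * e))).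
    rewrite const -!mulr_sumr; congr (_ * (_ * _) + _); last by rewrite mulrA.
    under eq_bigr do rewrite exchange_big /=.
    rewrite exchange_big /=; apply: eq_bigr => x _.
    rewrite -rootset_sum mulr_suml; apply: eq_bigr => r _; rewrite -mulr_suml; congr (_ * _).
    by rewrite (@sum_pick m (shiftZ H x) (fun _ => (idvd n (shiftZ H x - al r))%:R)).
  move=> r _; rewrite (eq_bigr (fun a : 'I_m => (m%:R * (18 * \sum_(x < (2 * H)%N) E r a x * S x) + m%:R * e))).
    by rewrite const -!mulr_sumr; ring.
  by move=> a _; rewrite sumr_const card_ord -[LHS]mulr_natl mulrDr.
apply: lerD; last first.
  by rewrite /e le_eqVlt; apply/orP; left; apply/eqP; field; rewrite !lt0r_neq0.
rewrite [leRHS](_ : _ = m%:R * (18 * (rho * (5 * Y ^+ 2)))); last by ring.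
apply: ler_wpM2l; first exact: ltW.
apply: ler_wpM2l; first by rewrite ler0n.
apply: le_trans (_ : rho * \sum_(x < (2 * H)%N) S x <= _).
  rewrite mulr_sumr; apply: ler_sum => x _; apply: ler_wpM2r; [by rewrite /S ler0n | exact: rho_ge].
apply: ler_wpM2l; last exact: count_short.
by apply: le_trans (rho_ge 0).
Qed.
End BoxCount.
End Counting.

(** * Assembly *)

Lemma shiftZ_abs (H : nat) (z : int) : - H%:Z < z < H%:Z ->
  exists x : 'I_(2 * H)%N, shiftZ H x = z.
Proof.
move=> /andP[h1 h2]; have xx : (`|(z + H%:Z)%R| < 2 * H)%N by lia.
by exists (Ordinal xx); rewrite /shiftZ /= gez0_abs ?addrK //; lia.
Qed.

Lemma countV_sum (S : set VZ) (H : nat) :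
  (forall f, S f -> - H%:Z < Acoef f < H%:Z /\ - H%:Z < Bcoef f < H%:Z) ->
  countV S = (\sum_(i < 3) \sum_(x < (2 * H)%N) \sum_(y < (2 * H)%N) `[< S (i, shiftZ H x, shiftZ H y) >])%N.
Proof.
move=> SH.
pose T := ('I_3 * 'I_(2 * H) * 'I_(2 * H))%type.
pose phi (u : T) : VZ := (u.1.1, shiftZ H u.1.2, shiftZ H u.2).
have phi_inj : injective phi.
  move=> [[i x] y] [[i' x'] y'] [-> hx hy].
  by congr (_, _, _); apply/val_inj; [move: hx | move: hy] => /addIr [].
pose s := [seq phi u | u <- enum {: 'I_3 * 'I_(2 * H) * 'I_(2 * H)} & `[< S (phi u) >]].
have us : uniq s by rewrite map_inj_uniq // filter_uniq // enum_uniq.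
have memS f : (f \in s) = `[< S f >].
  apply/mapP/asboolP => [[u]|Sf].
    by rewrite mem_filter => /andP[/asboolP h _] ->.
  have [hA hB] := SH _ Sf; have [x xE] := shiftZ_abs hA; have [y yE] := shiftZ_abs hB.
  have fE : f = phi (f.1.1, x, y).
    by rewrite /phi /= xE yE; case: (f) => [[]].
  by exists (f.1.1, x, y) => //; rewrite mem_filter mem_enum andbT; apply/asboolP; rewrite -fE.
have SE : S = [set` [fset f in s]%fset].
  by apply/seteqP; split=> f /=; rewrite finmap.inE /= memS => /asboolP.
rewrite /countV {1}SE set_fsetK.
have -> : (#|` [fset f in s]%fset| = size s)%N.
  by rewrite card_fseq undup_id.
rewrite size_map -sum1_size big_filter big_mkcond /= big_enum /=.
rewrite pair_bigA pair_bigA /=; apply: eq_bigr => -[[i x] y] _.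
by rewrite /phi /=; case: asboolP.
Qed.

Section Assembly.
Variable R : realType.
Local Notation mu := (@lebesgue_measure R).
Local Notation Vol s X Y t := (fine ((mu \x mu)%E (region s X Y t))).

Lemma measure_box (D : set (R * R)) (a b : R) : measurable D -> 0 < a -> 0 < b ->
  (forall x y, D (x, y) -> `|x| <= a /\ `|y| <= b) -> ((mu \x mu)%E D <= (4 * (a * b))%:E)%E.
Proof.
move=> mD a0 b0 DE; pose I (c : R) : set R := `[- c, c]%classic.
have mI (c : R) : measurable (I c) by exact: measurable_itv.
have len (c : R) : 0 < c -> mu (I c) = (2 * c)%:E.
  move=> c0; rewrite lebesgue_measure_itv /= lte_fin ifT; last by lra.
  by rewrite -EFinB; congr (_%:E); ring.
apply: (@le_trans _ _ ((mu \x mu)%E (I a `*` I b))).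
  have mX : measurable (I a `*` I b : set (R * R)) by exact: measurableX.
  apply: le_measure; [exact: mem_set | exact: mem_set | ].
  by move=> [x y] /DE[h1 h2]; split=> /=; rewrite /I /= in_itv /= -ler_norml.
have -> : (mu \x mu)%E (I a `*` I b) = (mu (I a) * mu (I b))%E by exact: (product_measure1E mu mu (mI a) (mI b)).
by rewrite (len a a0) (len b b0) -EFinM lee_fin le_eqVlt; apply/orP; left; apply/eqP; ring.
Qed.

(** A description by polynomial inequalities valid for every [Y > 0], from which measurability
    follows. *)
Lemma VR_region_small (s X Y : R) (i : 'I_3) : 0 < Y -> VR_region s X Y i =
  region s X Y (Defs.tval i)%:~R `&` ([set z | 0 < Y ^+ 3 - z.2] `&` [set z | 0 < Y ^+ 3 + z.2]).
Proof.
move=> Y0; apply/seteqP; split=> -[A B] /=.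
  move=> [h1 [h2 h3]]; have [J] := hR_lt_jury Y0 h3.
  rewrite /= ltr_norml => /andP[b1 b2]; split; [by [] | split; first by rewrite subr_gt0].
  by rewrite addrC -[Y ^+ 3]opprK subr_gt0.
move=> [[h1 [h2 h3]] [h4 h5]]; split=> //; split=> //.
by apply: jury_hR_lt_small => //; rewrite ltr_norml; apply/andP; split; rewrite -subr_gt0 // opprK addrC.
Qed.

Lemma measurable_VR_region (s X Y : R) (i : 'I_3) : 0 < Y -> measurable (VR_region s X Y i).
Proof.
move=> Y0; rewrite VR_region_small //.
have m2 : measurable_fun setT (snd : R * R -> R) by exact: measurable_snd.
apply: measurableI; first exact: measurable_region.
by apply: measurableI; apply: measurable_pos; [apply: measurable_funB | apply: measurable_funD].
Qed.

Lemma VR_region_box (s X Y : R) (i : 'I_3) A B : 0 < Y -> VR_region s X Y i (A, B) ->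
  `|A| <= Y ^+ 2 + Y /\ `|B| <= Y ^+ 3.
Proof.
move=> Y0 [_ [_ /= h]]; have [J B1] := hR_lt_jury Y0 h; split; last exact: ltW.
have /andP[h1 h2] := jury_bounds Y0 (norm_tval_le1 R i) J B1.
by rewrite ler_norml; apply/andP; split; [apply: ltW; lra | exact: ltW].
Qed.

Lemma VR_region_fin (s X Y : R) (i : 'I_3) : 0 < Y -> (mu \x mu)%E (VR_region s X Y i) \is a fin_num.
Proof.
move=> Y0; have a0 : 0 < Y ^+ 2 + Y by rewrite addr_gt0 ?exprn_gt0.
have b0 : 0 < Y ^+ 3 by rewrite exprn_gt0.
rewrite ge0_fin_numE //; apply: le_lt_trans (measure_box (measurable_VR_region _ _ _ Y0) a0 b0 _) (ltry _).
by move=> A B; exact: VR_region_box.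
Qed.

Lemma VolR_fine (s X Y : R) : 0 < Y ->
  VolR s X Y = (\sum_(i < 3) fine ((mu \x mu)%E (VR_region s X Y i)))%:E.
Proof.
by move=> Y0; rewrite /VolR -sumEFin; apply: eq_bigr => i _; rewrite fineK // VR_region_fin.
Qed.

(** If all roots have modulus less than [1], then [|B| < 1] gives [B = 0], and Jury's inequalities
    at radius one leave only [A = 0]; the cubic then has a double root at [0]. *)
Lemma hR_small (t A B : int) (Y : R) : Y < 1 -> `|t| <= 1 ->
  hR t%:~R A%:~R B%:~R < Y -> disc t A B = 0.
Proof.
move=> Y1 t1 hY; have h1 := lt_trans hY Y1.
have [[f1 f2 P]] := hR_lt_jury ltr01 h1.
rewrite expr1n -intr_norm ltrz1 => B0; have {B0} B0 : B = 0 by lia.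
move: f1 f2 P; rewrite B0 /pairprod !expr1n ?mulr1.
rewrite !mulr0z !addr0 mulr0 expr0n subr0 addr0 => f1 f2 P.
have A1 : A < 1.
  by rewrite -(ltr_int R); move: P; clear; lra.
have f1' : 0 < 1 + t + A by rewrite -(ltr_int R) !rmorphD /=; move: f1; clear; lra.
have f2' : - 1 + t - A < 0 by rewrite -(ltr_int R) !(rmorphD, rmorphN) /=; move: f2; clear; lra.
have -> : A = 0 by lia.
by rewrite /disc; ring.
Qed.

(** The index [inord 1] encodes [t = 0]. *)
Lemma mean_dist (V : 'I_3 -> R) (D : R) : (forall i, `|V i - V (inord 1)| <= D) ->
  forall i, `|V i - (\sum_(j < 3) V j) / 3| <= 2 * D.
Proof.
move=> h i; have D0 : 0 <= D by apply: le_trans (h i).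
set v := V (inord 1) in h *.
have E : (\sum_(j < 3) V j) / 3 - v = (\sum_(j < 3) (V j - v)) / 3.
  by rewrite sumrB sumr_const card_ord -[v *+ 3]mulr_natr mulrBl mulfK // pnatr_eq0.
have -> : V i - (\sum_(j < 3) V j) / 3 = (V i - v) - ((\sum_(j < 3) V j) / 3 - v) by ring.
rewrite E; apply: le_trans (ler_normB _ _) _; rewrite mulr_natl mulr2n; apply: lerD => //.
rewrite normrM (@ger0_norm _ (3^-1)) ?invr_ge0 ?ler0n // ler_pdivrMr ?ltr0n //.
apply: le_trans (ler_norm_sum _ _ _) _; apply: le_trans (ler_sum _ (fun j _ => h j)) _.
by rewrite sumr_const card_ord mulr_natr.
Qed.

(** The expected main term sees only the sum of the weights [l i], which may be unequal. Replacing
    each [V i] by the mean costs at most [2 * D / n^2] per value of [t]. *)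
Lemma main_term (N V l : 'I_3 -> R) (m n e D : R) : 0 < m -> 0 < n ->
  (forall i, 0 <= l i <= m ^+ 2) ->
  (forall i, `|N i - l i / (m ^+ 2 * n ^+ 2) * V i| <= e) ->
  (forall i, `|V i - V (inord 1)| <= D) ->
  `|\sum_(i < 3) N i - (\sum_(i < 3) l i) / (3 * m ^+ 2) * (n ^+ 2)^-1 * \sum_(i < 3) V i|
    <= 3 * e + 6 * (D / n ^+ 2).
Proof.
move=> m0 n0 hl hN hV; set W := (\sum_(i < 3) V i) / 3.
have M0 : 0 < m ^+ 2 * n ^+ 2 by rewrite mulr_gt0 ?exprn_gt0.
have -> : \sum_(i < 3) N i - (\sum_(i < 3) l i) / (3 * m ^+ 2) * (n ^+ 2)^-1 * \sum_(i < 3) V i =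
   \sum_(i < 3) ((N i - l i / (m ^+ 2 * n ^+ 2) * V i) + l i / (m ^+ 2 * n ^+ 2) * (V i - W)).
  rewrite [RHS](eq_bigr (fun i => N i - l i * (W / (m ^+ 2 * n ^+ 2)))); last by move=> i _; ring.
  rewrite sumrB -mulr_suml /W; congr (_ - _); field; by rewrite !lt0r_neq0.
apply: le_trans (ler_norm_sum _ _ _) _.
apply: le_trans (_ : \sum_(i < 3) (e + 2 * (D / n ^+ 2)) <= _).
  apply: ler_sum => i _; apply: le_trans (ler_normD _ _) _; apply: lerD => //.
  have /andP[l0 l1] := hl i.
  rewrite normrM ger0_norm ?divr_ge0 ?(ltW M0) //.
  apply: le_trans (_ : (n ^+ 2)^-1 * (2 * D) <= _); last by rewrite mulrC mulrA.
  apply: ler_pM => //; last exact: mean_dist.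
    by rewrite divr_ge0 ?(ltW M0).
  rewrite ler_pdivrMr // mulrC mulfK // lt0r_neq0 // exprn_gt0 //.
by rewrite sumr_const card_ord -[leLHS]mulr_natl le_eqVlt; apply/orP; left; apply/eqP; ring.
Qed.

Lemma powR_inv_le (n : nat) (eps : R) : (0 < n)%N -> 0 < eps -> n%:R^-1 <= (n%:R `^ (1 - eps))^-1 :> R.
Proof.
move=> n0 e0; have n1 : 1 <= n%:R :> R by rewrite ler1n.
have nR : 0 < n%:R :> R by rewrite ltr0n.
rewrite lef_pV2 ?posrE ?powR_gt0 // -[leRHS]powRr1 ?ler0n //.
by apply: ler_powR => //; rewrite gerBl ltW.
Qed.

Section Main.
Variables (m n : nat) (L : set VZ) (X Y eps C0 : R) (b : bool).
Hypothesis m0 : (0 < m)%N.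
Hypothesis n0 : (0 < n)%N.
Hypothesis sn : squarefree n.
Hypothesis cop : coprime m n.
Hypothesis cL : congruence_mod m L.
Hypothesis X0 : 0 < X.
Hypothesis Y0 : 0 < Y.
Hypothesis eps0 : 0 < eps.
Hypothesis C0_ge0 : 0 <= C0.
Hypothesis C0_bound : forall t A, #|rootset t A n|%:R <= C0 * n%:R `^ eps.

Let S : set VZ := [set f | L f /\ Sigma n f /\ 0 < sgnb R b * (discZ f)%:~R /\
                   `|(discZ f)%:~R| < X /\ hZ R f < Y].
Let V (i : 'I_3) : R := fine ((mu \x mu)%E (VR_region (sgnb R b) X Y i)).
Let l (i : 'I_3) : R := \sum_(a < m) \sum_(c < m) (`[< L (i, (nat_of_ord a)%:Z, (nat_of_ord c)%:Z) >])%:R.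

Lemma weight_bound i : 0 <= l i <= m%:R ^+ 2.
Proof.
rewrite /l; apply/andP; split.
  by apply: sumr_ge0 => a _; apply: sumr_ge0 => c _; rewrite ler0n.
apply: le_trans (_ : \sum_(a < m) \sum_(c < m) (1 : R) <= _).
  by apply: ler_sum => a _; apply: ler_sum => c _; rewrite lern1 leq_b1.
by rewrite !sumr_const !card_ord -[leLHS]mulr_natr expr2.
Qed.

Lemma nu_weights : nu R L = (\sum_(i < 3) l i) / (3 * m%:R ^+ 2).
Proof.
rewrite (nu_congruence R m0 cL) natrM natrX natr_sum; congr (_ / _).
by apply: eq_bigr => i _; rewrite natr_sum; apply: eq_bigr => a _; rewrite natr_sum.
Qed.

Lemma S_region f : S f <-> L f /\ VR_region (sgnb R b) X Y f.1.1 ((Acoef f)%:~R, (Bcoef f)%:~R) /\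
  exists r, dbl_root (tcoef f) (Acoef f) (Bcoef f) n r.
Proof.
have E : (discZ f)%:~R = disc (tcoef f)%:~R (Acoef f)%:~R (Bcoef f)%:~R :> R by rewrite /discZ rmorph_disc.
rewrite /S /VR_region /= -E; split.
  by move=> [h1 [/(Sigma_dbl_root f n0 sn)[h2 h3] [h4 [h5 h6]]]].
move=> [h1 [[h4 [h5 h6]] h3]]; split=> //; split=> //; apply/(Sigma_dbl_root f n0 sn); split=> //.
by apply/eqP => d0; move: h4; rewrite d0 mulr0 ltxx.
Qed.

Lemma count_large : 1 <= Y -> `|(countV S)%:R - nu R L * nu R (Sigma n) * \sum_(i < 3) V i| <=
  (34 * 1000 + 270 * C0) * (Y ^+ 3 * m%:R / (n%:R `^ (1 - eps)) + Y ^+ 2 * m%:R * n%:R `^ eps).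
Proof.
move=> Y1; pose H := Num.Def.archi_bound (2 * Y ^+ 3 + 1).
have Y3 : 0 < Y ^+ 3 by rewrite exprn_gt0.
have HY : 2 * Y ^+ 3 + 1 <= H%:R by apply: ltW; apply: archi_boundP; lra.
have mR : 1 <= m%:R :> R by rewrite ler1n.
have nR : 1 <= n%:R :> R by rewrite ler1n.
have mp : 0 < m%:R :> R by rewrite ltr0n.
have np : 0 < n%:R :> R by rewrite ltr0n.
have t1 i := norm_tval_le1 R i.
have SE i A B : `[< S (i, A, B) >] = inN (sgnb R b) X Y i n L A B.
  apply/asboolP/idP => [/S_region[/= h1 [h2 h3]]|/and3P[/asboolP h2 /asboolP h1 /asboolP h3]].
    by apply/and3P; split; apply/asboolP; rewrite // -VR_regionE.
  by apply/S_region; split=> //; split=> //; rewrite VR_regionE.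
have SH f : S f -> - H%:Z < Acoef f < H%:Z /\ - H%:Z < Bcoef f < H%:Z.
  move=> /S_region[_ [h _]]; rewrite VR_regionE // in h; have [h1 h2] := slice_box Y1 (t1 _) h.
  split; apply: (box_int HY); [apply: le_trans h1 _ | apply: le_trans h2 _; lra].
  by rewrite ler_pM2l // Y23.
pose N i : R := \sum_(x < (2 * H)%N) \sum_(y < (2 * H)%N) (inN (sgnb R b) X Y i n L (shiftZ H x) (shiftZ H y))%:R.
have -> : (countV S)%:R = \sum_(i < 3) N i.
  rewrite (countV_sum SH) natr_sum; apply: eq_bigr => i _; rewrite natr_sum; apply: eq_bigr => x _.
  by rewrite natr_sum; apply: eq_bigr => y _; rewrite SE.
rewrite nu_weights (nu_Sigma R n0 sn).
pose e := 90 * (m%:R * (C0 * n%:R `^ eps) * Y ^+ 2) + 36 * (m%:R * Y ^+ 3 / n%:R).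
apply: le_trans (@main_term N V l m%:R n%:R e (5500 * Y ^+ 3) mp np weight_bound _ _) _.
- move=> i; rewrite /V VR_regionE //.
  exact: (count_box (sgnb R b) X Y1 HY m0 n0 sn cop cL (C0_bound _)).
- move=> i; rewrite /V !VR_regionE //.
  have -> : Defs.tval (inord 1) = 0 by rewrite /Defs.tval inordK.
  have [->|[->|->]] : Defs.tval i = 0 \/ (Defs.tval i = 1 \/ Defs.tval i = -1).
  + by case: (i) => [[|[|[|k]]] hk] //; [right; right | left | right; left].
  + by rewrite subrr normr0; lra.
  + by apply: vol_cmp => //; left.
  + by apply: vol_cmp => //; right.
set P := n%:R `^ (1 - eps); set Q := n%:R `^ eps.
have P0 : 0 < P by rewrite powR_gt0.
have Q0 : 0 < Q by rewrite powR_gt0.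
have nP : n%:R^-1 <= P^-1 by exact: powR_inv_le.
have i0 : 0 <= n%:R^-1 :> R by rewrite invr_ge0 ltW.
have z1 : m%:R * Y ^+ 3 / n%:R <= Y ^+ 3 * m%:R / P.
  by rewrite [m%:R * _]mulrC; apply: ler_wpM2l => //; rewrite mulr_ge0 // ltW.
have z2 : Y ^+ 3 / n%:R ^+ 2 <= Y ^+ 3 * m%:R / P.
  apply: le_trans z1; apply: ler_pM.
  - exact: ltW.
  - by rewrite invr_ge0 exprn_ge0 // ltW.
  - by rewrite ler_peMl // ltW.
  - by rewrite lef_pV2 ?posrE ?exprn_gt0 // expr2 ler_peMl // ltW.
have z3 : 0 <= Y ^+ 2 * m%:R * Q by rewrite !mulr_ge0 ?sqr_ge0 // ltW.
have z4 : 0 <= C0 * (Y ^+ 3 * m%:R / P).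
  by rewrite !mulr_ge0 ?invr_ge0 //; apply: ltW.
have z5 : 0 <= Y ^+ 3 * m%:R / P by rewrite !mulr_ge0 ?invr_ge0 //; apply: ltW.
(* [270 = 3 * 90] and [108 = 3 * 36] come from [count_box], [33 * 1000 = 6 * 5500] from [vol_cmp];
   the last two together stay below [34 * 1000]. *)
have -> : 3 * e + 6 * (5500 * Y ^+ 3 / n%:R ^+ 2) =
  270 * (C0 * (Y ^+ 2 * m%:R * Q)) + 108 * (m%:R * Y ^+ 3 / n%:R) + (33 * 1000) * (Y ^+ 3 / n%:R ^+ 2).
  by rewrite /e -/Q; ring.
rewrite [leRHS](_ : _ = 270 * (C0 * (Y ^+ 2 * m%:R * Q)) + (34 * 1000) * (Y ^+ 3 * m%:R / P) +
   (34 * 1000) * (Y ^+ 2 * m%:R * Q) + 270 * (C0 * (Y ^+ 3 * m%:R / P))); last by ring.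
move: z1 z2 z3 z4 z5; set u1 := _ / n%:R; set u2 := _ / _ ^+ 2; set u3 := _ / P.
set u4 := _ * Q; set u5 := C0 * u3; set u6 := C0 * u4.
by move=> *; lra.
Qed.

(** The count is zero by [hR_small]. Each volume is at most [4 * (2*Y) * Y^3 <= 8*Y^3], so the main
    term is at most [24*Y^3/n^2]. *)
Lemma count_small : Y < 1 -> `|(countV S)%:R - nu R L * nu R (Sigma n) * \sum_(i < 3) V i| <=
  (34 * 1000 + 270 * C0) * (Y ^+ 3 * m%:R / (n%:R `^ (1 - eps)) + Y ^+ 2 * m%:R * n%:R `^ eps).
Proof.
move=> Y1; have Y3 : 0 < Y ^+ 3 by rewrite exprn_gt0.
have mR : 1 <= m%:R :> R by rewrite ler1n.
have nR : 1 <= n%:R :> R by rewrite ler1n.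
have mp : 0 < m%:R :> R by rewrite ltr0n.
have np : 0 < n%:R :> R by rewrite ltr0n.
have S0 f : ~ S f.
  move=> /S_region[_ [[h1 [_ h2]] _]]; move: h1; rewrite /= -(rmorph_disc intr).
  rewrite (hR_small Y1 _ h2) ?mulr0 ?ltxx //.
  by case: (f.1.1) => [[|[|[|k]]] hk].
have -> : countV S = 0%N.
  have SH f : S f -> - 0%N%:Z < Acoef f < 0%N%:Z /\ - 0%N%:Z < Bcoef f < 0%N%:Z by move=> /S0.
  by rewrite (countV_sum SH) big1 // => i _; rewrite big_ord0.
rewrite sub0r normrN nu_weights (nu_Sigma R n0 sn).
have V0 i : 0 <= V i by rewrite fine_ge0.
have Vb i : V i <= 8 * Y ^+ 3.
  have a0 : 0 < 2 * Y by rewrite mulr_gt0.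
  rewrite -lee_fin fineK ?VR_region_fin //.
  apply: le_trans (measure_box (measurable_VR_region _ _ _ Y0) a0 Y3 _) _.
    move=> A B /(VR_region_box Y0)[h1 h2]; split=> //; apply: le_trans h1 _.
    have : Y ^+ 2 <= Y by rewrite expr2 ler_piMl // ltW.
    lra.
  rewrite lee_fin; have : Y * Y ^+ 3 <= Y ^+ 3 by rewrite ler_piMl // ltW.
  by rewrite -mulrA; lra.
have sV : 0 <= \sum_(i < 3) V i <= 24 * Y ^+ 3.
  rewrite sumr_ge0 //=; apply: le_trans (ler_sum _ (fun i _ => Vb i)) _.
  by rewrite sumr_const card_ord -[leLHS]mulr_natr; lra.
have l1 : 0 <= (\sum_(i < 3) l i) / (3 * m%:R ^+ 2) <= 1.
  have q0 : 0 < 3 * m%:R ^+ 2 :> R by rewrite mulr_gt0 // exprn_gt0.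
  have s0 : 0 <= \sum_(i < 3) l i by apply: sumr_ge0 => i _; case/andP: (weight_bound i).
  rewrite divr_ge0 ?(ltW q0) //= ler_pdivrMr // mul1r.
  apply: le_trans (_ : \sum_(i < 3) m%:R ^+ 2 <= _).
    by apply: ler_sum => i _; case/andP: (weight_bound i).
  by rewrite sumr_const card_ord -[leLHS]mulr_natl.
set P := n%:R `^ (1 - eps); set Q := n%:R `^ eps.
have P0 : 0 < P by rewrite powR_gt0.
have Q0 : 0 < Q by rewrite powR_gt0.
have nP : n%:R^-1 <= P^-1 by exact: powR_inv_le.
have n2 : 0 <= ((n%:R : R) ^+ 2)^-1 <= P^-1.
  rewrite invr_ge0 exprn_ge0 ?(ltW np) //=; apply: le_trans nP.
  by rewrite lef_pV2 ?posrE ?exprn_gt0 // expr2 ler_peMl // ltW.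
case/andP: l1 => l0 l1; case/andP: n2 => n20 n21; case/andP: sV => sV0 sV1.
rewrite ger0_norm; last exact: mulr_ge0 (mulr_ge0 l0 n20) sV0.
apply: le_trans (_ : 1 * P^-1 * (24 * Y ^+ 3) <= _).
  by apply: ler_pM => //; [rewrite mulr_ge0 | apply: ler_pM].
have z3 : 0 <= Y ^+ 2 * m%:R * Q by rewrite !mulr_ge0 ?sqr_ge0 // ltW.
have z5 : Y ^+ 3 / P <= Y ^+ 3 * m%:R / P.
  by rewrite ler_pM2r ?invr_gt0 // ler_peMr // ltW.
have z6 : 0 <= Y ^+ 3 / P by rewrite divr_ge0 // ltW.
apply: le_trans (_ : (34 * 1000) * (Y ^+ 3 * m%:R / P + Y ^+ 2 * m%:R * Q) <= _).
  move: z3 z5 z6; rewrite mul1r [P^-1 * _]mulrC -[24 * _ / P]mulrA; set u1 := _ / P; set u2 := _ * Q; set u3 := _ / P.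
  by move=> *; lra.
apply: ler_wpM2r; last by rewrite lerDl mulr_ge0.
by rewrite addr_ge0 //; apply: le_trans z5.
Qed.
End Main.
End Assembly.

Unset Implicit Arguments.

Theorem theorem3p5 (R : realType) (eps : R) : 0 < eps ->
  exists C : R, 0 < C /\
  forall (m n : nat) (L : set VZ),
    (0 < m)%N -> (0 < n)%N -> squarefree n -> coprime n m ->
    congruence_mod m L ->
    forall (X Y : R) (b : bool), 0 < X -> 0 < Y ->
    (`| (countV [set f | L f /\ Sigma n f /\
                   0 < sgnb R b * (discZ f)%:~R /\
                   `|(discZ f)%:~R| < X /\ hZ R f < Y])%:R%:E
        - (nu R L * nu R (Sigma n))%:E * VolR (sgnb R b) X Y |
     <= (C * (Y ^+ 3 * m%:R / (n%:R `^ (1 - eps))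
              + Y ^+ 2 * m%:R * (n%:R `^ eps)))%:E)%E.
Proof.
move=> eps0; have [C0 C01 C0b] := rootset_bound eps0.
have C00 : 0 <= C0 by apply: le_trans C01.
have C1 : 0 < 34 * 1000 + 270 * C0.
  by apply: ltr_wpDr; [apply: mulr_ge0 => //; rewrite ler0n | apply: mulr_gt0; rewrite ltr0n].
exists (34 * 1000 + 270 * C0); split; first exact: C1.
move=> m n L m0 n0 sn; rewrite coprime_sym => cop cL X Y b X0 Y0.
have C0b' t A : #|rootset t A n|%:R <= C0 * n%:R `^ eps by exact: C0b.
rewrite VolR_fine // -EFinM -EFinB abse_EFin lee_fin.
have [Y1|Y1] := leP 1 Y; [exact: count_large | exact: count_small].
Qed.
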